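(* Let $k\ge2$ and $H\sim\mathcal{H}(n,p,k)$. Assume $\beta\ge n^{3/4}\log n$. There is a polynomial-time algorithm certifying that $\alpha(H)<\beta$ with high probability when $\bar m\ge O_k\!\left(\frac{n^{5k/2}\log^3n}{\beta^{2k}}\right)$.
   Context: $\mathcal{H}(n,p,k)$ is the distribution over $k$-uniform hypergraphs on vertex set $[n]$ in which each of the $\binom nk$ possible hyperedges is included independently with probability $p$; $\bar m=p\binom nk$. An independent set of $H$ is a vertex set containing no hyperedge; $\alpha(H)$ is the maximum size of an independent set. ''$\bar m\ge O_k(g)$'' means $\bar m\ge C_kg$ for a certain constant $C_k$ depending only on $k$. ''With high probability'': probability $1-o(1)$ as $n\to\infty$. A certifying algorithm outputs the bound or ''fail'', never outputs the bound when false, and fails with probability $o(1)$. *)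

(* Defs.v *)
From HB Require Import structures.
From mathcomp Require Import all_boot all_order all_algebra.
From mathcomp Require Import all_classical all_reals all_analysis.
Import Order.TTheory GRing.Theory Num.Theory.
Import numFieldNormedType.Exports.

Set Implicit Arguments.
Unset Strict Implicit.
Unset Printing Implicit Defensive.

(* Polynomial time is meant on the random access machine with the logarithmic
   cost criterion (Aho, Hopcroft and Ullman, "The Design and Analysis of Computer
   Algorithms", chapter 1), which is polynomially equivalent to Turing machines.
   Cells hold natural numbers, and programs use structured control flow instead
   of jumps. *)

Definition memory := nat -> nat.

Inductive binop := Add | Sub | Mul | Div.

Inductive expr :=
| Const of nat
| Cell of expr
| Op of binop & expr & expr.

Inductive prog :=
| Skip
| Store of expr & expr
| Seq of prog & prog
| If of expr & prog & prog
| While of expr & prog.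

(* [Sub] is truncated, and [Div] is Euclidean with [m %/ 0 = 0]. *)
Definition eval_binop (o : binop) : nat -> nat -> nat :=
  match o with Add => addn | Sub => subn | Mul => muln | Div => divn end.

Fixpoint eval (s : memory) (e : expr) : nat :=
  match e with
  | Const c => c
  | Cell a => s (eval s a)
  | Op o a b => eval_binop o (eval s a) (eval s b)
  end.

(* Number of binary digits, with [bitlen 0 = 1]. *)
Definition bitlen (n : nat) : nat := (trunc_log 2 n).+1.

(* Every address and every operand is charged its binary length. *)
Fixpoint eval_cost (s : memory) (e : expr) : nat :=
  match e with
  | Const c => bitlen c
  | Cell a => eval_cost s a + bitlen (eval s a) + bitlen (s (eval s a))
  | Op _ a b =>
      eval_cost s a + eval_cost s b + bitlen (eval s a) + bitlen (eval s b)
  end.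

Definition update (s : memory) (a v : nat) : memory :=
  fun i => if i == a then v else s i.

(* [exec P s t s']: started in memory [s], the program [P] halts after time [t]
   in memory [s'].  A test succeeds when its value is nonzero. *)
Inductive exec : prog -> memory -> nat -> memory -> Prop :=
| ExecSkip s : exec Skip s 1 s
| ExecStore s a e :
    exec (Store a e) s
      (eval_cost s a + eval_cost s e + bitlen (eval s a) + bitlen (eval s e))
      (update s (eval s a) (eval s e))
| ExecSeq P Q s s' s'' t t' :
    exec P s t s' -> exec Q s' t' s'' -> exec (Seq P Q) s (t + t') s''
| ExecIfTrue e P Q s s' t :
    eval s e != 0 -> exec P s t s' ->
    exec (If e P Q) s (eval_cost s e + bitlen (eval s e) + t) s'
| ExecIfFalse e P Q s s' t :
    eval s e = 0 -> exec Q s t s' ->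
    exec (If e P Q) s (eval_cost s e + bitlen (eval s e) + t) s'
| ExecWhileTrue e P s s' s'' t t' :
    eval s e != 0 -> exec P s t s' -> exec (While e P) s' t' s'' ->
    exec (While e P) s (eval_cost s e + bitlen (eval s e) + t + t') s''
| ExecWhileFalse e P s :
    eval s e = 0 ->
    exec (While e P) s (eval_cost s e + bitlen (eval s e)) s.

(* The input occupies the cells 0, 1, ...; the other cells are initially 0. *)
Definition initial (x : seq nat) : memory := nth 0 x.

Definition input_length (x : seq nat) : nat := \sum_(a <- x) bitlen a.

(* The answer is read in cell 0: zero means "fail". *)
Definition accepts (P : prog) (x : seq nat) : Prop :=
  exists t s, exec P (initial x) t s /\ s 0 != 0.

Definition poly_time_on (D : set (seq nat)) (P : prog) : Prop :=
  exists c d : nat, forall x, D x ->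
    exists t s, exec P (initial x) t s /\ t <= c * input_length x ^ d + c.

Definition hypergraph (n : nat) := {set {set 'I_n}}.

Definition uniform (n k : nat) (H : hypergraph n) : bool :=
  [forall e in H, #|e| == k].

Definition independent (n : nat) (H : hypergraph n) (S : {set 'I_n}) : bool :=
  [forall e in H, ~~ (e \subset S)].

Definition alpha (n : nat) (H : hypergraph n) : nat :=
  \max_(S : {set 'I_n} | independent H S) #|S|.

(* The set of base-[n] digits of [i]: for [i < n ^ k], this is the set of
   entries of the [i]-th [k]-tuple of vertices. *)
Definition tuple_support (n k i : nat) : {set 'I_n} :=
  [set v : 'I_n | [exists j : 'I_k, val v == (i %/ n ^ j) %% n]].

(* The number of vertices, the integer threshold, and the adjacency tensor, with
   an entry for each [k]-tuple of vertices (0 on tuples with a repetition). *)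
Definition encode (n k b : nat) (H : hypergraph n) : seq nat :=
  n :: b :: mkseq (fun i => nat_of_bool (tuple_support n k i \in H)) (n ^ k).

Definition encodings (k : nat) : set (seq nat) :=
  [set x | exists n b (H : hypergraph n), uniform k H /\ x = encode k b H]%classic.

Local Open Scope ring_scope.

(* Probability of the event [E] under H(n,p,k): a [k]-uniform [H] has probability
   p ^ #|H| (1 - p) ^ ('C(n, k) - #|H|). *)
Definition prob (R : realType) (n k : nat) (p : R) (E : pred (hypergraph n)) : R :=
  \sum_(H : hypergraph n | uniform k H && E H)
    \prod_(e : {set 'I_n} | #|e| == k) (if e \in H then p else 1 - p).

(* The threshold handed to the machine: for [0 <= beta], the integer [alpha H] is
   less than [beta] iff it is less than the ceiling of [beta]. *)
Definition threshold (R : realType) (beta : R) : nat := `|Num.ceil beta|%N.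

Definition certifies (R : realType) (k : nat) (A : prog) (n : nat) (beta : R)
    (H : hypergraph n) : Prop :=
  accepts A (encode k (threshold beta) H).

Definition fail_prob (R : realType) (k : nat) (A : prog) (n : nat) (p beta : R) : R :=
  @prob R n k p (fun H => ~~ `[< certifies k A beta H >]).

(* Main.v *)
Require Import Defs.
From mathcomp Require Import all_boot all_order all_algebra.
From mathcomp Require Import all_classical all_reals all_analysis.
From mathcomp Require Import zify ring lra.
Import Order.TTheory GRing.Theory Num.Theory.
Import numFieldNormedType.Exports.
(* [Defs] is imported again because its [eval] and [Sub] are shadowed above. *)
Import Defs.

(** Only increasing [k]-tuples of vertices are used, so that the entries of the
    centred adjacency tensor [W] are independent.  Split the coordinates of a tuple
    as [(i, a, b)], with [k/2] coordinates in [a], and either [k/2] in [i] and none in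
    [b] ([k] even) or one in [i] and [(k-1)/2] in [b] ([k] odd).  If [S] is independent,
    then summing [W] over the tuples of [S] gives exactly [- p 'C(#|S|, k)].  By the
    Cauchy-Schwarz inequality over [i], the square of this sum is at most the number of
    values of [i] times the sum of the squared entries of [W] plus the quadratic form
    of the symmetric off-diagonal kernel
    [C (a, b') (a', b) = \sum_i W(i, a, b) W(i, a', b')], and the [m]-th power of
    this form is at most [N^m \tr (C^m)] for [m] a power of two and [N] the size of
    [C].  All of this is integer arithmetic once [p] is replaced by a multiple of
    [n^-k]; the program tries all these multiples, and computes [C^m] with [m] of order
    [log n] by repeated squaring.

    That the bound is good enough for random hypergraphs is shown by the trace method.
    A closed walk that involves [E] distinct tuples contributes at most
    [(2 p n^(k/2))^m n^(- k E / 2)] in expectation, and the numbers of distinct labels [i],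
    [a], [b] it visits are controlled by [E]: either [2 #I <= E] and [#A + #B <= E + 2],
    or [#I + #A <= E + 1].  Hence it suffices to bound the sum over all walks of
    [1 / (n_i^#I n_a^#A n_b^#B)], which is at most [(m!)^3]. *)

Set Implicit Arguments.
Unset Strict Implicit.
Unset Printing Implicit Defensive.

(** * Closed walks *)

Local Open Scope ring_scope.

(** The value of [p] is not part of the input. Soundness holds for every candidate [r / n^k], so all
    of them can be tried, and only the one just below [p] has to succeed. The price is that the
    entries are centred at [ph = r / n^k] instead of [p]: their mean does not vanish, and walks
    visiting an entry only once do not drop out. But [|p - ph| <= n^-k <= n^(-k/2)], and once a
    factor of order [sqrt (p n^(k/2))] per visit is taken out, each distinct entry costs [n^(-k/2)]
    whatever its multiplicity. This is why only the number [E] of distinct tuples matters. On an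
    independent set of size [b] the signal is of order [p^2 b^(2k)]. The noise is [n_i N = n^k]
    times a norm of order [p n^(k/2) m^3], where [m^3] comes from the [m]-th root of [(m!)^3]. With
    [m] of order [log n], the factor [N^(1/m)] is bounded and [m^3] is the [log^3 n] of the
    statement: the signal wins once [p n^k] exceeds a constant times [n^(5k/2) log^3 n / b^(2k)]. *)

Definition distinct (T : eqType) (s : seq T) : nat := size (undup s).

Lemma distinct_cons (T : eqType) (x : T) (s : seq T) :
  distinct (x :: s) = ((x \notin s) + distinct s)%N.
Proof. by rewrite /distinct /=; case: (x \in s). Qed.

Lemma distinct_sub (T : eqType) (s t : seq T) :
  {subset s <= t} -> (distinct s <= distinct t)%N.
Proof.
move=> st; apply: uniq_leq_size (undup_uniq s) _ => x.
by rewrite !mem_undup; apply: st.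
Qed.

Lemma distinct_map_leq (T U : eqType) (f : T -> U) (s : seq T) :
  (distinct (map f s) <= distinct s)%N.
Proof.
elim: s => //= x s IH; rewrite !distinct_cons leq_add //.
have [xs|_] := boolP (x \in s); last exact: leq_b1.
by rewrite (map_f f xs).
Qed.

Lemma big_tuple_cons (R : nmodType) (T : finType) m (F : seq T -> R) :
  \sum_(t : m.+1.-tuple T) F t = \sum_x \sum_(t : m.-tuple T) F (x :: t).
Proof.
rewrite pair_big /=.
rewrite (reindex (fun u : T * m.-tuple T => [tuple of u.1 :: u.2])) //=.
exists (fun t : m.+1.-tuple T => (thead t, [tuple of behead t])).
  by case=> x t _ /=; congr pair; apply: val_inj.
by move=> t _; rewrite [RHS]tuple_eta.
Qed.

Section Linked.
Variables X Y : eqType.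

Definition linked (u v : X * Y) : bool := (u.1 == v.1) || (u.2 == v.2).

(** Pairs are edges of a bipartite graph on [X] and [Y]. A chain of edges with consecutive ones
    sharing an endpoint is connected, so it has at most one vertex more than edges; two chains give
    at most two components, hence the two extra terms. *)
Lemma sorted_linked_distinct2 (p q : seq (X * Y)) :
  sorted linked p -> sorted linked q ->
  (distinct (map fst (p ++ q)) + distinct (map snd (p ++ q)) <=
   distinct (p ++ q) + (p != [::]) + (q != [::]))%N.
Proof.
have cons_new (x : X * Y) s : (distinct (map fst (x :: s)) +
    distinct (map snd (x :: s)) <=
   distinct (map fst s) + distinct (map snd s) + (x \notin s).*2)%N.
  rewrite /= !distinct_cons; have [xs|_] := boolP (x \in s).
    by rewrite !map_f //= !add0n addn0.
  by case: (_ \notin _); case: (_ \notin _) => /=; lia.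
have cons_linked (x y : X * Y) s : linked x y -> (distinct (map fst (x :: y :: s)) +
    distinct (map snd (x :: y :: s)) <=
   distinct (map fst (y :: s)) + distinct (map snd (y :: s)) + (x \notin y :: s))%N.
  move=> lxy; rewrite /= ![distinct (_ :: _ :: _)]distinct_cons.
  have [xs|_] := boolP (x \in y :: s).
    by rewrite -!(map_cons fst) -!(map_cons snd) !map_f //= !add0n addn0.
  have : (x.1 \in y.1 :: map fst s) || (x.2 \in y.2 :: map snd s).
    by rewrite !inE; case/orP: lxy => ->; rewrite ?orbT.
  by case: (x.1 \in _); case: (x.2 \in _) => //=; lia.
have step S u v w t : (S <= t + u -> v <= S + w -> v <= w + t + u)%N by lia.
have step3 S t u v (w : bool) : (S <= t + 0 + u -> v <= S + w.*2 -> v <= w + t + 1 + u)%N.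
  by case: w; lia.
move=> sp sq; elim: p sp => [|x p IH] /=.
  move=> _; rewrite addn0; elim: q sq => [//|x q IH] /=; case: q IH => [|y q] IH /=.
    by move=> _; rewrite /distinct /=.
  move=> /andP[lxy /IH H]; rewrite [distinct (x :: y :: q)]distinct_cons.
  exact: step H (cons_linked x y q lxy).
case: p IH => [|y p] IH /=.
  move=> _; rewrite [distinct (x :: q)]distinct_cons.
  exact: step3 (IH isT) (cons_new x q).
move=> /andP[lxy /IH H]; rewrite [distinct (x :: y :: _)]distinct_cons -addnA.
apply: step (cons_linked x y (p ++ q) lxy); move: H.
by rewrite -addnA.
Qed.

Lemma sorted_linked_distinct (p : seq (X * Y)) :
  sorted linked p ->
  (distinct (map fst p) + distinct (map snd p) <= (distinct p).+1)%N.
Proof.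
move=> sp; have := @sorted_linked_distinct2 p [::] sp isT.
by rewrite cats0 addn0 => /leq_trans -> //; rewrite -addn1 leq_add2l leq_b1.
Qed.

End Linked.

Section Walks.
Variables I A B : eqType.

Implicit Types (s : seq (I * (A * B))) (z : A * B).

(* A closed walk is a list of letters (i_t, (a_t, b_t)); its [t]-th step reads
   the entries (i_t, a_t, b_{t+1}) and (i_t, a_{t+1}, b_t), the last step
   returning to [z]. *)
Definition next_vertex z s : A * B := head z (map snd s).

Fixpoint walk_edges z s : seq (I * A * B) :=
  if s is x :: s' then
    let y := next_vertex z s' in
    [:: (x.1, x.2.1, y.2), (x.1, y.1, x.2.2) & walk_edges z s']
  else [::].

Fixpoint walk_proper z s : bool :=
  if s is x :: s' then (x.2 != next_vertex z s') && walk_proper z s' else true.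

Lemma size_walk_edges z s : size (walk_edges z s) = (size s).*2.
Proof. by elim: s => //= x s ->. Qed.

Lemma walk_edges_key z s e : e \in walk_edges z s -> e.1.1 \in map fst s.
Proof.
elim: s => //= x s IH; rewrite !inE => /or3P[/eqP->|/eqP->|/IH ->] /=;
  by rewrite ?eqxx ?orbT.
Qed.

Lemma walk_edges_mem z s x : x \in s ->
  exists a b, (x.1, x.2.1, b) \in walk_edges z s /\ (x.1, a, x.2.2) \in walk_edges z s.
Proof.
elim: s => //= y s IH; rewrite inE => /orP[/eqP->|/IH [a [b [H1 H2]]]].
  by exists (next_vertex z s).1, (next_vertex z s).2; rewrite !inE !eqxx ?orbT.
by exists a, b; rewrite !inE H1 H2 !orbT.
Qed.

(** A label that does not occur later contributes two entries that do not occur later either, and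
    these differ because the step is not a loop. *)
Lemma walk_distinct_I z s : walk_proper z s ->
  ((distinct (map fst s)).*2 <= distinct (walk_edges z s))%N.
Proof.
elim: s => //= x s IH /andP[xy /IH {}IH].
rewrite !distinct_cons.
have [_|xs] /= := boolP (x.1 \in map fst s); first lia.
have new a b : ((x.1, a, b) \in walk_edges z s) = false.
  by apply: contraNF xs => /walk_edges_key.
rewrite in_cons !new orbF /=; set e := (_ == _).
suff -> : e = false by lia.
apply: contraNF xy => /eqP[ea eb].
by rewrite [x.2]surjective_pairing [next_vertex z s]surjective_pairing -ea eb.
Qed.

(** With [B] forgotten, the walk reads [(i_t, a_t)], [(i_t, a_{t+1})], [(i_{t+1}, a_{t+1})] and so
    on, a single chain of linked edges. *)
Lemma walk_distinct_IA z s :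
  (distinct (map fst s) + distinct (map (fun x => x.2.1) s) <=
   (distinct (walk_edges z s)).+1)%N.
Proof.
pose es := map fst (walk_edges z s).
have srt : sorted (@linked I A) es.
  rewrite /es {es}; elim: s => //= x s; case: s => [|y s] IH /=.
    by rewrite /linked /= eqxx.
  by move: IH => /= ->; rewrite /linked /= !eqxx orbT.
apply: (leq_trans (leq_add _ _)); last first.
- apply: leq_trans (sorted_linked_distinct srt) _.
  exact: distinct_map_leq.
- apply: distinct_sub => a /mapP[x xs ->].
  have [a' [b' [H _]]] := walk_edges_mem z xs.
  by apply/mapP; exists (x.1, x.2.1) => //; apply/mapP; exists (x.1, x.2.1, b').
- apply: distinct_sub => a /mapP[x xs ->].
  have [a' [b' [H _]]] := walk_edges_mem z xs.
  by apply/mapP; exists (x.1, x.2.1) => //; apply/mapP; exists (x.1, x.2.1, b').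
Qed.

(* The entries met alternately as first and second factor of the steps; two
   consecutive ones share their [A]- or their [B]-coordinate. *)
Fixpoint zigzag (f : bool) z s : seq (A * B) :=
  if s is x :: s' then
    let y := next_vertex z s' in
    (if f then (x.2.1, y.2) else (y.1, x.2.2)) :: zigzag (~~ f) z s'
  else [::].

Lemma zigzag_linked f z s : sorted (@linked A B) (zigzag f z s).
Proof.
elim: s f => //= x s IH f; case: s IH => [|y s] IH //=.
have /= -> := IH (~~ f); rewrite andbT /linked.
by case: f => /=; rewrite eqxx ?orbT.
Qed.

Lemma zigzag_edges z s :
  map (fun e => (e.1.2, e.2)) (walk_edges z s) =i zigzag true z s ++ zigzag false z s.
Proof.
elim: s => //= x s IH e; rewrite !inE IH !mem_cat /= !inE.
by case: (e == _); case: (e == _); rewrite /= ?orbT //= orbC.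
Qed.

(** With [I] forgotten, the two entries of one step need not touch. The edges split into two zigzags
    of opposite phase, so there may be two components. *)
Lemma walk_distinct_AB z s :
  (distinct (map (fun x => x.2.1) s) + distinct (map (fun x => x.2.2) s) <=
   (distinct (walk_edges z s)).+2)%N.
Proof.
pose es := map (fun e : I * A * B => (e.1.2, e.2)) (walk_edges z s).
set zz := zigzag true z s ++ zigzag false z s.
have Ezz : distinct zz = distinct es.
  by apply/eqP; rewrite eqn_leq !distinct_sub // => e; rewrite zigzag_edges.
have : (distinct (map fst zz) + distinct (map snd zz) <= distinct zz + 1 + 1)%N.
  apply: leq_trans (sorted_linked_distinct2 (zigzag_linked _ _ _) (zigzag_linked _ _ _)) _.
  by rewrite leq_add ?leq_add ?leq_b1.
rewrite Ezz; have : (distinct es <= distinct (walk_edges z s))%N by apply: distinct_map_leq.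
have : (distinct (map (fun x => x.2.1) s) <= distinct (map fst zz))%N.
  apply: distinct_sub => a /mapP[x xs ->].
  have [a' [b' [H _]]] := walk_edges_mem z xs.
  apply/mapP; exists (x.2.1, b') => //; rewrite -zigzag_edges.
  by apply/mapP; exists (x.1, x.2.1, b').
have : (distinct (map (fun x => x.2.2) s) <= distinct (map snd zz))%N.
  apply: distinct_sub => a /mapP[x xs ->].
  have [a' [b' [_ H]]] := walk_edges_mem z xs.
  apply/mapP; exists (a', x.2.2) => //; rewrite -zigzag_edges.
  by apply/mapP; exists (x.1, a', x.2.2).
lia.
Qed.

End Walks.

(** * Weighted counting of walks *)

Section Weights.
Variable R : realFieldType.

Definition weight (T : finType) (s : seq T) : R := #|T|%:R ^- distinct s.

Lemma weight_ge0 (T : finType) (s : seq T) : 0 <= weight s.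
Proof. by rewrite invr_ge0 exprn_ge0 ?ler0n. Qed.

(** A letter already in [s] leaves the weight unchanged and has at most [size s] choices; a fresh
    one divides the weight by [#|T|] and has at most [#|T|] choices. *)
Lemma sum_weight_cons (T : finType) (s : seq T) :
  \sum_x weight (x :: s) <= (size s).+1%:R * weight s.
Proof.
rewrite (bigID (mem s)) /= -natr1 mulrDl mul1r lerD //.
  rewrite (eq_bigr (fun=> weight s)); last first.
    by move=> x xs; rewrite /weight distinct_cons xs.
  rewrite sumr_const -[leLHS]mulr_natl ler_wpM2r ?weight_ge0 // ler_nat.
  exact: card_size.
have [/eqP T0|T0] := posnP #|T|.
  by rewrite big1 ?weight_ge0 // => x; have := fintype0 x (eqP T0).
rewrite (eq_bigr (fun=> #|T|%:R^-1 * weight s)); last first.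
  by move=> x xs; rewrite /weight distinct_cons xs /= exprS invfM.
rewrite sumr_const -[leLHS]mulr_natl mulrA -[leRHS]mul1r ler_wpM2r ?weight_ge0 //.
by rewrite ler_pdivrMr ?ltr0n // mul1r ler_nat max_card.
Qed.

Lemma sum_weight3 (I A B : finType) m :
  \sum_(t : m.-tuple (I * (A * B)))
     weight (map fst t) * weight (map (fun x => x.2.1) t) *
     weight (map (fun x => x.2.2) t) <= (m`!%:R) ^+ 3 :> R.
Proof.
elim: m => [|m IH].
  rewrite (bigD1 [tuple]) //= big1 => [|t /eqP[]]; last exact: tuple0.
  by rewrite /weight /distinct /= !expr0 !invr1 !mulr1 addr0 expr1n.
rewrite (big_tuple_cons _ (fun t => weight (map fst t) *
  weight (map (fun x => x.2.1) t) * weight (map (fun x => x.2.2) t))).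
rewrite exchange_big /=.
rewrite factS natrM exprMn; apply: le_trans (ler_wpM2l _ IH); last first.
  by rewrite exprn_ge0 ?ler0n.
rewrite big_distrr /=; apply: ler_sum => t _.
rewrite (eq_bigr (fun x => weight (x.1 :: map fst t) *
   (weight (x.2.1 :: map (fun x => x.2.1) t) *
    weight (x.2.2 :: map (fun x => x.2.2) t)))); last by move=> x _; rewrite mulrA.
rewrite -(pair_bigA _ (fun i z => weight (i :: map fst t) *
   (weight (z.1 :: map (fun x => x.2.1) t) *
    weight (z.2 :: map (fun x => x.2.2) t)))) /=.
rewrite -big_distrlr /= -(pair_bigA _ (fun a b => weight (a :: map (fun x => x.2.1) t) *
    weight (b :: map (fun x => x.2.2) t))) /= -big_distrlr /=.
have S1 := sum_weight_cons (map fst t).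
have S2 := sum_weight_cons (map (fun x => x.2.1) t).
have S3 := sum_weight_cons (map (fun x => x.2.2) t).
rewrite !size_map !size_tuple in S1 S2 S3.
have G (T : finType) (u : seq T) : 0 <= \sum_x weight (x :: u).
  by apply: sumr_ge0 => x _; apply: weight_ge0.
apply: le_trans (ler_pM (G _ _) _ S1 (ler_pM (G _ _) (G _ _) S2 S3)) _.
  by rewrite mulr_ge0 ?G.
by rewrite !exprS expr0 mulr1 !mulrA; lra.
Qed.

End Weights.

Local Close Scope ring_scope.

(** * Symmetric kernels and their traces *)

Local Open Scope ring_scope.

Section Kernels.
Variables (R : realFieldType) (Z : finType).
Implicit Types (C D : Z -> Z -> R) (u : Z -> R).

Definition kernel_mul C D : Z -> Z -> R := fun x z => \sum_y C x y * D y z.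
Definition kernel_sqr C := kernel_mul C C.
Definition kernel_trace C : R := \sum_z C z z.
Definition kernel_form C u : R := \sum_x \sum_y u x * u y * C x y.
Fixpoint kernel_exp C m : Z -> Z -> R :=
  if m is m'.+1 then kernel_mul C (kernel_exp C m') else fun x y => (x == y)%:R.

Lemma kernel_expD C a b x z :
  kernel_exp C (a + b) x z = kernel_mul (kernel_exp C a) (kernel_exp C b) x z.
Proof.
rewrite /kernel_mul; elim: a x => [|a IH] x; rewrite ?addSn /=.
  rewrite (bigD1 x) //= eqxx mul1r big1 ?addr0 // => y /negPf; rewrite eq_sym => ->.
  by rewrite mul0r.
rewrite /kernel_mul; under [LHS]eq_bigr do rewrite IH big_distrr /=.
rewrite exchange_big /=; apply: eq_bigr => y _.
by rewrite big_distrl /=; apply: eq_bigr => y' _; rewrite mulrA.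
Qed.

Lemma iter_kernel_sqr C j x z : iter j kernel_sqr C x z = kernel_exp C (2 ^ j) x z.
Proof.
elim: j x z => [|j IH] x z /=.
  rewrite /kernel_mul (bigD1 z) //= eqxx mulr1 big1 ?addr0 // => y /negPf ->.
  by rewrite mulr0.
rewrite expnS mul2n -addnn kernel_expD /kernel_sqr /kernel_mul.
by under eq_bigr do rewrite !IH.
Qed.

Lemma cauchy_schwarz (I : finType) (f g : I -> R) :
  (\sum_i f i * g i) ^+ 2 <= (\sum_i f i ^+ 2) * (\sum_i g i ^+ 2).
Proof.
have : 0 <= \sum_i \sum_j (f i * g j - f j * g i) ^+ 2.
  by apply: sumr_ge0 => i _; apply: sumr_ge0 => j _; apply: sqr_ge0.
set a := \sum_i f i * g i; set b := \sum_i f i ^+ 2; set c := \sum_i g i ^+ 2.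
have bc : b * c = \sum_i \sum_j f i ^+ 2 * g j ^+ 2 by rewrite /b /c big_distrlr.
have cb : b * c = \sum_i \sum_j f j ^+ 2 * g i ^+ 2.
  by rewrite mulrC /b /c big_distrlr /=; under eq_bigr do under eq_bigr do rewrite mulrC.
have aa : a ^+ 2 = \sum_i \sum_j (f i * g i) * (f j * g j).
  by rewrite expr2 /a big_distrlr.
have -> : \sum_i \sum_j (f i * g j - f j * g i) ^+ 2 = b * c + b * c - 2 * a ^+ 2.
  rewrite {1}bc cb aa big_distrr /= -big_split -sumrB /=; apply: eq_bigr => i _.
  rewrite big_distrr /= -big_split -sumrB /=; apply: eq_bigr => j _.
  ring.
lra.
Qed.

(** Cauchy-Schwarz gives [<u, C u>^2 <= |u|^2 |C u|^2], and [|C u|^2 = <u, C^2 u>] by symmetry. *)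
Lemma kernel_form_sqr C u : (forall x y, C x y = C y x) ->
  kernel_form C u ^+ 2 <= (\sum_x u x ^+ 2) * kernel_form (kernel_sqr C) u.
Proof.
move=> symC.
have -> : kernel_form C u = \sum_x u x * \sum_y u y * C x y.
  by apply: eq_bigr => x _; rewrite big_distrr; apply: eq_bigr => y _ /=; rewrite mulrA.
apply: le_trans (cauchy_schwarz _ _) _; rewrite ler_wpM2l ?sumr_ge0 // => [x _|].
  exact: sqr_ge0.
rewrite le_eqVlt; apply/orP; left; apply/eqP.
transitivity (\sum_y \sum_x \sum_z u x * u z * (C x y * C y z)).
  apply: eq_bigr => y _; rewrite expr2 big_distrlr /=.
  by apply: eq_bigr => x _; apply: eq_bigr => z _; rewrite (symC y x); ring.
rewrite exchange_big; apply: eq_bigr => x _.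
rewrite exchange_big; apply: eq_bigr => z _.
by rewrite /kernel_sqr /kernel_mul big_distrr.
Qed.

Lemma kernel_sqr_sym C : (forall x y, C x y = C y x) ->
  forall x y, kernel_sqr C x y = kernel_sqr C y x.
Proof.
by move=> symC x y; apply: eq_bigr => z _; rewrite (symC x z) (symC z y) mulrC.
Qed.

Lemma iter_kernel_sqr_sym C j : (forall x y, C x y = C y x) ->
  forall x y, iter j kernel_sqr C x y = iter j kernel_sqr C y x.
Proof. by move=> symC; elim: j => //= j IH; apply: kernel_sqr_sym. Qed.

Lemma kernel_trace_sqr C : (forall x y, C x y = C y x) ->
  kernel_trace (kernel_sqr C) = \sum_x \sum_y C x y ^+ 2.
Proof.
move=> symC; apply: eq_bigr => x _; apply: eq_bigr => y _.
by rewrite (symC y x) expr2.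
Qed.

Lemma kernel_form_sqr_trace C u : (forall x y, C x y = C y x) ->
  kernel_form (kernel_sqr C) u <= (\sum_x u x ^+ 2) * kernel_trace (kernel_sqr C).
Proof.
move=> symC; rewrite kernel_trace_sqr //.
have -> : kernel_form (kernel_sqr C) u = \sum_y (\sum_x u x * C y x) ^+ 2.
  transitivity (\sum_y \sum_x \sum_z u x * u z * (C x y * C y z)).
    rewrite exchange_big; apply: eq_bigr => x _.
    rewrite exchange_big; apply: eq_bigr => z _.
    by rewrite /kernel_sqr /kernel_mul big_distrr.
  apply: eq_bigr => y _; rewrite expr2 big_distrlr /=.
  by apply: eq_bigr => x _; apply: eq_bigr => z _; rewrite (symC y x); ring.
by rewrite big_distrr; apply: ler_sum => y _; apply: cauchy_schwarz.
Qed.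

(** The form is squared repeatedly up to [C^(2^j.+1)]. This is the square of a symmetric kernel, so
    its form is at most [|u|^2] times its trace, a squared Frobenius norm; hence at least one
    squaring. *)
Lemma kernel_form_exp_trace C u (S : R) j : (forall x y, C x y = C y x) ->
  \sum_x u x ^+ 2 <= S ->
  kernel_form C u ^+ (2 ^ j.+1) <= S ^+ (2 ^ j.+1) * kernel_trace (kernel_exp C (2 ^ j.+1)).
Proof.
move=> symC uS; have S0 : 0 <= S.
  by apply: le_trans uS; apply: sumr_ge0 => x _; apply: sqr_ge0.
have H i : kernel_form C u ^+ (2 ^ i) <=
    S ^+ (2 ^ i).-1 * kernel_form (iter i kernel_sqr C) u.
  elim: i => [|i IH]; first by rewrite expr0 mul1r.
  (* Squaring keeps the inequality only if the left side is nonnegative: for [i = 0] it is an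
     equality, afterwards the left side is an even power. *)
  have L : (kernel_form C u ^+ (2 ^ i)) ^+ 2 <=
      (S ^+ (2 ^ i).-1 * kernel_form (iter i kernel_sqr C) u) ^+ 2.
    case: i IH => [|i] IH; first by rewrite expr0 mul1r.
    have P : 0 <= kernel_form C u ^+ (2 ^ i.+1) by rewrite expnS exprM exprn_ge0 // sqr_ge0.
    by rewrite ler_sqr // nnegrE // (le_trans P).
  rewrite expnSr exprM; apply: le_trans L _.
  rewrite exprMn -exprM.
  apply: le_trans (ler_wpM2l _ (kernel_form_sqr _ (iter_kernel_sqr_sym i symC))) _.
    by rewrite exprn_ge0.
  have -> : ((2 ^ i * 2).-1 = (2 ^ i).-1 * 2 + 1)%N by have := expn_gt0 2 i; lia.
  rewrite exprD expr1 -mulrA ler_wpM2l ?exprn_ge0 //= ler_wpM2r //.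
  have -> : kernel_form (kernel_sqr (iter i kernel_sqr C)) u =
     \sum_y (\sum_x u x * iter i kernel_sqr C y x) ^+ 2.
    transitivity (\sum_y \sum_x \sum_z u x * u z * (iter i kernel_sqr C x y * iter i kernel_sqr C y z)).
      rewrite exchange_big; apply: eq_bigr => x _.
      rewrite exchange_big; apply: eq_bigr => z _.
      by rewrite /kernel_sqr /kernel_mul big_distrr.
    apply: eq_bigr => y _; rewrite expr2 big_distrlr /=.
    by apply: eq_bigr => x _; apply: eq_bigr => z _; rewrite (iter_kernel_sqr_sym i symC y x); ring.
  by apply: sumr_ge0 => y _; apply: sqr_ge0.
apply: le_trans (H j.+1) _.
have -> : kernel_trace (kernel_exp C (2 ^ j.+1)) = kernel_trace (iter j.+1 kernel_sqr C).
  by apply: eq_bigr => x _; rewrite iter_kernel_sqr.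
have symj := iter_kernel_sqr_sym j symC.
have T0 : 0 <= kernel_trace (iter j.+1 kernel_sqr C).
  by rewrite /= kernel_trace_sqr //; apply: sumr_ge0 => x _; apply: sumr_ge0 => y _; apply: sqr_ge0.
apply: le_trans (ler_wpM2l _ (kernel_form_sqr_trace u symj)) _; first by rewrite exprn_ge0.
rewrite mulrA ler_wpM2r //.
have {2}-> : (2 ^ j.+1 = (2 ^ j.+1).-1 + 1)%N by have := expn_gt0 2 j.+1; lia.
by rewrite exprD expr1 ler_wpM2l ?exprn_ge0.
Qed.

End Kernels.

(** * Contraction of a tensor and the walk expansion of its traces *)

Section TensorKernel.
Variables (R : realFieldType) (I A B : finType).
Implicit Types (w : I * A * B -> R).

(* The tensor is contracted with itself along [I], and the two copies of [A * B]
   are regrouped as rows (a, b') and columns (a', b); this makes the kernel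
   symmetric, and the removed diagonal is the sum of the squared entries. *)
Definition tensor_step w (i : I) (z z' : A * B) : R :=
  (z != z')%:R * (w (i, z.1, z'.2) * w (i, z'.1, z.2)).

Definition tensor_kernel w (z z' : A * B) : R := \sum_i tensor_step w i z z'.

Lemma tensor_kernel_sym w z z' : tensor_kernel w z z' = tensor_kernel w z' z.
Proof.
by apply: eq_bigr => i _; rewrite /tensor_step eq_sym; congr (_ * _); rewrite mulrC.
Qed.

(** Cauchy-Schwarz over [i], then expansion of the squares. The diagonal of the regrouped kernel is
    split off so that every remaining step reads two different entries, which the bound [2 #I <= E]
    on walks requires. *)
Lemma tensor_form_le w (f : I -> bool) (g : A -> bool) (h : B -> bool) :
  (\sum_i \sum_a \sum_b w (i, a, b) * (f i && g a && h b)%:R) ^+ 2 <=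
  #|I|%:R * (\sum_e w e ^+ 2 +
     kernel_form (tensor_kernel w) (fun z => (g z.1 && h z.2)%:R)).
Proof.
pose y i := \sum_a \sum_b w (i, a, b) * (g a && h b)%:R.
have -> : \sum_i \sum_a \sum_b w (i, a, b) * (f i && g a && h b)%:R =
   \sum_i (f i)%:R * y i.
  apply: eq_bigr => i _; rewrite big_distrr; apply: eq_bigr => a _ /=.
  rewrite big_distrr; apply: eq_bigr => b _ /=.
  by rewrite -andbA; case: (f i); rewrite ?mul1r // mul0r mulr0.
apply: le_trans (cauchy_schwarz _ _) _; apply: ler_pM.
- by apply: sumr_ge0 => i _; apply: sqr_ge0.
- by apply: sumr_ge0 => i _; apply: sqr_ge0.
- rewrite -sum1_card natr_sum; apply: ler_sum => i _.
  by case: (f i); rewrite ?expr1n // expr0n ler01.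
pose u (z : A * B) : R := (g z.1 && h z.2)%:R.
pose full z z' := \sum_i w (i, z.1, z'.2) * w (i, z'.1, z.2).
have -> : \sum_i y i ^+ 2 = \sum_z \sum_z' u z * u z' * full z z'.
  transitivity (\sum_i \sum_a \sum_b \sum_a' \sum_b'
      (g a && h b && (g a' && h b'))%:R * (w (i, a, b) * w (i, a', b'))).
    apply: eq_bigr => i _; rewrite expr2 /y big_distrlr /=.
    under eq_bigr do under eq_bigr do rewrite big_distrlr /=.
    apply: eq_bigr => a _; rewrite exchange_big; apply: eq_bigr => b _.
    apply: eq_bigr => a' _; apply: eq_bigr => b' _.
    by rewrite mulrACA -natrM mulnb mulrC.
  rewrite (eq_bigr (fun z => \sum_a' \sum_b \sum_i
      (g z.1 && h b && (g a' && h z.2))%:R * (w (i, z.1, b) * w (i, a', z.2)))); last first.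
    move=> z _; rewrite pair_bigA /=; apply: eq_bigr => z' _.
    rewrite /full big_distrr /=; apply: eq_bigr => i _.
    rewrite /u -natrM mulnb; congr (_%:R * _).
    by case: (g _); case: (h _); case: (g _); case: (h _).
  rewrite -(pair_bigA _ (fun a b' => \sum_a' \sum_b \sum_i
      (g a && h b && (g a' && h b'))%:R * (w (i, a, b) * w (i, a', b')))) /=.
  rewrite exchange_big; apply: eq_bigr => a _.
  under [RHS]eq_bigr do under eq_bigr do rewrite exchange_big /=.
  under [RHS]eq_bigr do rewrite exchange_big /=.
  rewrite [RHS]exchange_big; apply: eq_bigr => i _ /=.
  under [RHS]eq_bigr do rewrite exchange_big /=.
  rewrite [RHS]exchange_big; apply: eq_bigr => b _ /=.
  by rewrite exchange_big.
have u01 z : u z * u z <= 1 by rewrite /u; case: (_ && _); rewrite ?mulr1 // mulr0.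
rewrite addrC /kernel_form.
apply: le_trans (_ : \sum_z (\sum_z' u z * u z' * tensor_kernel w z z' + full z z) <= _).
  apply: ler_sum => z _.
  rewrite (bigD1 z) //= [X in _ <= X + _](bigD1 z) //=.
  rewrite (eq_bigr (fun z' => u z * u z' * tensor_kernel w z z')); last first.
    move=> z' zz'; congr (_ * _); apply: eq_bigr => i _.
    by rewrite /tensor_step eq_sym zz' mul1r.
  have -> : tensor_kernel w z z = 0.
    by rewrite /tensor_kernel big1 // => i _; rewrite /tensor_step eqxx mul0r.
  rewrite mulr0 add0r addrC lerD2l -[leRHS]mul1r ler_wpM2r //.
  by apply: sumr_ge0 => i _; rewrite -expr2 sqr_ge0.
rewrite big_split /= lerD2l exchange_big pair_bigA /=.
rewrite le_eqVlt; apply/orP; left; apply/eqP.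
rewrite (reindex (fun e : I * A * B => (e.1.1, (e.1.2, e.2)))) /=; last first.
  by exists (fun e : I * (A * B) => (e.1, e.2.1, e.2.2)) => [[[]]|[? []]].
by apply: eq_bigr => -[[i a] b] _; rewrite expr2.
Qed.

Fixpoint walk_product w (z : A * B) (s : seq (I * (A * B))) : R :=
  if s is x :: s' then tensor_step w x.1 x.2 (next_vertex z s') * walk_product w z s'
  else 1.

Lemma walk_productE w z s :
  walk_product w z s = (walk_proper z s)%:R * \prod_(e <- walk_edges z s) w e.
Proof.
elim: s => [|x s IH] /=; first by rewrite big_nil mulr1.
by rewrite !big_cons IH /tensor_step -mulnb natrM; ring.
Qed.

Lemma tensor_kernel_exp w m z z' :
  kernel_exp (tensor_kernel w) m.+1 z z' =
  \sum_i \sum_(t : m.-tuple (I * (A * B))) walk_product w z' ((i, z) :: t).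
Proof.
elim: m z => [|m IH] z.
  rewrite /= /kernel_mul (bigD1 z') //= eqxx mulr1 big1 ?addr0 => [|y /negPf ->];
    last by rewrite mulr0.
  apply: eq_bigr => i _; rewrite (bigD1 [tuple]) //= big1 => [|t /eqP[]].
    by rewrite addr0 mulr1.
  exact: tuple0.
transitivity (\sum_y tensor_kernel w z y * kernel_exp (tensor_kernel w) m.+1 y z') => //.
under eq_bigr do rewrite IH.
transitivity (\sum_i \sum_y \sum_i' \sum_(t : m.-tuple (I * (A * B)))
   tensor_step w i z y * walk_product w z' ((i', y) :: t)).
  rewrite exchange_big; apply: eq_bigr => y _; rewrite big_distrl /=.
  by apply: eq_bigr => i _; rewrite big_distrr; apply: eq_bigr => i' _; rewrite big_distrr.
apply: eq_bigr => i _.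
rewrite (big_tuple_cons _ (fun t => walk_product w z' ((i, z) :: t))).
by rewrite exchange_big pair_bigA; apply: eq_bigr => -[i' y] _.
Qed.

Lemma tensor_kernel_trace w m :
  kernel_trace (kernel_exp (tensor_kernel w) m.+1) =
  \sum_(x : I * (A * B)) \sum_(t : m.-tuple (I * (A * B)))
     (walk_proper x.2 (x :: t))%:R * \prod_(e <- walk_edges x.2 (x :: t)) w e.
Proof.
rewrite /kernel_trace; under eq_bigr do rewrite tensor_kernel_exp.
rewrite exchange_big pair_bigA; apply: eq_bigr => -[i z] _.
by apply: eq_bigr => t _; rewrite walk_productE.
Qed.

End TensorKernel.

Local Close Scope ring_scope.

(** * Moments under the random hypergraph *)

Local Open Scope ring_scope.

Section Expectation.
Variables (R : realType) (n k : nat) (p : R).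
Hypothesis p01 : 0 <= p <= 1.

Definition expect (F : hypergraph n -> R) : R :=
  \sum_(H : hypergraph n | uniform k H)
    (\prod_(e : {set 'I_n} | #|e| == k) (if e \in H then p else 1 - p)) * F H.

Lemma hweight_ge0 (H : hypergraph n) :
  0 <= \prod_(e : {set 'I_n} | #|e| == k) (if e \in H then p else 1 - p).
Proof.
apply: prodr_ge0 => e _; case/andP: p01 => p0 p1; case: (_ \in _) => //.
by rewrite subr_ge0.
Qed.

Lemma eq_expect (F G : hypergraph n -> R) : F =1 G -> expect F = expect G.
Proof. by move=> FG; apply: eq_bigr => H _; rewrite FG. Qed.

Lemma expectZ c (F : hypergraph n -> R) : expect (fun H => c * F H) = c * expect F.
Proof. by rewrite /expect big_distrr /=; apply: eq_bigr => H _; rewrite mulrCA. Qed.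

Lemma expectD (F G : hypergraph n -> R) :
  expect (fun H => F H + G H) = expect F + expect G.
Proof. by rewrite /expect -big_split /=; apply: eq_bigr => H _; rewrite mulrDr. Qed.

Lemma expect_sum (I : finType) (F : I -> hypergraph n -> R) :
  expect (fun H => \sum_i F i H) = \sum_i expect (F i).
Proof.
rewrite /expect exchange_big /=; apply: eq_bigr => H _.
by rewrite big_distrr.
Qed.

Lemma expect_prod (g : {set 'I_n} -> bool -> R) :
  expect (fun H => \prod_(e : {set 'I_n} | #|e| == k) g e (e \in H)) =
  \prod_(e : {set 'I_n} | #|e| == k) (p * g e true + (1 - p) * g e false).
Proof.
(* A set of size other than [k] gets weight 0 inside [H] and 1 outside, so the product of sums
   expands over all set systems and the non-uniform ones vanish. *)
pose F (e : {set 'I_n}) := if #|e| == k then p * g e true else 0.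
pose G (e : {set 'I_n}) := if #|e| == k then (1 - p) * g e false else 1.
transitivity (\prod_e (F e + G e)); last first.
  rewrite [LHS](bigID (fun e : {set 'I_n} => #|e| == k)) /= [X in _ * X]big1; last first.
    by move=> e /negPf ek; rewrite /F /G ek add0r.
  by rewrite mulr1; apply: eq_bigr => e ek; rewrite /F /G ek.
rewrite bigA_distr /expect big_mkcond /=; apply: eq_bigr => H _.
case: ifPn => [/forallP uH|].
  rewrite -big_split /= big_mkcond /=; apply: eq_bigr => e _.
  rewrite /F /G; have := uH e; case: (e \in H) => /= [->//|_].
  by case: (#|e| == k).
rewrite negb_forall => /existsP[e]; rewrite negb_imply => /andP[eH /negPf ek].
by rewrite (bigD1 e) //= eH /F ek mul0r.
Qed.

Lemma expect_const c : expect (fun=> c) = c.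
Proof.
transitivity (c * expect (fun H => \prod_(e : {set 'I_n} | #|e| == k) 1)).
  by rewrite -expectZ; apply: eq_expect => H; rewrite big1_eq mulr1.
rewrite (expect_prod (fun _ _ => 1)) big1 ?mulr1 // => e _; lra.
Qed.

Lemma expect_mem (e : {set 'I_n}) : #|e| == k -> expect (fun H => (e \in H)%:R) = p.
Proof.
move=> ek.
transitivity (expect (fun H => \prod_(e' : {set 'I_n} | #|e'| == k)
   (if e' == e then (e' \in H)%:R else 1))).
  apply: eq_expect => H; rewrite (bigD1 e) //= eqxx big1 ?mulr1 // => e' /andP[_ /negPf->] //.
rewrite (expect_prod (fun e' b => if e' == e then b%:R else 1)) (bigD1 e) //= eqxx.
by rewrite big1 => [|e' /andP[_ /negPf ->]]; lra.
Qed.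

Lemma prob_expect_le (E : pred (hypergraph n)) (F : hypergraph n -> R) :
  (forall H, uniform k H -> 0 <= F H) ->
  (forall H, uniform k H -> E H -> 1 <= F H) -> prob k p E <= expect F.
Proof.
move=> F0 F1; rewrite /prob /expect big_mkcondr /=; apply: ler_sum => H uH.
case: ifP => EH; last by rewrite mulr_ge0 ?hweight_ge0 ?F0.
by rewrite ler_peMr ?hweight_ge0 ?F1.
Qed.

Lemma prod_count (F : {set 'I_n} -> R) (s : seq {set 'I_n}) :
  all (fun e : {set 'I_n} => #|e| == k) s ->
  \prod_(e : {set 'I_n} | #|e| == k) F e ^+ count_mem e s = \prod_(e <- s) F e.
Proof.
elim: s => [_|e s IH] /=; first by rewrite big_nil big1.
case/andP=> ek /IH {}IH; rewrite big_cons -IH.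
under eq_bigr do rewrite exprD; rewrite big_split /=; congr (_ * _).
rewrite (bigD1 e) //= eqxx expr1 big1 ?mulr1 // => e' /andP[_ ne].
by rewrite eq_sym (negPf ne).
Qed.

(** * Moments of a nearly centred tensor *)

Section Tensor.
Variables (I A B : finType) (edge : I * A * B -> {set 'I_n}) (inc : pred (I * A * B)).
Hypothesis inc_card : forall e, inc e -> #|edge e| == k.
Hypothesis inc_inj : {in inc &, injective edge}.
Variables (ph rho theta : R).
Hypothesis ph01 : 0 <= ph <= 1.
Hypothesis rho_gt0 : 0 < rho.
Hypothesis theta1 : 1 <= theta.
Hypothesis p_ph : `|p - ph| <= rho.
Hypothesis p_theta : p + ph ^+ 2 <= theta ^+ 2 * rho.

Definition centered (H : hypergraph n) (e : I * A * B) : R :=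
  (inc e)%:R * ((edge e \in H)%:R - ph).

(** [rho] bounds the mean and [theta ^ 2 * rho] the second moment. Higher moments are no larger,
    since the entries have absolute value at most 1; thus [rho] is paid once whatever [c]. *)
Lemma moment_le c : (0 < c)%N ->
  `|p * (1 - ph) ^+ c + (1 - p) * (0 - ph) ^+ c| <= theta ^+ c * rho.
Proof.
case/andP: p01 => p0 p1; case/andP: ph01 => h0 h1.
case: c => [//|[_|c _]].
  rewrite !expr1; have -> : p * (1 - ph) + (1 - p) * (0 - ph) = p - ph by ring.
  by apply: le_trans p_ph _; rewrite (ler_peMl (ltW rho_gt0) theta1).
apply: le_trans (_ : theta ^+ 2 * rho <= _); last first.
  by rewrite (ler_wpM2r (ltW rho_gt0)) // ler_weXn2l.
apply: le_trans p_theta; apply: le_trans (ler_normD _ _) _.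
rewrite [`|p * _|]normrM [`|(1 - p) * _|]normrM !normrX sub0r normrN !ger0_norm ?subr_ge0 // lerD //.
  by rewrite ler_piMr // exprn_ile1 // ?subr_ge0 //; lra.
rewrite -[leRHS]mul1r; apply: ler_pM; rewrite ?subr_ge0 ?exprn_ge0 //; first lra.
by rewrite ler_wiXn2l.
Qed.

Lemma distinct_map_in (s : seq (I * A * B)) : all inc s ->
  distinct (map edge s) = distinct s.
Proof.
elim: s => //= x s IH /andP[ix al]; rewrite !distinct_cons IH //; congr (_ + _)%N.
congr (~~ _ : nat); apply/mapP/idP => [[y ys]|xs]; last by exists x.
by move/inc_inj => -> //; have /allP := al; apply.
Qed.

(** Distinct tuples in [inc] have distinct hyperedges, hence independent entries, and the
    expectation factors. A tuple outside [inc] makes the product vanish. *)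
Lemma expect_prod_centered (s : seq (I * A * B)) :
  `|expect (fun H => \prod_(e <- s) centered H e)| <= theta ^+ size s * rho ^+ distinct s.
Proof.
have th0 : 0 <= theta by apply: le_trans theta1.
have [al|nal] := boolP (all inc s); last first.
  have -> : expect (fun H => \prod_(e <- s) centered H e) = 0.
    rewrite -[RHS](expect_const 0); apply: eq_expect => H.
    have /allPn[e es /negPf ie] := nal.
    by rewrite (big_rem e) //= /centered ie mul0r mul0r.
  by rewrite normr0 mulr_ge0 ?exprn_ge0 // ltW.
pose es := map edge s.
have esk : all (fun e : {set 'I_n} => #|e| == k) es.
  by rewrite all_map; apply/allP => e /(allP al); apply: inc_card.
have -> : expect (fun H => \prod_(e <- s) centered H e) =
    expect (fun H => \prod_(e : {set 'I_n} | #|e| == k) ((e \in H)%:R - ph) ^+ count_mem e es).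
  apply: eq_expect => H; rewrite (prod_count (fun e => (e \in H)%:R - ph)) //.
  rewrite big_map big_seq [RHS]big_seq; apply: eq_bigr => e ein.
  by rewrite /centered (allP al e ein) mul1r.
rewrite (expect_prod (fun e b => (b%:R - ph) ^+ count_mem e es)) normr_prod.
have -> : theta ^+ size s * rho ^+ distinct s =
   \prod_(e : {set 'I_n} | #|e| == k) (theta ^+ count_mem e es * rho ^+ count_mem e (undup es)).
  rewrite big_split /= !(prod_count (fun=> _)) //; last first.
    by apply/allP => e; rewrite mem_undup => /(allP esk).
  rewrite !big_const_seq !count_predT !iter_mulr !mulr1 size_map.
  by rewrite -(distinct_map_in al).
apply: ler_prod => e ek; rewrite normr_ge0 /=.
rewrite (count_uniq_mem _ (undup_uniq es)) mem_undup.
have [ein|] := boolP (e \in es).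
  by rewrite expr1 moment_le // -has_count has_pred1.
move=> /count_memPn ->; rewrite !expr0 mulr1 !mulr1; have -> : p + (1 - p) = 1 by ring.
by rewrite normr1.
Qed.

Lemma expect_trace_le m :
  (forall (z : A * B) (s : seq (I * (A * B))), walk_proper z s -> rho ^+ distinct (walk_edges z s) <=
     #|A|%:R * #|B|%:R * (weight R (map fst s) * weight R (map (fun x => x.2.1) s) *
       weight R (map (fun x => x.2.2) s))) ->
  expect (fun H => kernel_trace (kernel_exp (tensor_kernel (centered H)) m.+1)) <=
  #|A|%:R * #|B|%:R * (theta ^+ 2) ^+ m.+1 * (m.+1)`!%:R ^+ 3.
Proof.
move=> Hw; rewrite (eq_expect (fun H => tensor_kernel_trace _ _)).
have th0 : 0 <= theta by apply: le_trans theta1.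
rewrite expect_sum.
pose W (s : seq (I * (A * B))) := weight R (map fst s) * weight R (map (fun x => x.2.1) s) *
       weight R (map (fun x => x.2.2) s).
apply: le_trans (_ : \sum_x \sum_(t : m.-tuple (I * (A * B)))
    (#|A|%:R * #|B|%:R * (theta ^+ 2) ^+ m.+1) * W (x :: t) <= _).
  apply: ler_sum => x _; rewrite expect_sum; apply: ler_sum => t _.
  rewrite expectZ; have [pr|_] := boolP (walk_proper x.2 (x :: t)); last first.
    by rewrite mul0r !mulr_ge0 ?ler0n ?exprn_ge0 ?weight_ge0.
  rewrite mul1r; apply: le_trans (ler_norm _) _.
  apply: le_trans (expect_prod_centered _) _.
  have -> : size (walk_edges x.2 (x :: t)) = (2 * m.+1)%N.
    by rewrite size_walk_edges /= size_tuple mul2n.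
  rewrite exprM mulrAC [leRHS]mulrC ler_wpM2l ?exprn_ge0 //.
  exact: Hw.
rewrite -(big_tuple_cons _ (fun s => (#|A|%:R * #|B|%:R * (theta ^+ 2) ^+ m.+1) * W s)).
rewrite -big_distrr /= ler_wpM2l ?sum_weight3 //.
by rewrite !mulr_ge0 ?ler0n ?exprn_ge0.
Qed.

End Tensor.
End Expectation.

Definition split0 (k : nat) : nat := if odd k then 1 else k./2.
Definition split2 (k : nat) : nat := if odd k then k./2 else 0.

Lemma split_add (k : nat) : (split0 k + k./2 + split2 k = k)%N.
Proof. rewrite /split0 /split2 -[RHS]odd_double_half; case: (odd k); lia. Qed.

Lemma split0_double (k : nat) : (2 <= k -> (split0 k).*2 <= k)%N.
Proof. rewrite /split0 => k2; have := odd_double_half k; case: (odd k); lia. Qed.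

(** With [rho = n^(-k/2)] this compares exponents of [n]. For odd [k] it follows from [2 #I <= E]
    and [#A + #B <= E + 2]; for even [k] the type [B] is a single point and [#I + #A <= E + 1]
    suffices. The surplus in these inequalities is exactly [#|A| * #|B|]. *)
Lemma walk_weight_le (R : realFieldType) (n k : nat) (I A B : finType) (rho : R)
    (z : A * B) (s : seq (I * (A * B))) :
  (0 < n)%N -> #|I| = (n ^ split0 k)%N -> #|A| = (n ^ k./2)%N -> #|B| = (n ^ split2 k)%N ->
  0 <= rho -> rho ^+ 2 * (n ^ k)%:R = 1 -> walk_proper z s ->
  rho ^+ distinct (walk_edges z s) <=
  #|A|%:R * #|B|%:R * (weight R (map fst s) * weight R (map (fun x => x.2.1) s) *
       weight R (map (fun x => x.2.2) s)).
Proof.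
move=> n0 cI cA cB rho0 rhoD pr.
set E := distinct (walk_edges z s).
rewrite /weight cI cA cB; set i := distinct _; set a := distinct _; set b := distinct _.
have Hn : (2 * (split0 k * i + k./2 * a + split2 k * b) <= 2 * (k./2 + split2 k) + k * E)%N.
  rewrite /split0 /split2; have := odd_double_half k.
  have HI := walk_distinct_I pr; have HIA := walk_distinct_IA z s.
  have HAB := walk_distinct_AB z s; move: HI HIA HAB; rewrite -/E -/i -/a -/b.
  case: (odd k) => HI HIA HAB Hk.
    have : (k./2 * (a + b) <= k./2 * E.+2)%N by rewrite leq_mul2l HAB orbT.
    by nia.
  have : (k./2 * (i + a) <= k./2 * E.+1)%N by rewrite leq_mul2l HIA orbT.
  by nia.
have nR : 1 <= n%:R :> R by rewrite ler1n.
have nR0 : 0 < n%:R :> R by rewrite ltr0n.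
set rhs := (X in _ <= X).
have rhs0 : 0 <= rhs by rewrite /rhs !mulr_ge0 ?invr_ge0 ?exprn_ge0 ?ler0n.
(* Both sides are squared to avoid the half-integral exponent [k / 2]. *)
rewrite -ler_sqr ?nnegrE ?exprn_ge0 // /rhs.
have Drho : rho ^+ 2 = (n%:R ^+ k)^-1.
  have Dn : (n ^ k)%:R != 0 :> R by rewrite pnatr_eq0 -lt0n expn_gt0 n0.
  by rewrite -natrX; apply: (mulIf Dn); rewrite rhoD mulVf.
rewrite -exprM mulnC exprM Drho exprVn -exprM !natrX -!exprM -!invfM -!exprD exprMn exprVn -!exprM.
rewrite ler_pdivlMr ?exprn_gt0 // mulrC ler_pdivrMr ?exprn_gt0 // -exprD ler_weXn2l //.
by rewrite mulnC [X in (_ <= X + _)%N]mulnC.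
Qed.

Local Close Scope ring_scope.

(** * Tuples of vertices as numbers *)

Section Digits.
Variable n : nat.
Hypothesis n_gt0 : 0 < n.

Definition digit (t j : nat) : nat := (t %/ n ^ j) %% n.
Definition digits (k t : nat) : seq nat := mkseq (digit t) k.
Definition increasing (k t : nat) : bool := sorted ltn (digits k t).

Lemma digit_ltn t j : digit t j < n.
Proof. exact: ltn_pmod. Qed.

Lemma digitS t j : digit t j.+1 = digit (t %/ n) j.
Proof. by rewrite /digit expnS divnMA. Qed.

Lemma digit_cat c i x j : i < n ^ c ->
  digit (i + n ^ c * x) j = if j < c then digit i j else digit x (j - c).
Proof.
move=> ic; rewrite /digit; have [jc|cj] := ltnP j c.
  have E : n ^ c = n ^ j * (n * n ^ (c - j.+1)) by rewrite -expnS -expnD; congr (_ ^ _); lia.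
  have -> : i + n ^ c * x = n ^ (c - j.+1) * x * n * n ^ j + i by rewrite E; lia.
  by rewrite divnMDl ?expn_gt0 ?n_gt0 // modnMDl.
have -> : n ^ j = n ^ c * n ^ (j - c) by rewrite -expnD subnKC.
rewrite divnMA [_ + n ^ c * x]addnC [n ^ c * x]mulnC divnMDl ?expn_gt0 ?n_gt0 //.
by rewrite (divn_small ic) addn0.
Qed.

Lemma digits_inj k t t' : t < n ^ k -> t' < n ^ k -> digits k t = digits k t' -> t = t'.
Proof.
elim: k t t' => [|k IH] t t'; first by rewrite expn0 !ltnS !leqn0 => /eqP-> /eqP->.
rewrite expnS => tk t'k E.
have D j : j < k.+1 -> digit t j = digit t' j.
  by move=> jk; have := congr1 (fun s => nth 0 s j) E; rewrite /digits !nth_mkseq.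
rewrite (divn_eq t n) (divn_eq t' n).
move: (D 0 isT); rewrite /digit !expn0 !divn1 => ->; congr (_ * _ + _).
apply: IH; rewrite ?ltn_divLR // 1?mulnC //.
apply: (@eq_from_nth _ 0) => [|j]; rewrite !size_mkseq // => jk.
by rewrite !nth_mkseq // -!digitS D.
Qed.

Lemma digits_surj (s : seq nat) : all (fun d => d < n) s ->
  exists2 t, t < n ^ size s & digits (size s) t = s.
Proof.
elim: s => [|d s IH] /=; first by exists 0.
case/andP=> dn /IH [t tn E]; exists (d + n * t).
  rewrite expnS; apply: leq_trans (_ : n * t.+1 <= _); last by rewrite leq_mul2l tn orbT.
  by rewrite mulnS ltn_add2r.
apply: (@eq_from_nth _ 0) => [|j]; rewrite size_mkseq // => jk.
rewrite nth_mkseq // -[X in X * t]expn1 digit_cat ?expn1 //.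
case: j jk => [|j] jk /=; first by rewrite /digit expn0 divn1 modn_small.
by rewrite subn1 /= -E nth_mkseq.
Qed.

Lemma mem_tuple_support k t (v : 'I_n) :
  (v \in tuple_support n k t) = (val v \in digits k t).
Proof.
rewrite inE; apply/existsP/mapP => [[j /eqP ->]|[j jk ->]].
  by exists (val j) => //; rewrite mem_iota add0n ltn_ord.
by move: jk; rewrite mem_iota => /andP[_ jk]; exists (Ordinal jk).
Qed.

Lemma tuple_support_subset k t (S : {set 'I_n}) :
  (tuple_support n k t \subset S) =
  all (fun d => d \in map val (enum S)) (digits k t).
Proof.
apply/fintype.subsetP/allP => [sub d dt|al v].
  have dn : d < n by case/mapP: dt => j _ ->; apply: digit_ltn.
  apply/mapP; exists (Ordinal dn) => //; rewrite mem_enum; apply: sub.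
  by rewrite mem_tuple_support.
rewrite mem_tuple_support => /al /mapP[u]; rewrite mem_enum => uS /val_inj ->.
exact: uS.
Qed.

Lemma map_val_enum_tuple_support k t :
  map val (enum (tuple_support n k t)) =i digits k t.
Proof.
move=> d; apply/mapP/idP => [[v]|dt].
  by rewrite mem_enum mem_tuple_support => H ->.
have dn : d < n by case/mapP: dt => j _ ->; apply: digit_ltn.
by exists (Ordinal dn) => //; rewrite mem_enum mem_tuple_support.
Qed.

Lemma card_tuple_support k t : increasing k t -> #|tuple_support n k t| = k.
Proof.
move=> inc; rewrite cardE -(size_map (val : 'I_n -> nat)) -[RHS](size_mkseq (digit t)).
apply/eqP; rewrite eq_sym -(uniq_size_uniq _ (map_val_enum_tuple_support k t)).
  exact: sorted_uniq ltn_trans ltnn _ inc.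
by rewrite (map_inj_uniq val_inj) enum_uniq.
Qed.

Lemma tuple_support_inj k t t' : t < n ^ k -> t' < n ^ k ->
  increasing k t -> increasing k t' ->
  tuple_support n k t = tuple_support n k t' -> t = t'.
Proof.
move=> tk t'k it it' E; apply: digits_inj tk t'k _.
apply: (irr_sorted_eq ltn_trans ltnn it it') => d.
by rewrite -!map_val_enum_tuple_support E.
Qed.

(** The witness is the increasing enumeration of [K], read as digits in base [n]. *)
Lemma tuple_support_surj (K : {set 'I_n}) :
  exists t, [/\ t < n ^ #|K|, increasing #|K| t & tuple_support n #|K| t = K].
Proof.
have all_n : all (fun d => d < n) (map val (enum K)).
  by apply/allP => d /mapP[v _ ->]; apply: ltn_ord.
have [t tn E] := digits_surj all_n; rewrite size_map -cardE in tn E.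
have srt : sorted ltn (map val (enum K)).
  rewrite /enum_mem -enumT; apply: (@subseq_sorted _ _ ltn_trans _ (iota 0 n)).
    rewrite -val_enum_ord; apply: map_subseq; exact: filter_subseq.
  exact: iota_ltn_sorted.
exists t; split => //; first by rewrite /increasing E.
apply/setP => v; rewrite mem_tuple_support E.
by rewrite (mem_map val_inj) mem_enum.
Qed.

End Digits.

(** * Splitting a tuple into its three groups of coordinates *)

Section Index.
Variables n k : nat.
Hypothesis n_gt0 : 0 < n.

Notation I := 'I_(n ^ split0 k).
Notation A := 'I_(n ^ k./2).
Notation B := 'I_(n ^ split2 k).

Definition index (i a b : nat) : nat := i + n ^ split0 k * (a + n ^ k./2 * b).

Lemma index_ltn i a b : i < n ^ split0 k -> a < n ^ k./2 -> b < n ^ split2 k ->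
  index i a b < n ^ k.
Proof.
rewrite /index.
have -> : n ^ k = n ^ split0 k * (n ^ k./2 * n ^ split2 k) by rewrite -!expnD addnA split_add.
move: (n ^ split0 k) (n ^ k./2) (n ^ split2 k) => x y z ix ay bz.
apply: leq_trans (_ : x * (a + y * b).+1 <= _); first by rewrite mulnS ltn_add2r.
rewrite leq_mul2l; apply/orP; right.
apply: leq_trans (_ : y * b.+1 <= _); first by rewrite mulnS ltn_add2r.
by rewrite leq_mul2l bz orbT.
Qed.

Definition tensor_index (e : I * A * B) : nat := index e.1.1 e.1.2 e.2.

Lemma tensor_index_ltn e : tensor_index e < n ^ k.
Proof. by case: e => -[i a] b; rewrite index_ltn ?ltn_ord. Qed.

Lemma tensor_index_inj : injective tensor_index.
Proof.
have uniq_rem x y z u v : x < z -> y < z -> x + z * u = y + z * v -> x = y /\ u = v.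
  move=> xz yz E; have z0 : 0 < z by apply: leq_trans xz.
  have H : x = y.
    by have := congr1 (modn^~ z) E; rewrite ![_ + z * _]addnC ![z * _]mulnC !modnMDl !modn_small.
  by split=> //; move: E; rewrite H => /addnI /eqP; rewrite eqn_pmul2l // => /eqP.
move=> [[i a] b] [[i' a'] b']; rewrite /tensor_index /index /=.
case/uniq_rem => // /ord_inj -> /uniq_rem []// /ord_inj -> /ord_inj -> //.
Qed.

Lemma big_tensor_index (R : nmodType) (F : nat -> R) :
  (\sum_(t < n ^ k) F t = \sum_(e : I * A * B) F (tensor_index e))%R.
Proof.
pose f e : 'I_(n ^ k) := Ordinal (tensor_index_ltn e).
have inj : injective f by move=> e e' /(congr1 val) /= /tensor_index_inj.
have [g fg gf] : bijective f.
  apply: inj_card_bij inj _.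
  by rewrite !card_prod !card_ord -!expnD split_add.
by rewrite (reindex f) //; exists g => e _.
Qed.

Lemma digits_index (i : I) (a : A) (b : B) :
  digits n k (index i a b) =
  digits n (split0 k) i ++ digits n k./2 a ++ digits n (split2 k) b.
Proof.
apply: (@eq_from_nth _ 0) => [|j].
  by rewrite !size_cat !size_mkseq addnA split_add.
rewrite size_mkseq => jk; rewrite nth_mkseq // /index digit_cat ?ltn_ord //.
rewrite nth_cat size_mkseq; case: ltnP => jc; first by rewrite nth_mkseq.
rewrite digit_cat ?ltn_ord // nth_cat size_mkseq; case: ltnP => jq; first by rewrite nth_mkseq.
by rewrite nth_mkseq //; have := split_add k; lia.
Qed.

Definition inside (S : {set 'I_n}) (m t : nat) : bool :=
  all (fun d => d \in map val (enum S)) (digits n m t).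

Lemma tensor_support_subset (S : {set 'I_n}) (i : I) (a : A) (b : B) :
  (tuple_support n k (tensor_index (i, a, b)) \subset S) =
  inside S (split0 k) i && inside S k./2 a && inside S (split2 k) b.
Proof.
by rewrite tuple_support_subset // /tensor_index digits_index !all_cat andbA.
Qed.

(** Every [k]-subset of [S] is the support of exactly one increasing tuple. *)
Lemma card_tensor_inside (S : {set 'I_n}) :
  #|[set e : I * A * B | increasing n k (tensor_index e) &
       tuple_support n k (tensor_index e) \subset S]| = 'C(#|S|, k).
Proof.
rewrite -cards_draws; set X := [set e | _ & _].
have <- : [set tuple_support n k (tensor_index e) | e in X] = [set K : {set 'I_n} | K \subset S & #|K| == k].
  apply/setP => K; rewrite inE; apply/imsetP/andP => [[e]|[KS /eqP Kk]].
    by rewrite inE => /andP[inc sub] ->; rewrite sub card_tuple_support.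
  have [t []] := tuple_support_surj n_gt0 K; rewrite Kk => tk inc E.
  pose f e : 'I_(n ^ k) := Ordinal (tensor_index_ltn e).
  have [g fg gf] : bijective f.
    apply: inj_card_bij => [e e' /(congr1 val) /= /tensor_index_inj //|].
    by rewrite !card_prod !card_ord -!expnD split_add.
  have Et : tensor_index (g (Ordinal tk)) = t by rewrite -[LHS]/(val (f _)) gf.
  by exists (g (Ordinal tk)); rewrite ?inE Et ?inc ?E.
rewrite card_in_imset // => e e'; rewrite !inE => /andP[ie _] /andP[ie' _] E.
by apply: tensor_index_inj; apply: (tuple_support_inj n_gt0) E; rewrite ?tensor_index_ltn.
Qed.

End Index.

(** * The certificate and its soundness *)

(* The integer matrices computed by the program.  The signed entry
   n^k [t in H] - r is kept as a difference [pos_part - neg_part], and a signed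
   matrix P - Q of size [order] as the natural matrix ((P, Q), (Q, P)). *)
Section Matrices.
Variables (n k : nat) (x : nat -> nat) (r : nat).

Definition order : nat := n ^ k./2 * n ^ split2 k.
Definition pos_part (t : nat) : nat := increasing n k t * (n ^ k * x t).
Definition neg_part (t : nat) : nat := increasing n k t * r.
Definition signed_mul (same : bool) (t t' : nat) : nat :=
  if same then pos_part t * pos_part t' + neg_part t * neg_part t'
  else pos_part t * neg_part t' + neg_part t * pos_part t'.
(** The quotient by [order] selects the block of the signed matrix. The remainder encodes the vertex
    [(a, b)] as [a + n^(k/2) b]. *)
Definition entry (u v i : nat) : nat :=
  (u %% order != v %% order) *
  signed_mul (u %/ order == v %/ order)
    (index n k i (u %% order %% n ^ k./2) (v %% order %/ n ^ k./2))
    (index n k i (v %% order %% n ^ k./2) (u %% order %/ n ^ k./2)).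
Fixpoint level (j u v : nat) : nat :=
  if j is j'.+1 then \sum_(w < order + order) level j' u w * level j' w v
  else \sum_(i < n ^ split0 k) entry u v i.
Definition trace_pos (j : nat) : nat := \sum_(z < order) level j z z.
Definition trace_neg (j : nat) : nat := \sum_(z < order) level j z (order + z).
Definition edge_count : nat := \sum_(t < n ^ k) increasing n k t * x t.
(** The signal minus the squared-entry term of the Cauchy-Schwarz bound, scaled by [(k!)^2] so that
    falling factorials replace binomials. Truncation at 0 is harmless: [refuted] is then false. *)
Definition excess (b : nat) : nat :=
  (r * b ^_ k) ^ 2 - k`! ^ 2 * n ^ split0 k * ((n ^ k) ^ 2 * edge_count + r ^ 2 * n ^ k).
(** In the factor [n ^ k], [n ^ split0 k] comes from Cauchy-Schwarz over [i] and [order] from the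
    trace bound. *)
Definition refuted (b j : nat) : bool :=
  (k`! ^ 2 * n ^ k) ^ (2 ^ j) * (trace_pos j - trace_neg j) < excess b ^ (2 ^ j).

Lemma entry_flip u v i : u < order -> v < order ->
  (entry (order + u) (order + v) i = entry u v i) *
  (entry (order + u) v i = entry u (order + v) i).
Proof.
move=> uN vN; have N0 : 0 < order by apply: leq_trans uN.
by rewrite /entry !modnDl !divnDl ?dvdnn // divnn N0 (divn_small uN) (divn_small vN).
Qed.

Lemma level_flip j u v : u < order -> v < order ->
  (level j (order + u) (order + v) = level j u v) *
  (level j (order + u) v = level j u (order + v)).
Proof.
elim: j u v => [|j IH] u v uN vN.
  by split; apply: eq_bigr => i _; rewrite (entry_flip _ uN vN).
split; rewrite /= !big_split_ord /= addnC; congr (_ + _); apply: eq_bigr => w _;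
  by rewrite !(IH _ _ uN (ltn_ord w)) !(IH _ _ (ltn_ord w) vN).
Qed.

Hypothesis n_gt0 : 0 < n.
Variable R : realType.
Notation I := 'I_(n ^ split0 k).
Notation A := 'I_(n ^ k./2).
Notation B := 'I_(n ^ split2 k).

Local Open Scope ring_scope.

Definition signed_tensor (e : I * A * B) : R :=
  (increasing n k (tensor_index e))%:R *
  ((n ^ k)%:R * (x (tensor_index e))%:R - r%:R).

Lemma signed_tensorE e :
  signed_tensor e = (pos_part (tensor_index e))%:R - (neg_part (tensor_index e))%:R.
Proof. by rewrite /signed_tensor !natrM mulrBr. Qed.

Definition vertex_index (z : A * B) : nat := (z.1 + n ^ k./2 * z.2)%N.

Lemma vertex_index_ltn z : (vertex_index z < order)%N.
Proof.
case: z => a b; rewrite /vertex_index /order /=.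
apply: leq_trans (_ : n ^ k./2 * b.+1 <= _)%N; first by rewrite mulnS ltn_add2r.
by rewrite leq_mul2l ltn_ord orbT.
Qed.

Lemma vertex_index_mod z : (vertex_index z %% n ^ k./2 = z.1)%N.
Proof. by rewrite /vertex_index addnC mulnC modnMDl modn_small. Qed.

Lemma vertex_index_div z : (vertex_index z %/ n ^ k./2 = z.2)%N.
Proof.
by rewrite /vertex_index addnC mulnC divnMDl ?expn_gt0 ?n_gt0 // divn_small ?addn0.
Qed.

Lemma vertex_index_inj : injective vertex_index.
Proof.
move=> z z' E; rewrite [z]surjective_pairing [z']surjective_pairing; congr pair; apply: ord_inj.
  by rewrite -!vertex_index_mod E.
by rewrite -!vertex_index_div E.
Qed.

Lemma big_vertex_index (V : nmodType) (F : nat -> V) :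
  \sum_(t < order) F t = \sum_(z : A * B) F (vertex_index z).
Proof.
pose f z : 'I_order := Ordinal (vertex_index_ltn z).
have inj : injective f by move=> z z' /(congr1 val) /= /vertex_index_inj.
have [g fg gf] : bijective f.
  by apply: inj_card_bij inj _; rewrite card_prod !card_ord.
by rewrite (reindex f) //; exists g => z _.
Qed.

(** The map from [((P, Q), (Q, P))] to [P - Q] is multiplicative:
    [(P - Q)^2 = (P^2 + Q^2) - (P Q + Q P)]. So squaring the natural matrix squares the signed
    one. *)
Lemma level_kernel j z z' :
  (level j (vertex_index z) (vertex_index z'))%:R -
  (level j (vertex_index z) (order + vertex_index z'))%:R =
  iter j (@kernel_sqr _ _) (tensor_kernel signed_tensor) z z'.
Proof.
elim: j z z' => [|j IH] z z'.
  rewrite /= !natr_sum -sumrB; apply: eq_bigr => i _.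
  have zN := vertex_index_ltn z; have z'N := vertex_index_ltn z'.
  have N0 : (0 < order)%N by apply: leq_trans zN.
  rewrite /entry modnDl (@divnDl order (vertex_index z') order (dvdnn _)) divnn N0 (divn_small zN) (divn_small z'N) (modn_small zN) (modn_small z'N).
  rewrite !vertex_index_mod !vertex_index_div eqxx /= /tensor_step.
  rewrite (inj_eq vertex_index_inj) !natrM -mulrBr; congr (_ * _).
  by rewrite !signed_tensorE /tensor_index /= !natrD !natrM; ring.
rewrite [RHS]/= /kernel_sqr /kernel_mul.
under eq_bigr do rewrite -!IH.
rewrite -(big_vertex_index (fun w =>
  ((level j (vertex_index z) w)%:R - (level j (vertex_index z) (order + w))%:R) *
  ((level j w (vertex_index z'))%:R - (level j w (order + vertex_index z'))%:R))).
rewrite /= !natr_sum !big_split_ord /= -!big_split /= -sumrB.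
apply: eq_bigr => w _.
rewrite !(level_flip j (ltn_ord w) (vertex_index_ltn z')) !natrM; ring.
Qed.

Lemma trace_level j :
  (trace_pos j)%:R - (trace_neg j)%:R =
  kernel_trace (kernel_exp (tensor_kernel signed_tensor) (2 ^ j)).
Proof.
rewrite /trace_pos /trace_neg !natr_sum -sumrB.
rewrite (big_vertex_index (fun z => (level j z z)%:R - (level j z (order + z))%:R)).
by apply: eq_bigr => z _; rewrite level_kernel iter_kernel_sqr.
Qed.

Lemma trace_exp_ge0 (Z : finType) (C : Z -> Z -> R) j : (forall y z, C y z = C z y) ->
  0 <= kernel_trace (kernel_exp C (2 ^ j.+1)).
Proof.
move=> symC.
have -> : kernel_trace (kernel_exp C (2 ^ j.+1)) = kernel_trace (iter j.+1 (@kernel_sqr _ _) C).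
  by apply: eq_bigr => z _; rewrite iter_kernel_sqr.
rewrite /= kernel_trace_sqr; last exact: iter_kernel_sqr_sym.
by apply: sumr_ge0 => y _; apply: sumr_ge0 => z _; apply: sqr_ge0.
Qed.

(** The trace of an even power of a symmetric kernel is nonnegative, so the truncated subtraction is
    exact. *)
Lemma trace_subn j :
  (trace_pos j.+1 - trace_neg j.+1)%:R =
  kernel_trace (kernel_exp (tensor_kernel signed_tensor) (2 ^ j.+1)).
Proof.
rewrite -trace_level natrB // -(ler_nat R) -subr_ge0 trace_level.
by apply: trace_exp_ge0 => y z; apply: tensor_kernel_sym.
Qed.

(** A present hyperedge contributes [(n^k - r)^2 <= n^(2k) + r^2], an absent one [r^2]. *)
Lemma sum_sqr_tensor_le : (forall t, x t <= 1)%N ->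
  \sum_e signed_tensor e ^+ 2 <= ((n ^ k) ^ 2 * edge_count + r ^ 2 * n ^ k)%N%:R.
Proof.
move=> x01; rewrite /edge_count natrD [((n ^ k) ^ 2 * _)%N%:R]natrM [(r ^ 2 * _)%N%:R]natrM natr_sum.
rewrite (big_tensor_index n k (fun t => (increasing n k t * x t)%N%:R)) //.
rewrite big_distrr /=.
have -> : (r ^ 2)%:R * (n ^ k)%:R = \sum_(e : I * A * B) (r ^ 2)%:R :> R.
  rewrite sumr_const !card_prod !card_ord -!expnD split_add.
  by rewrite mulr_natr.
rewrite -big_split /=; apply: ler_sum => e _; rewrite /signed_tensor.
have := x01 (tensor_index e); case: (x _) => [|[|]] // _.
all: case: (increasing _ _ _); rewrite ?mul0n ?mul1n ?mul1r ?mul0r ?mulr0 ?expr0n ?add0r ?natrX //=.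
- by rewrite sqrrN.
- by rewrite exprn_ge0.
- rewrite !mulr1; have : 0 <= r%:R * (n ^ k)%:R :> R by rewrite mulr_ge0.
  by rewrite !natrX; move: (n%:R ^+ k) => y; nra.
- by rewrite exprn_ge0.
Qed.

End Matrices.

(** * Soundness for every candidate density *)

Section Soundness.
Variables (n k : nat) (H : hypergraph n) (r : nat).

Definition incidence (t : nat) : nat := tuple_support n k t \in H.

Lemma incidence_le1 t : incidence t <= 1.
Proof. by rewrite /incidence; case: (_ \in _). Qed.

Local Open Scope ring_scope.

(** No tuple inside [S] is a hyperedge, so each increasing tuple inside [S] contributes [- r]. *)
Lemma sum_tensor_independent (R : realType) (S : {set 'I_n}) : (0 < n)%N -> independent H S ->
  \sum_(i : 'I_(n ^ split0 k)) \sum_(a : 'I_(n ^ k./2)) \sum_(b : 'I_(n ^ split2 k))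
     @signed_tensor n k incidence r R (i, a, b) *
     (inside S (split0 k) i && inside S k./2 a && inside S (split2 k) b)%:R =
  - (r * 'C(#|S|, k))%:R.
Proof.
move=> n0 indS.
rewrite (eq_bigr (fun i => \sum_(z : 'I_(n ^ k./2) * 'I_(n ^ split2 k))
  @signed_tensor n k incidence r R (i, z.1, z.2) *
     (tuple_support n k (tensor_index (i, z.1, z.2)) \subset S)%:R)); last first.
  move=> i _; rewrite pair_bigA; apply: eq_bigr => -[a b] _ /=.
  by rewrite (tensor_support_subset n0).
rewrite pair_bigA.
rewrite (reindex (fun e : 'I_(n ^ split0 k) * 'I_(n ^ k./2) * 'I_(n ^ split2 k) =>
  (e.1.1, (e.1.2, e.2)))) /=; last first.
  by exists (fun e => (e.1, e.2.1, e.2.2)) => [[[]]|[? []]].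
rewrite -(card_tensor_inside k n0 S) mulnC natrM -mulrN -sum1_card natr_sum big_distrl /=.
rewrite [RHS]big_mkcond /=; apply: eq_bigr => -[[i a] b] _ /=.
rewrite inE /signed_tensor; set t := tensor_index _.
have [tS|_] := boolP (_ \subset _); last by rewrite andbF mulr0.
have -> : incidence t = 0%N.
  rewrite /incidence; case: (boolP (_ \in _)) => // tH.
  by move/forallP: indS => /(_ (tuple_support n k t)); rewrite tH tS.
by case: (increasing _ _ _); rewrite ?mul0r // !mul1r mulr0 sub0r mulr1.
Qed.

Lemma refuted_sound (R : realType) (j : nat) (S : {set 'I_n}) :
  (0 < k)%N -> independent H S -> ~~ refuted n k incidence r #|S| j.+1.
Proof.
move=> k0 indS; apply/negP; rewrite /refuted => ref.
set m := (2 ^ j.+1)%N in ref; have m0 : (0 < m)%N by rewrite expn_gt0.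
have e0 : (0 < excess n k incidence r #|S|)%N.
  by move: ref; case: (excess _ _ _ _ _) => //; rewrite exp0n // ltn0.
have le1 : (k`! ^ 2 * n ^ split0 k *
    ((n ^ k) ^ 2 * edge_count n k incidence + r ^ 2 * n ^ k) <= (r * #|S| ^_ k) ^ 2)%N.
  by apply: ltnW; rewrite -subn_gt0.
(* A positive excess forces [k <= #|S|], so there are vertices. *)
have n0 : (0 < n)%N.
  have : (0 < #|S| ^_ k)%N.
    move: e0; rewrite /excess; case: (_ ^_ _)%N => //.
    by rewrite muln0 exp0n // sub0n.
  rewrite ffact_gt0 => /(leq_trans k0) S0.
  by rewrite -(card_ord n); apply: leq_trans S0 (max_card _).
pose f := inside S (split0 k); pose g := inside S k./2; pose h := inside S (split2 k).
pose w := @signed_tensor n k incidence r R.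
pose u (z : 'I_(n ^ k./2) * 'I_(n ^ split2 k)) : R := (g z.1 && h z.2)%:R.
pose F := kernel_form (tensor_kernel w) u.
have V := tensor_form_le w f g h.
rewrite (sum_tensor_independent R n0 indS) sqrrN card_ord -/u -/F in V.
have Q := @sum_sqr_tensor_le n k incidence r R incidence_le1.
have exF : (excess n k incidence r #|S|)%:R <= (k`! ^ 2 * n ^ split0 k)%:R * F.
  rewrite /excess natrB // -bin_ffact.
  have -> : (((r * ('C(#|S|, k) * k`!)) ^ 2)%N%:R = (k`! ^ 2)%:R * (r * 'C(#|S|, k))%:R ^+ 2 :> R).
    by rewrite -natrX -natrM; congr (_%:R); rewrite !expnMn; lia.
  rewrite lerBlDr [X in _ <= _ + X]natrM -mulrDr [X in _ <= X * _]natrM -mulrA ler_wpM2l //.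
  apply: le_trans V _; rewrite ler_wpM2l // addrC lerD2l; exact: Q.
have NF : F ^+ m <= ((order n k)%:R) ^+ m * kernel_trace (kernel_exp (tensor_kernel w) m).
  apply: kernel_form_exp_trace; first exact: tensor_kernel_sym.
  have -> : (order n k)%:R = \sum_(z : 'I_(n ^ k./2) * 'I_(n ^ split2 k)) 1 :> R.
    by rewrite sumr_const card_prod !card_ord.
  by apply: ler_sum => z _; rewrite /u; case: (_ && _); rewrite ?expr1n // expr0n ler01.
move: ref; rewrite -(ltr_nat R) natrM !natrX trace_subn // ltNge => /negP; apply.
apply: le_trans (_ : ((k`! ^ 2 * n ^ split0 k)%:R * F) ^+ m <= _).
  by rewrite lerXn2r ?nnegrE // (le_trans _ exF).
rewrite exprMn; apply: le_trans (ler_wpM2l _ NF) _; first by rewrite exprn_ge0.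
rewrite mulrA -exprMn -!natrM -natrX.
by rewrite /order -mulnA -!expnD addnA split_add natrX.
Qed.

End Soundness.

(** * Completeness *)

Local Open Scope ring_scope.

Lemma kernel_exp_scale (R : realFieldType) (Z : finType) (C C' : Z -> Z -> R) c m :
  (forall x y, C' x y = c * C x y) ->
  forall x y, kernel_exp C' m x y = c ^+ m * kernel_exp C m x y.
Proof.
move=> CC; elim: m => [|m IH] x y /=; first by rewrite mul1r.
rewrite /kernel_mul big_distrr /=; apply: eq_bigr => z _.
by rewrite CC IH exprS mulrACA.
Qed.

Lemma kernel_trace_scale (R : realFieldType) (Z : finType) (C C' : Z -> Z -> R) c m :
  (forall x y, C' x y = c * C x y) ->
  kernel_trace (kernel_exp C' m) = c ^+ m * kernel_trace (kernel_exp C m).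
Proof.
move=> CC; rewrite /kernel_trace big_distrr /=; apply: eq_bigr => z _.
exact: kernel_exp_scale.
Qed.

Lemma tensor_kernel_scale (R : realFieldType) (I A B : finType) (w w' : I * A * B -> R) c :
  (forall e, w' e = c * w e) ->
  forall y z, tensor_kernel w' y z = c ^+ 2 * tensor_kernel w y z.
Proof.
move=> ww y z; rewrite /tensor_kernel big_distrr /=; apply: eq_bigr => i _.
by rewrite /tensor_step !ww; ring.
Qed.

Lemma fact_le_exp m : (m`! <= m ^ m)%N.
Proof.
rewrite -ffactnn ffact_prod -[X in (_ <= _ ^ X)%N]card_ord -prod_nat_const.
by apply: leq_prod => i _; apply: leq_subr.
Qed.

Lemma exp_le_ffact (b k : nat) : (2 * k <= b)%N -> (b ^ k <= 2 ^ k * b ^_ k)%N.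
Proof.
move=> kb; rewrite ffact_prod -[X in (b ^ X)%N]card_ord -[X in (2 ^ X)%N]card_ord -!prod_nat_const.
rewrite -big_split /=; apply: leq_prod => i _; have := ltn_ord i; lia.
Qed.

Lemma split0_gt0 (k : nat) : (2 <= k)%N -> (0 < split0 k)%N.
Proof. by rewrite /split0; case: (odd k); rewrite ?half_gt0. Qed.

Section Completeness.
Variables (R : realType) (n k b j : nat) (p l : R).
Hypothesis k_ge2 : (2 <= k)%N.
Hypothesis n_gt0 : (0 < n)%N.
Hypothesis p01 : 0 <= p <= 1.

Notation I := 'I_(n ^ split0 k).
Notation A := 'I_(n ^ k./2).
Notation B := 'I_(n ^ split2 k).

Definition tensor_edge (e : I * A * B) : {set 'I_n} := tuple_support n k (tensor_index e).
Definition tensor_inc (e : I * A * B) : bool := increasing n k (tensor_index e).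

Lemma expect_edge_count :
  expect k p (fun H : hypergraph n => (edge_count n k (incidence k H))%:R) <= p * (n ^ k)%:R.
Proof.
case/andP: p01 => p0 p1.
have -> : expect k p (fun H : hypergraph n => (edge_count n k (incidence k H))%:R) =
  expect k p (fun H : hypergraph n => \sum_(t < n ^ k)
   (increasing n k t)%:R * (tuple_support n k t \in H)%:R).
  by apply: eq_expect => H; rewrite /edge_count natr_sum; apply: eq_bigr => t _; rewrite natrM.
rewrite expect_sum; apply: le_trans (_ : \sum_(t < n ^ k) p <= _).
  apply: ler_sum => t _; rewrite expectZ.
  have [it|_] := boolP (increasing _ _ _); last by rewrite mul0r.
  by rewrite mul1r expect_mem ?card_tuple_support.
by rewrite sumr_const card_ord mulr_natr.
Qed.

Let m := (2 ^ j.+1)%N.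
Let D : R := (n ^ k)%:R.
Let sD : R := Num.sqrt D.
(** [4 ^ k] pays for replacing [b ^ (2 * k)] by [(b ^_ k) ^ 2], [(k!)^2] is the scaling of [excess],
    and [2 ^ (k + 10)] is [2 ^ k.+1 * 512], the constant of the norm bound. Of the remaining 16, one
    factor 4 comes from [p / 2 <= ph] and the other absorbs the sum of the two error terms. *)
Let K : R := 4 ^+ k.+1 * k`!%:R ^+ 2 * 2 ^+ (k + 12).

Hypothesis l_ge1 : 1 <= l.
Hypothesis n_le : (n <= 2 ^ m)%N.
Hypothesis m_le : m%:R ^+ 3 <= 512 * l.
Hypothesis b_le : (b <= n)%N.
Hypothesis b_ge : (2 * k <= b)%N.
Hypothesis p_ge : K * l * D * sD <= p * b%:R ^+ (2 * k).

Lemma size_ge1 : 1 <= D.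
Proof. by rewrite /D ler1n expn_gt0 n_gt0. Qed.

Lemma size_sqrt : sD ^+ 2 = D.
Proof. by rewrite sqr_sqrtr // (le_trans ler01 size_ge1). Qed.

Lemma sqrt_ge1 : 1 <= sD.
Proof. by rewrite -sqrtr1 ler_wsqrtr // size_ge1. Qed.

Lemma const_ge : 16 <= K.
Proof.
have h1 : 1 <= k`!%:R ^+ 2 :> R by rewrite exprn_ege1 // ler1n fact_gt0.
have h2 : 1 <= 4 ^+ k.+1 :> R by rewrite exprn_ege1 //; lra.
have h3 : 16 <= 2 ^+ (k + 12) :> R.
  rewrite -natrX (ler_nat _ 16); apply: (@leq_trans (2 ^ 12)) => //.
  by rewrite leq_pexp2l // leq_addl.
have h12 : 1 <= 4 ^+ k.+1 * k`!%:R ^+ 2 :> R by rewrite -[leLHS]mulr1 ler_pM.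
by rewrite /K -[leLHS]mul1r ler_pM.
Qed.

(** Follows from [b <= n]. It makes [2 * p * sD] at least 1, as needed for [theta], and makes
    rounding [p] to the grid harmless. *)
Lemma edge_prob_ge : 16 * l <= p * sD.
Proof.
case/andP: p01 => p0 p1; have s1 := sqrt_ge1; have D1 := size_ge1.
have bD : b%:R ^+ (2 * k) <= D ^+ 2.
  by rewrite mulnC exprM ler_sqr ?nnegrE ?exprn_ge0 // /D -natrX ler_nat leq_exp2r // (leq_trans _ k_ge2).
have H1 : K * l * D * sD <= p * D ^+ 2.
  by apply: le_trans p_ge _; rewrite ler_wpM2l.
have H2 : K * l <= p * sD.
  rewrite -(@ler_pM2r _ (D * sD)) ?mulr_gt0 ?(lt_le_trans ltr01) //.
  rewrite mulrA; apply: le_trans H1 _; rewrite le_eqVlt; apply/orP; left; apply/eqP.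
  by rewrite -size_sqrt; ring.
apply: le_trans H2; apply: ler_wpM2r; last exact: const_ge.
exact: le_trans l_ge1.
Qed.

Let r := Num.truncn (p * D).
Let ph : R := r%:R / D.

Lemma grid_le : r%:R <= p * D < r%:R + 1.
Proof.
case/andP: p01 => p0 p1; have D1 := size_ge1.
by rewrite natr1 truncn_itv // mulr_ge0 //; lra.
Qed.

Lemma grid_bounds : [/\ p / 2 <= ph, ph <= p, `|p - ph| <= sD^-1 & (r <= n ^ k)%N].
Proof.
case/andP: p01 => p0 p1; have s1 := sqrt_ge1; have D1 := size_ge1.
have D0 : 0 < D by lra.
have s0 : 0 < sD by lra.
case/andP: grid_le => r1 r2; have pl := edge_prob_ge; have l1 := l_ge1.
have pD : 2 <= p * D.
  have h : 0 <= (p * sD - 2) * sD by rewrite mulr_ge0 ?subr_ge0 //; move: l_ge1; lra.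
  by rewrite -size_sqrt; lra.
have php : ph <= p by rewrite /ph ler_pdivrMr.
split => //.
- by rewrite /ph ler_pdivlMr // ; lra.
- rewrite ger0_norm ?subr_ge0 //.
  apply: le_trans (_ : D^-1 <= _).
    rewrite -[leRHS]div1r ler_pdivlMr // mulrBl /ph divfK ?gt_eqF //; lra.
  by rewrite lef_pV2 ?posrE // -size_sqrt expr2 ler_peMl // ltW.
rewrite -(ler_nat R) (le_trans r1) //; rewrite -/D; nra.
Qed.

(** An upper estimate for the [m]-th root of the expected trace times [n]: [2 ^ k] absorbs
    [n * order], [2 * p * sD] is [theta ^ 2], and [m ^ 3] dominates the root of [(m!)^3]. *)
Definition norm_bound : R := 2 ^+ k.+1 * m%:R ^+ 3 * p * sD.

(** The factor [n] becomes the failure probability [1 / n] in Markov's inequality. It fits because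
    [split0 k] is positive, so [n * order <= n ^ k <= 2 ^ (m * k)]. *)
Lemma expect_norm_trace :
  n%:R * expect k p (fun H : hypergraph n => kernel_trace (kernel_exp
     (tensor_kernel (centered tensor_edge tensor_inc ph H)) m)) <= norm_bound ^+ m.
Proof.
case/andP: p01 => p0 p1; have s1 := sqrt_ge1; have D1 := size_ge1.
have [ph1 ph2 ph3 _] := grid_bounds; have pl := edge_prob_ge; have l1 := l_ge1.
have s0 : 0 < sD by lra.
have ph01 : 0 <= ph <= 1 by apply/andP; split; lra.
have th0 : 1 <= 2 * p * sD by lra.
have th2 : Num.sqrt (2 * p * sD) ^+ 2 = 2 * p * sD by rewrite sqr_sqrtr //; lra.
have m0 : (0 < m)%N by rewrite expn_gt0.
have T : expect k p (fun H : hypergraph n => kernel_trace (kernel_exp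
     (tensor_kernel (centered tensor_edge tensor_inc ph H)) m)) <=
  (order n k)%:R * (2 * p * sD) ^+ m * m`!%:R ^+ 3.
  have -> : (order n k)%:R = #|A|%:R * #|B|%:R :> R by rewrite -natrM !card_ord.
  (* The choice is [theta ^ 2 = 2 * p * sD] and [rho = sD^-1], so that [theta ^ 2 * rho = 2 * p]
     bounds [p + ph ^ 2]. *)
  rewrite -th2 -(prednK m0).
  apply: (@expect_trace_le _ _ _ _ _ _ _ _ _ _ _ _ _ sD^-1) => //.
  - by move=> e ie; apply/eqP; apply: card_tuple_support.
  - move=> e e' ie ie'; rewrite /tensor_edge => /(tuple_support_inj n_gt0) E.
    by apply: tensor_index_inj; apply: E => //; apply: tensor_index_ltn.
  - by rewrite invr_gt0.
  - by rewrite -[leLHS]sqrtr1 ler_wsqrtr.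
  - by rewrite th2 mulfK ?gt_eqF //; nra.
  - move=> z s; apply: (@walk_weight_le R n k) => //; rewrite ?card_ord //.
      by rewrite invr_ge0 ltW.
    by rewrite exprVn size_sqrt mulVf // gt_eqF //; lra.
apply: le_trans (ler_wpM2l _ T) _ => //.
have nN : (n * order n k <= 2 ^ (m * k))%N.
  apply: (@leq_trans (n ^ k)); last by rewrite expnM leq_exp2r // (leq_trans _ k_ge2).
  rewrite /order -expnD -expnS leq_pexp2l // -addSn -{3}(split_add k) leq_add2r.
  by rewrite -add1n leq_add2r split0_gt0.
have mf : m`!%:R <= m%:R ^+ m :> R by rewrite -natrX ler_nat fact_le_exp.
have -> : norm_bound ^+ m = (2 ^ (m * k))%:R * (2 * p * sD) ^+ m * (m%:R ^+ m) ^+ 3.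
  have -> : norm_bound = 2 ^+ k * (2 * p * sD) * m%:R ^+ 3 by rewrite /norm_bound exprS; ring.
  rewrite [LHS]exprMn [(2 ^+ k * _) ^+ m]exprMn natrX -!exprM.
  by rewrite [(k * m)%N]mulnC [(3 * m)%N]mulnC.
have Y0 : 0 <= (2 * p * sD) ^+ m by rewrite exprn_ge0 //; lra.
have -> : n%:R * ((order n k)%:R * (2 * p * sD) ^+ m * m`!%:R ^+ 3) =
    (n * order n k)%:R * (2 * p * sD) ^+ m * m`!%:R ^+ 3.
  by rewrite [(n * _)%N%:R]natrM !mulrA.
apply: ler_pM.
- by rewrite mulr_ge0.
- by rewrite exprn_ge0 ?ler0n.
- by apply: ler_wpM2r => //; rewrite ler_nat.
- by rewrite lerXn2r ?nnegrE ?exprn_ge0.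
Qed.

Lemma refuted_of_bounds (H : hypergraph n) :
  (edge_count n k (incidence k H))%:R < l * p * D ->
  kernel_trace (kernel_exp
     (tensor_kernel (centered tensor_edge tensor_inc ph H)) m) < norm_bound ^+ m ->
  refuted n k (incidence k H) r b j.+1.
Proof.
case/andP: p01 => p0 p1; have s1 := sqrt_ge1; have D1 := size_ge1.
have [ph1 ph2 ph3 _] := grid_bounds; have pl := edge_prob_ge; have l1 := l_ge1.
have D0 : 0 < D by lra.
have s0 : 0 < sD by lra.
move=> cnt tr; rewrite /refuted -(ltr_nat R) natrM !natrX trace_subn // -/m.
have -> : kernel_trace (kernel_exp (tensor_kernel (@signed_tensor n k (incidence k H) r R)) m) =
   (D ^+ 2) ^+ m * kernel_trace (kernel_exp
     (tensor_kernel (centered tensor_edge tensor_inc ph H)) m).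
  apply: kernel_trace_scale; apply: tensor_kernel_scale => e.
  rewrite /signed_tensor /centered -/D /tensor_inc /tensor_edge /incidence /ph.
  by field; rewrite gt_eqF.
have Kb0 : 0 <= norm_bound by rewrite /norm_bound !mulr_ge0 ?exprn_ge0 //; lra.
have kf : 0 < k`!%:R :> R by rewrite ltr0n fact_gt0.
apply: lt_le_trans (_ : (k`!%:R ^+ 2 * D * (D ^+ 2 * norm_bound)) ^+ m <= _).
  rewrite [ltRHS]exprMn [X in _ < _ * X]exprMn natrM [(k`! ^ 2)%N%:R]natrX -/D.
  by rewrite ltr_pM2l ?ltr_pM2l ?exprn_gt0 ?mulr_gt0 ?exprn_gt0.
have sub_ge (x y : nat) : x%:R - y%:R <= (x - y)%N%:R :> R.
  have [xy|/ltnW xy] := leqP y x; first by rewrite natrB.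
  by rewrite (le_trans _ (ler0n _ _)) // subr_le0 ler_nat.
rewrite lerXn2r ?nnegrE ?mulr_ge0 ?exprn_ge0 //; try lra.
rewrite /excess; apply: le_trans (sub_ge _ _).
have sD2 := size_sqrt; have n0s : (n ^ split0 k)%:R <= sD.
  rewrite -ler_sqr ?nnegrE ?ler0n ?(ltW s0) // sD2 /D -natrX ler_nat -expnM leq_pexp2l // muln2.
  exact: split0_double.
set g : R := k`!%:R ^+ 2; have g0 : 0 < g by rewrite exprn_gt0.
set f : R := (b ^_ k)%:R ^+ 2; have f0 : 0 <= f by rewrite exprn_ge0.
pose T : R := 2 ^+ (k + 10); have T2 : 2 <= T.
  by rewrite /T exprD; have : 1 <= 2 ^+ k :> R by [rewrite exprn_ege1 //; lra]; move: (2 ^+ k) => y; lra.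
(* All terms are compared with [g * X]: the signal is at least [4 * T] times it, the norm term at
   most [T] times, and the squared entries at most twice, where [2 <= T]. *)
pose X := p * l * (D * sD).
have X0 : 0 <= X by rewrite /X !mulr_ge0 //; lra.
have bf : b%:R ^+ (2 * k) <= 4 ^+ k * f.
  rewrite mulnC exprM /f (_ : 4 = 2 ^+ 2 :> R); last by ring.
  rewrite [2 ^+ 2 ^+ k]exprAC -exprMn ler_sqr ?nnegrE ?mulr_ge0 ?exprn_ge0 //.
  by rewrite -!natrX -natrM ler_nat exp_le_ffact.
have pf : 16 * g * T * (l * (D * sD)) <= p * f.
  have c0 : 0 < 4 ^+ k :> R by rewrite exprn_gt0.
  rewrite -(ler_pM2l c0); apply: le_trans (_ : p * (4 ^+ k * f) <= _); last by rewrite mulrCA.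
  apply: le_trans (ler_wpM2l p0 bf); apply: le_trans p_ge.
  rewrite le_eqVlt; apply/orP; left; apply/eqP; rewrite /K -/g /T exprS !exprD.
  by move: (4 ^+ k) (2 ^+ k) => y1 y2; ring.
have main : 4 * g * T * X <= ph ^+ 2 * f.
  apply: le_trans (_ : (p / 2) ^+ 2 * f <= _); last first.
    by rewrite ler_wpM2r // ler_sqr ?nnegrE //; lra.
  have := ler_wpM2l p0 pf; rewrite /X; move: (D * sD) => y; lra.
have low : g * (n ^ split0 k)%:R * ((edge_count n k (incidence k H))%:R + ph ^+ 2 * D) <= 2 * g * X.
  have h : (edge_count n k (incidence k H))%:R + ph ^+ 2 * D <= 2 * p * l * D.
    have : ph ^+ 2 * D <= p * l * D by rewrite ler_wpM2r ?(ltW D0) //; nra.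
    lra.
  apply: le_trans (ler_wpM2l _ h) _; first by rewrite mulr_ge0 ?(ltW g0).
  have h2 : 0 <= g * (p * l * D) by rewrite !mulr_ge0 ?(ltW g0) //; lra.
  have := ler_wpM2l h2 n0s; rewrite /X; lra.
have high : g * D * norm_bound <= g * T * X.
  have h2 : 0 <= g * D * (2 ^+ k.+1 * (p * sD)) by rewrite !mulr_ge0 ?exprn_ge0 ?(ltW g0) //; lra.
  have := ler_wpM2l h2 m_le; rewrite /X /T /norm_bound exprS exprD.
  by move: (2 ^+ k) => y; lra.
have rE : r%:R = ph * D by rewrite /ph divfK // gt_eqF.
have fin : g * D * norm_bound +
    g * (n ^ split0 k)%:R * ((edge_count n k (incidence k H))%:R + ph ^+ 2 * D) <= ph ^+ 2 * f.
  apply: le_trans (lerD high low) _; apply: le_trans main.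
  have h3 : 0 <= g * X by rewrite mulr_ge0 // ltW.
  have := ler_wpM2r h3 T2; lra.
rewrite lerBrDr [((r * _) ^ 2)%N%:R]natrX [(r * _)%N%:R]natrM exprMn -/f rE.
rewrite [(k`! ^ 2 * _ * _)%N%:R]natrM [(k`! ^ 2 * _)%N%:R]natrM [(k`! ^ 2)%N%:R]natrX -/g.
rewrite natrD [((n ^ k) ^ 2 * _)%N%:R]natrM [((n ^ k) ^ 2)%N%:R]natrX -/D.
rewrite [(r ^ 2 * _)%N%:R]natrM [(r ^ 2)%N%:R]natrX -/D rE.
have D2 : 0 <= D ^+ 2 by rewrite exprn_ge0 // ltW.
have := ler_wpM2l D2 fin; lra.
Qed.

(** Markov's inequality for the sum of the normalised edge count and the normalised trace; when both
    are small, the candidate [r], the integer part of [p n^k], succeeds. *)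
Lemma prob_not_refuted :
  prob k p (fun H : hypergraph n =>
    ~~ [exists i : 'I_(n ^ k).+1, refuted n k (incidence k H) i b j.+1]) <= l^-1 + n%:R^-1.
Proof.
case/andP: p01 => p0 p1; have s1 := sqrt_ge1; have D1 := size_ge1.
have [ph1 ph2 ph3 rn] := grid_bounds; have pl := edge_prob_ge; have l1 := l_ge1.
have D0 : 0 < D by lra.
have s0 : 0 < sD by lra.
have p_gt0 : 0 < p.
  rewrite lt_neqAle p0 andbT eq_sym; apply/eqP => pz; move: pl; rewrite pz mul0r; lra.
have b0 : 0 < l * p * D by rewrite !mulr_gt0 //; lra.
have nb0 : 0 < norm_bound ^+ m.
  by rewrite exprn_gt0 // /norm_bound !mulr_gt0 ?exprn_gt0 ?ltr0n ?expn_gt0 //; lra.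
pose T (H : hypergraph n) := kernel_trace (kernel_exp
     (tensor_kernel (centered tensor_edge tensor_inc ph H)) m).
pose c (H : hypergraph n) : R := (edge_count n k (incidence k H))%:R.
have T0 H : 0 <= T H by apply: trace_exp_ge0 => y z; apply: tensor_kernel_sym.
apply: le_trans (_ : expect k p (fun H => (l * p * D)^-1 * c H + (norm_bound ^+ m)^-1 * T H) <= _).
  apply: prob_expect_le => // H uH.
    by rewrite addr_ge0 // mulr_ge0 ?invr_ge0 // ltW.
  move=> nr; have [cb|cb] := ltP (c H) (l * p * D); last first.
    rewrite -[leLHS]addr0 lerD ?mulr_ge0 ?invr_ge0 ?(ltW nb0) //.
    by rewrite mulrC ler_pdivlMr // mul1r.
  have [tb|tb] := ltP (T H) (norm_bound ^+ m); last first.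
    rewrite -[leLHS]add0r lerD ?mulr_ge0 ?invr_ge0 ?(ltW b0) //.
    by rewrite mulrC ler_pdivlMr // mul1r.
  move: nr; rewrite negb_exists => /forallP /(_ (Ordinal (rn : (r < (n ^ k).+1)%N))).
  by rewrite refuted_of_bounds.
rewrite expectD !expectZ lerD //.
  rewrite mulrC ler_pdivrMr //; apply: le_trans expect_edge_count _.
  by rewrite -/D !mulrA mulVf ?mul1r // gt_eqF //; lra.
rewrite mulrC ler_pdivrMr // mulrC ler_pdivlMr ?ltr0n // mulrC.
exact: expect_norm_trace.
Qed.

End Completeness.

Local Close Scope ring_scope.

(** * Running time of programs *)

Lemma exec_det P s t1 s1 t2 s2 : exec P s t1 s1 -> exec P s t2 s2 -> s1 = s2.
Proof.
move=> H; elim: H t2 s2 => {P s t1 s1}.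
- by move=> s t2 s2 H; inversion H.
- by move=> s a e t2 s2 H; inversion H.
- move=> P Q s s' s'' t t' _ IH1 _ IH2 t2 s2 H; inversion H; subst.
  match goal with A : exec P s _ ?u, B : exec Q ?u _ s2 |- _ =>
    apply: (IH2 _ _ _); rewrite (IH1 _ _ A); exact: B end.
- move=> e P Q s s' t e0 _ IH t2 s2 H; inversion H; subst.
    by match goal with A : exec P s _ s2 |- _ => exact: IH A end.
  by match goal with A : eval s e = 0 |- _ => rewrite A in e0 end.
- move=> e P Q s s' t e0 _ IH t2 s2 H; inversion H; subst.
    by match goal with A : is_true (eval s e != 0) |- _ => rewrite e0 in A end.
  by match goal with A : exec Q s _ s2 |- _ => exact: IH A end.
- move=> e P s s' s'' t t' e0 _ IH1 _ IH2 t2 s2 H; inversion H; subst.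
    match goal with A : exec P s _ ?u, B : exec (While e P) ?u _ s2 |- _ =>
      apply: (IH2 _ _ _); rewrite (IH1 _ _ A); exact: B end.
  by match goal with A : eval _ e = 0 |- _ => rewrite A in e0 end.
- move=> e P s e0 t2 s2 H; inversion H; subst => //.
  by match goal with A : is_true (eval s e != 0) |- _ => rewrite e0 in A end.
Qed.

(** A constant counts with its value, so that [bound ^ expr_size e] dominates the value of [e]. *)
Fixpoint expr_size (e : expr) : nat :=
  match e with
  | Const c => c.+1
  | Cell a => (expr_size a).+1
  | Op _ a b => (expr_size a + expr_size b).+1
  end.

Fixpoint prog_size (P : prog) : nat :=
  match P with
  | Skip => 1
  | Store a e => (expr_size a + expr_size e).+1
  | Seq P Q => prog_size P + prog_size Q
  | If e P Q => (expr_size e).+1 + prog_size P + prog_size Q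
  | While e P => (expr_size e).+1 + prog_size P
  end.

Lemma bitlen_leq a b : a <= b -> bitlen a <= bitlen b.
Proof. by move=> ab; rewrite /bitlen ltnS leq_trunc_log. Qed.

Lemma bitlen_gt0 a : 0 < bitlen a. Proof. by []. Qed.

Lemma bitlen_ltn a : a < 2 ^ bitlen a.
Proof. exact: trunc_log_ltn. Qed.

Lemma bitlen_le_of_ltn a m : 0 < m -> a < 2 ^ m -> bitlen a <= m.
Proof.
move=> m0 am; rewrite /bitlen; have [->|a0] := posnP a; first by rewrite trunc_log0.
by rewrite -(@ltn_exp2l 2) //; apply: leq_ltn_trans am; apply: trunc_logP.
Qed.

Lemma bitlen_exp_le B m : 0 < m -> bitlen (B ^ m) <= m * bitlen B.
Proof.
move=> m0; apply: bitlen_le_of_ltn; first by rewrite muln_gt0 m0.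
by rewrite mulnC expnM ltn_exp2r // bitlen_ltn.
Qed.

Section Cost.
Variable bound : nat.
Hypothesis bound_gt1 : 1 < bound.

Definition bounded (s : memory) : Prop := forall a, s a <= bound.

Lemma expr_size_gt0 e : 0 < expr_size e. Proof. by case: e. Qed.

Lemma eval_bound s e : bounded s -> eval s e <= bound ^ expr_size e.
Proof.
have b0 : 0 < bound by apply: ltnW.
move=> bs; elim: e => [c|a IH|o a IHa b IHb] /=.
- by apply: ltnW; apply: leq_trans (ltn_expl c bound_gt1) _; rewrite leq_pexp2l.
- by apply: leq_trans (bs _) _; rewrite expnS leq_pmulr // expn_gt0 b0.
have X0 : 0 < bound ^ expr_size a by rewrite expn_gt0 b0.
have Y0 : 0 < bound ^ expr_size b by rewrite expn_gt0 b0.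
rewrite expnS expnD.
have XY : bound ^ expr_size a * bound ^ expr_size b <=
    bound * (bound ^ expr_size a * bound ^ expr_size b) by rewrite leq_pmull.
have Xle : bound ^ expr_size a <= bound * (bound ^ expr_size a * bound ^ expr_size b).
  by apply: leq_trans XY; rewrite leq_pmulr.
case: o => /=.
- apply: leq_trans (leq_add IHa IHb) _.
  apply: (@leq_trans (2 * (bound ^ expr_size a * bound ^ expr_size b))); last by rewrite leq_mul2r bound_gt1 orbT.
  by rewrite mul2n -addnn leq_add // ?leq_pmulr // leq_pmull.
- by apply: leq_trans (leq_subr _ _) _; apply: leq_trans Xle.
- by apply: leq_trans XY; apply: leq_mul.
- by apply: leq_trans (leq_div _ _) _; apply: leq_trans Xle.
Qed.

Lemma bitlen_eval s e : bounded s -> bitlen (eval s e) <= expr_size e * bitlen bound.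
Proof.
move=> bs; apply: leq_trans (bitlen_leq (eval_bound e bs)) _.
exact: bitlen_exp_le (expr_size_gt0 e).
Qed.

(** Each node pays for operands whose length is linear in the size of the expression, whence the
    square. *)
Lemma eval_cost_le s e : bounded s -> eval_cost s e <= expr_size e ^ 2 * bitlen bound.
Proof.
move=> bs; have L0 := bitlen_gt0 bound; elim: e => [c|a IH|o a IHa b IHb] /=.
- apply: leq_trans (bitlen_eval (Const c) bs) _ => /=.
  by rewrite leq_mul2r expnS leq_pmulr ?orbT // expn_gt0.
- have := bitlen_eval a bs; have := bitlen_leq (bs (eval s a)); move: IH.
  move: (eval_cost _ _) (bitlen (eval _ _)) (bitlen (s _)) (bitlen bound) (expr_size a) L0.
  move=> x1 x2 x3 L e L0; nia.
have := bitlen_eval a bs; have := bitlen_eval b bs; move: IHa IHb.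
move: (eval_cost _ a) (eval_cost _ b) (bitlen (eval _ a)) (bitlen (eval _ b)) (bitlen bound) (expr_size a) (expr_size b) L0.
move=> x1 x2 x3 x4 L e f L0; nia.
Qed.

Variable h : nat.

Definition unit_cost : nat := h ^ 2 * bitlen bound.

(** Time is counted in units that dominate any single instruction or test of a program of size at
    most [h]. Since [h] is fixed in advance, the rules below merely add numbers of steps. *)
Definition runs (P : prog) (s : memory) (N : nat) (Q : memory -> Prop) : Prop :=
  prog_size P <= h ->
  exists t s', [/\ exec P s t s', t <= N * unit_cost & Q s'].

Lemma runs_skip s (Q : memory -> Prop) : Q s -> runs Skip s 1 Q.
Proof.
move=> q hs; exists 1, s; split=> //; first exact: ExecSkip.
by rewrite mul1n /unit_cost muln_gt0 bitlen_gt0 expn_gt0 hs.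
Qed.

Lemma runs_store s a e (Q : memory -> Prop) : bounded s ->
  Q (update s (eval s a) (eval s e)) -> runs (Store a e) s 1 Q.
Proof.
move=> bs q hs; rewrite /= in hs; do 2![eexists]; split; [exact: ExecStore | | exact: q].
rewrite mul1n /unit_cost.
have := eval_cost_le a bs; have := eval_cost_le e bs.
have := bitlen_eval a bs; have := bitlen_eval e bs.
have : ((expr_size a + expr_size e).+1 ^ 2 * bitlen bound <= h ^ 2 * bitlen bound).
  by rewrite leq_mul2r leq_exp2r // hs orbT.
move: (eval_cost _ a) (eval_cost _ e) (bitlen (eval _ a)) (bitlen (eval _ e)) (h ^ 2 * bitlen bound) (bitlen bound) (expr_size a) (expr_size e).
move=> x1 x2 x3 x4 U L x y; nia.
Qed.

Lemma guard_cost s e : bounded s -> expr_size e < h ->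
  eval_cost s e + bitlen (eval s e) <= unit_cost.
Proof.
move=> bs hs; have := eval_cost_le e bs; have := bitlen_eval e bs.
have : (expr_size e).+1 ^ 2 * bitlen bound <= unit_cost.
  by rewrite /unit_cost leq_mul2r leq_exp2r // hs orbT.
move: (eval_cost _ _) (bitlen (eval _ _)) unit_cost (bitlen bound) (expr_size e).
move=> x1 x2 U L y; nia.
Qed.

Lemma runs_seq P P' s N N' (Q : memory -> Prop) :
  runs P s N (fun s' => runs P' s' N' Q) -> runs (Seq P P') s (N + N') Q.
Proof.
move=> H hs; rewrite /= in hs; have [t [s' [e tN H']]] := H ltac:(lia).
have [t' [s'' [e' tN' q]]] := H' ltac:(lia).
exists (t + t'), s''; split=> //; first exact: ExecSeq e e'.
by rewrite mulnDl leq_add.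
Qed.

Lemma runs_if e P P' s N N' (Q : memory -> Prop) : bounded s ->
  (eval s e != 0 -> runs P s N Q) -> (eval s e = 0 -> runs P' s N' Q) ->
  runs (If e P P') s (1 + (N + N')) Q.
Proof.
move=> bs H1 H2 hs; rewrite /= in hs; have [e0|e0] := eqVneq (eval s e) 0.
  have [t [s' [ex tN q]]] := H2 e0 ltac:(lia).
  exists (eval_cost s e + bitlen (eval s e) + t), s'; split=> //; first exact: ExecIfFalse.
  by rewrite !mulnDl mul1n; have := @guard_cost s e bs ltac:(lia); lia.
have [t [s' [ex tN q]]] := H1 e0 ltac:(lia).
exists (eval_cost s e + bitlen (eval s e) + t), s'; split=> //; first exact: ExecIfTrue.
by rewrite !mulnDl mul1n; have := @guard_cost s e bs ltac:(lia); lia.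
Qed.

Lemma runs_while e P B (Inv : nat -> memory -> Prop) N :
  (forall i s, i <= B -> Inv i s -> bounded s /\ (eval s e != 0) = (i < B)) ->
  (forall i s, i < B -> Inv i s -> runs P s N (Inv i.+1)) ->
  forall s, Inv 0 s -> runs (While e P) s (B * (1 + N) + 1) (Inv B).
Proof.
move=> Hg Hb s I0 hs; rewrite /= in hs.
suff H d i s' : i + d = B -> Inv i s' -> exists t s'', [/\ exec (While e P) s' t s'',
    t <= (d * (1 + N) + 1) * unit_cost & Inv B s''].
  exact: (H B 0).
elim: d i s' => [|d IH] i s' E Ii.
  have iB : i = B by lia.
  have [bs g] := Hg i s' ltac:(lia) Ii.
  have e0 : eval s' e = 0 by apply/eqP; rewrite -[_ == _]negbK g iB ltnn.
  do 2![eexists]; split; [exact: ExecWhileFalse e0 | | by rewrite -iB].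
  by rewrite mul0n mul1n guard_cost //; lia.
have iB : i < B by lia.
have [bs g] := Hg i s' ltac:(lia) Ii.
have [t [s1 [ex tN I1]]] := Hb i s' iB Ii ltac:(lia).
have [t' [s2 [ex' tN' I2]]] := IH i.+1 s1 ltac:(lia) I1.
exists (eval_cost s' e + bitlen (eval s' e) + t + t'), s2; split=> //.
  by apply: ExecWhileTrue ex'; rewrite ?g.
have := @guard_cost s' e bs ltac:(lia).
by rewrite mulSn !mulnDl mul1n in tN' *; lia.
Qed.

End Cost.

(** * Registers, arrays and loops *)

Fixpoint powE (m : nat) : expr :=
  if m is m'.+1 then Op Mul (Cell (Const 0)) (powE m') else Const 1.

(* The registers are the [num_vars] cells following the input, and the cells
   after them form one unbounded array. *)
Definition num_vars : nat := 12.
Definition baseE (k : nat) : expr := Op Add (powE k) (Const 2).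
Definition varA (k y : nat) : expr := Op Add (baseE k) (Const y).
Definition varE (k y : nat) : expr := Cell (varA k y).
Definition arrA (k : nat) (e : expr) : expr := Op Add (Op Add (baseE k) (Const num_vars)) e.
Definition arrE (k : nat) (e : expr) : expr := Cell (arrA k e).
Definition inputE (e : expr) : expr := Cell (Op Add e (Const 2)).
Definition setP (k y : nat) (e : expr) : prog := Store (varA k y) e.
Definition putP (k : nat) (a e : expr) : prog := Store (arrA k a) e.
Definition forP (k y : nat) (bnd : expr) (body : prog) : prog :=
  Seq (setP k y (Const 0))
    (While (Op Sub bnd (varE k y)) (Seq body (setP k y (Op Add (varE k y) (Const 1))))).
Definition sumP (k x y : nat) (bnd term : expr) : prog :=
  Seq (setP k x (Const 0)) (forP k y bnd (setP k x (Op Add (varE k x) term))).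

(** Tests take the values 0 and 1 through truncated subtraction. For a zero divisor [modE] returns
    its first argument, in agreement with [%%]. *)
Definition modE (a b : expr) : expr := Op Sub a (Op Mul (Op Div a b) b).
Definition ltE (a b : expr) : expr := Op Sub (Const 1) (Op Sub (Op Add a (Const 1)) b).
Definition eqE (a b : expr) : expr := Op Sub (Const 1) (Op Add (Op Sub a b) (Op Sub b a)).
Definition notE (a : expr) : expr := Op Sub (Const 1) a.


Lemma eval_add s e f : eval s (Op Add e f) = eval s e + eval s f. Proof. by []. Qed.
Lemma eval_sub s e f : eval s (Op Sub e f) = eval s e - eval s f. Proof. by []. Qed.
Lemma eval_mul s e f : eval s (Op Mul e f) = eval s e * eval s f. Proof. by []. Qed.
Lemma eval_div s e f : eval s (Op Div e f) = eval s e %/ eval s f. Proof. by []. Qed.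
Lemma eval_const s c : eval s (Const c) = c. Proof. by []. Qed.
Definition evalE := (eval_add, eval_sub, eval_mul, eval_div, eval_const).

Lemma eval_mod s e f : eval s (modE e f) = eval s e %% eval s f.
Proof. by rewrite /modE /= {1}(divn_eq (eval s e) (eval s f)) addKn. Qed.

Lemma eval_lt s e f : eval s (ltE e f) = (eval s e < eval s f).
Proof. by rewrite /ltE /=; case: ltnP => H; lia. Qed.

Lemma eval_eq s e f : eval s (eqE e f) = (eval s e == eval s f).
Proof. by rewrite /eqE /=; case: eqVneq => H; lia. Qed.

Lemma eval_not s e (c : bool) : eval s e = c -> eval s (notE e) = ~~ c.
Proof. by rewrite /notE /= => ->; case: c. Qed.

Definition eq_off (l : seq nat) (v v' : nat -> nat) : Prop :=
  forall z, z \notin l -> v' z = v z.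

Definition for_steps (B N : nat) : nat := 1 + (B * (1 + (N + 1)) + 1).
Definition sum_steps (B : nat) : nat := 1 + for_steps B 1.

Section Rules.
Variables (n k b : nat) (x : nat -> nat) (bound h : nat).
Hypothesis bound_gt1 : 1 < bound.

(** Boundedness is carried along with the layout because the cost of every instruction depends on
    it. *)
Definition rep (s v a : nat -> nat) : Prop :=
  [/\ s 0 = n, s 1 = b, forall t, t < n ^ k -> s (t + 2) = x t,
      forall y, y < num_vars -> s (n ^ k + 2 + y) = v y &
      forall t, s (n ^ k + 2 + num_vars + t) = a t] /\ bounded bound s.

Definition hoare (v a : nat -> nat) (P : prog) (N : nat)
    (Q : (nat -> nat) -> (nat -> nat) -> Prop) : Prop :=
  forall s, rep s v a ->
    runs bound h P s N (fun s' => exists v' a', rep s' v' a' /\ Q v' a').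

Section Eval.
Variables (s v a : nat -> nat).
Hypothesis r : rep s v a.

Lemma eval_pow m : eval s (powE m) = n ^ m.
Proof.
by elim: m => [//|m IH]; rewrite expnS -IH; case: r => -[<- _ _ _ _] _.
Qed.

Lemma eval_var y : y < num_vars -> eval s (varE k y) = v y.
Proof.
move=> yn; rewrite /varE /= eval_pow; case: r => -[_ _ _ H _] _; exact: H.
Qed.

Lemma eval_arr e : eval s (arrE k e) = a (eval s e).
Proof. by rewrite /arrE /= eval_pow; case: r => -[_ _ _ _ H] _; rewrite -H. Qed.

Lemma eval_input e : eval s e < n ^ k -> eval s (inputE e) = x (eval s e).
Proof. by move=> et; rewrite /inputE /=; case: r => -[_ _ H _ _] _; apply: H. Qed.

Lemma eval_n : s 0 = n. Proof. by case: r => -[]. Qed.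
Lemma eval_b : s 1 = b. Proof. by case: r => -[]. Qed.

Lemma rep_set y w : y < num_vars -> w <= bound ->
  rep (update s (n ^ k + 2 + y) w) (update v y w) a.
Proof.
case: r => -[H0 H1 H2 H3 H4] bs yn wb; split; last first.
  by move=> t; rewrite /update; case: ifP.
rewrite /update; split.
- by case: ifP => // /eqP E; lia.
- by case: ifP => // /eqP E; lia.
- by move=> t tn; case: ifP => [/eqP E|_]; [lia | exact: H2].
- by move=> z zn; rewrite eqn_add2l; case: ifP => // _; apply: H3.
- by move=> t; case: ifP => [/eqP E|_]; [lia | exact: H4].
Qed.

Lemma rep_put t w : w <= bound ->
  rep (update s (n ^ k + 2 + num_vars + t) w) v (update a t w).
Proof.
case: r => -[H0 H1 H2 H3 H4] bs wb; split; last first.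
  by move=> t'; rewrite /update; case: ifP.
rewrite /update; split.
- by case: ifP => // /eqP E; lia.
- by case: ifP => // /eqP E; lia.
- by move=> t' tn; case: ifP => [/eqP E|_]; [lia | exact: H2].
- by move=> z zn; case: ifP => [/eqP E|_]; [lia | exact: H3].
- by move=> t'; rewrite eqn_add2l; case: ifP => // _; apply: H4.
Qed.

End Eval.

Opaque powE varE arrE inputE modE ltE eqE notE.

Lemma hoare_skip v a (Q : (nat -> nat) -> (nat -> nat) -> Prop) :
  Q v a -> hoare v a Skip 1 Q.
Proof. by move=> q s r; apply: runs_skip; exists v, a. Qed.

Lemma hoare_set v a y e w (Q : (nat -> nat) -> (nat -> nat) -> Prop) : y < num_vars ->
  (forall s, rep s v a -> eval s e = w) -> w <= bound ->
  Q (update v y w) a -> hoare v a (setP k y e) 1 Q.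
Proof.
move=> yn ew wb q s r; apply: (runs_store bound_gt1); first by case: r.
exists (update v y w), a; split=> //; rewrite ew //= (eval_pow r).
exact: rep_set.
Qed.

Lemma hoare_put v a ea e t w (Q : (nat -> nat) -> (nat -> nat) -> Prop) :
  (forall s, rep s v a -> eval s ea = t) ->
  (forall s, rep s v a -> eval s e = w) -> w <= bound ->
  Q v (update a t w) -> hoare v a (putP k ea e) 1 Q.
Proof.
move=> et ew wb q s r; apply: (runs_store bound_gt1); first by case: r.
exists v, (update a t w); split=> //; rewrite ew //= (eval_pow r) et //.
exact: rep_put.
Qed.

Lemma hoare_seq v a P P' N N' (Q : (nat -> nat) -> (nat -> nat) -> Prop) :
  hoare v a P N (fun v' a' => hoare v' a' P' N' Q) -> hoare v a (Seq P P') (N + N') Q.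
Proof.
move=> H s r; apply: (runs_seq bound_gt1) => hs; have [t [s' [e tN [v' [a' [r' q]]]]]] := H s r hs.
by exists t, s'; split=> //; apply: q.
Qed.

Lemma hoare_if v a e P P' N N' w (Q : (nat -> nat) -> (nat -> nat) -> Prop) :
  (forall s, rep s v a -> eval s e = w) ->
  (w != 0 -> hoare v a P N Q) -> (w = 0 -> hoare v a P' N' Q) ->
  hoare v a (If e P P') (1 + (N + N')) Q.
Proof.
move=> ew H1 H2 s r; apply: (runs_if bound_gt1); first by case: r.
  by rewrite ew // => w0; apply: H1.
by rewrite ew // => w0; apply: H2.
Qed.

Lemma hoare_for v a y bnd body B N (Inv : nat -> (nat -> nat) -> (nat -> nat) -> Prop)
    (Q : (nat -> nat) -> (nat -> nat) -> Prop) :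
  y < num_vars -> B <= bound -> (forall s v a, rep s v a -> eval s bnd = B) ->
  Inv 0 (update v y 0) a ->
  (forall i v a, i < B -> v y = i -> Inv i v a ->
     hoare v a body N (fun v' a' => v' y = i /\ Inv i.+1 (update v' y i.+1) a')) ->
  (forall v a, v y = B -> Inv B v a -> Q v a) ->
  hoare v a (forP k y bnd body) (for_steps B N) Q.
Proof.
move=> yn Bb eB I0 Hb HQ; apply: hoare_seq; apply: (@hoare_set _ _ _ _ 0) => // s r.
have main := @runs_while bound bound_gt1 h (Op Sub bnd (varE k y))
  (Seq body (setP k y (Op Add (varE k y) (Const 1)))) B
  (fun i s => exists v a, [/\ rep s v a, v y = i & Inv i v a]) (N + 1).
move=> hs; case: (main _ _ s _ hs).
- move=> i s' iB [v' [a' [r' vi _]]]; split; first by case: r'.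
  by rewrite evalE (eB _ _ _ r') (eval_var r') // vi subn_eq0 -ltnNge.
- move=> i s' iB [v' [a' [r' vi Ii]]]; apply: (runs_seq bound_gt1) => hs'.
  have [t [s1 [ex tN [v1 [a1 [r1 [v1i I1]]]]]]] := Hb i v' a' iB vi Ii s' r' hs'.
  exists t, s1; split=> // hs1.
  have HS : hoare v1 a1 (setP k y (Op Add (varE k y) (Const 1))) 1
      (fun v2 a2 => v2 = update v1 y i.+1 /\ a2 = a1).
    apply: (@hoare_set _ _ _ _ i.+1) => //; last exact: leq_trans Bb.
    by move=> s3 r3; rewrite evalE (eval_var r3) // evalE v1i addn1.
  have [t2 [s2 [ex2 tN2 [v2 [a2 [r2 [v2E a2E]]]]]]] := HS s1 r1 hs1.
  exists t2, s2; split=> //; exists v2, a2; split=> //; first by rewrite v2E /update eqxx.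
  by rewrite v2E a2E.
- by exists (update v y 0), a; split=> //; rewrite /update eqxx.
move=> t [s' [ex tN [v' [a' [r' vB IB]]]]].
by exists t, s'; split=> //; exists v', a'; split=> //; apply: HQ.
Qed.

(** Only the full sum has to be bounded, since the terms are natural numbers and partial sums are
    smaller. *)
Lemma hoare_sum v a (z y : nat) bnd term B (F : nat -> nat)
    (Q : (nat -> nat) -> (nat -> nat) -> Prop) :
  z != y -> z < num_vars -> y < num_vars -> B <= bound ->
  (forall s v a, rep s v a -> eval s bnd = B) ->
  (forall i v' s, i < B -> eq_off [:: z; y] v v' -> v' y = i -> rep s v' a -> eval s term = F i) ->
  \sum_(i < B) F i <= bound ->
  (forall v', eq_off [:: z; y] v v' -> v' z = \sum_(i < B) F i -> Q v' a) ->
  hoare v a (sumP k z y bnd term) (sum_steps B) Q.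
Proof.
move=> zy zn yn Bb eB eF Fb HQ; apply: hoare_seq; apply: (@hoare_set _ _ _ _ 0) => //.
apply: (@hoare_for _ _ _ _ _ _ _ (fun i v' a' =>
  [/\ a' = a, eq_off [:: z; y] v v' & v' z = \sum_(j < i) F j])) => //.
- split=> //; last by rewrite big_ord0 /update eqxx (negPf zy).
  by move=> u; rewrite !inE negb_or => /andP[/negPf uz /negPf uy]; rewrite /update uy uz.
- move=> i v' a' iB vi [-> off vz].
  apply: (@hoare_set _ _ _ _ (\sum_(j < i.+1) F j)) => //.
  + move=> s r; rewrite evalE (eval_var r) // (eF i v' s) // vz big_ord_recr //.
  + apply: leq_trans Fb; rewrite (big_ord_widen _ F iB).
    by rewrite [leqRHS](bigID (fun j : 'I_B => j < i.+1)) leq_addr.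
  + rewrite /update eqxx [y == z]eq_sym (negPf zy); split=> //; split=> //.
      by move=> u; rewrite !inE negb_or => /andP[/negPf uz /negPf uy];
         rewrite uz uy; apply: off; rewrite !inE uz uy.
by move=> v' a' _ [-> off vz]; apply: HQ.
Qed.

Lemma hoare_conseq v a P N (Q Q' : (nat -> nat) -> (nat -> nat) -> Prop) :
  hoare v a P N Q' -> (forall v' a', Q' v' a' -> Q v' a') -> hoare v a P N Q.
Proof.
move=> H QQ s r hs; have [t [s' [e tN [v' [a' [r' q]]]]]] := H s r hs.
by exists t, s'; split=> //; exists v', a'; split=> //; apply: QQ.
Qed.

End Rules.

(** * The program *)

Definition digitE (e : expr) (j : nat) : expr := modE (Op Div e (powE j)) (Cell (Const 0)).
Fixpoint increasingE_rec (e : expr) (l : seq nat) : expr :=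
  if l is j :: l' then Op Mul (ltE (digitE e j) (digitE e j.+1)) (increasingE_rec e l')
  else Const 1.
Definition increasingE (k : nat) (e : expr) : expr := increasingE_rec e (iota 0 k.-1).
Fixpoint ffactE (e : expr) (m : nat) : expr :=
  if m is m'.+1 then Op Mul (ffactE e m') (Op Sub e (Const m')) else Const 1.
Definition orderE (k : nat) : expr := Op Mul (powE k./2) (powE (split2 k)).
Definition dimE (k : nat) : expr := Op Add (orderE k) (orderE k).
Definition dim2E (k : nat) : expr := Op Mul (dimE k) (dimE k).
Definition indexE (k : nat) (i a b : expr) : expr :=
  Op Add i (Op Mul (powE (split0 k)) (Op Add a (Op Mul (powE k./2) b))).

Definition r_ans := 0.
Definition r_num := 1.
Definition r_cnt := 2.
Definition r_exc := 3.
Definition r_scl := 4.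
Definition r_cap := 5.
Definition r_off := 6.
Definition r_pos := 7.
Definition r_idx := 8.
Definition r_acc := 9.
Definition r_rnd := 10.
Definition r_neg := 11.

Definition posE (k : nat) (e : expr) : expr :=
  Op Mul (increasingE k e) (Op Mul (powE k) (inputE e)).
Definition negE (k : nat) (e : expr) : expr := Op Mul (increasingE k e) (varE k r_num).
Definition signedE (k : nat) (same e f : expr) : expr :=
  Op Add
    (Op Mul same (Op Add (Op Mul (posE k e) (posE k f)) (Op Mul (negE k e) (negE k f))))
    (Op Mul (notE same)
       (Op Add (Op Mul (posE k e) (negE k f)) (Op Mul (negE k e) (posE k f)))).
Definition entryE (k : nat) : expr :=
  let u := Op Div (varE k r_pos) (dimE k) in
  let v := modE (varE k r_pos) (dimE k) in
  let ru := modE u (orderE k) in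
  let rv := modE v (orderE k) in
  Op Mul (notE (eqE ru rv))
    (signedE k (eqE (Op Div u (orderE k)) (Op Div v (orderE k)))
       (indexE k (varE k r_idx) (modE ru (powE k./2)) (Op Div rv (powE k./2)))
       (indexE k (varE k r_idx) (modE rv (powE k./2)) (Op Div ru (powE k./2)))).
Definition excessE (k : nat) : expr :=
  let m := Op Mul (varE k r_num) (ffactE (Cell (Const 1)) k) in
  Op Sub (Op Mul m m)
    (Op Mul (Op Mul (Const (k`! ^ 2)) (powE (split0 k)))
       (Op Add (Op Mul (Op Mul (powE k) (powE k)) (varE k r_cnt))
               (Op Mul (Op Mul (varE k r_num) (varE k r_num)) (powE k)))).
Definition productE (k : nat) : expr :=
  Op Mul
    (arrE k (Op Add (varE k r_off)
       (Op Add (Op Mul (Op Div (varE k r_pos) (dimE k)) (dimE k)) (varE k r_idx))))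
    (arrE k (Op Add (varE k r_off)
       (Op Add (Op Mul (varE k r_idx) (dimE k)) (modE (varE k r_pos) (dimE k))))).

(** The new matrix is written behind the current one, which is read throughout the product. The
    scalars are squared along with it, so that both sides of the final test carry the exponent
    [2 ^ j]. *)
Definition squareP (k : nat) : prog :=
  Seq (setP k r_cap (Op Mul (varE k r_cap) (varE k r_cap)))
 (Seq (setP k r_exc (Op Mul (varE k r_exc) (varE k r_exc)))
 (Seq (setP k r_scl (Op Mul (varE k r_scl) (varE k r_scl)))
 (Seq (forP k r_pos (dim2E k)
        (Seq (sumP k r_acc r_idx (dimE k) (productE k))
             (putP k (Op Add (Op Add (varE k r_off) (dim2E k)) (varE k r_pos))
                (varE k r_acc))))
      (setP k r_off (Op Add (varE k r_off) (dim2E k)))))).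

(** [r_cap] holds [2 ^ 2 ^ j]. Stopping once it reaches [n + 3] keeps the exponent [2 ^ j] of order
    [log n] and the numbers short. The summand 3 makes the first round always square, so that the
    trace is nonnegative. *)
Definition roundP (k : nat) : prog :=
  If (Op Sub (Op Add (Cell (Const 0)) (Const 3)) (varE k r_cap)) (squareP k) Skip.

Definition fillP (k : nat) : prog :=
  forP k r_pos (dim2E k)
    (Seq (sumP k r_acc r_idx (powE (split0 k)) (entryE k))
         (putP k (varE k r_pos) (varE k r_acc))).

Definition gridP (k : nat) : prog :=
  Seq (sumP k r_cnt r_idx (powE k)
         (Op Mul (increasingE k (varE k r_idx)) (inputE (varE k r_idx))))
 (Seq (setP k r_exc (excessE k))
 (Seq (setP k r_scl (Op Mul (Const (k`! ^ 2)) (powE k)))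
 (Seq (setP k r_cap (Const 2))
 (Seq (setP k r_off (Const 0))
 (Seq (fillP k)
 (Seq (forP k r_rnd (Cell (Const 0)) (roundP k))
 (Seq (sumP k r_acc r_idx (orderE k)
        (arrE k (Op Add (varE k r_off)
           (Op Add (Op Mul (varE k r_idx) (dimE k)) (varE k r_idx)))))
 (Seq (sumP k r_neg r_idx (orderE k)
        (arrE k (Op Add (varE k r_off)
           (Op Add (Op Mul (varE k r_idx) (dimE k)) (Op Add (orderE k) (varE k r_idx))))))
      (If (Op Sub (varE k r_exc)
             (Op Mul (varE k r_scl) (Op Sub (varE k r_acc) (varE k r_neg))))
          (setP k r_ans (Const 1)) Skip))))))))).

(** The answer stays in a register until the end because cell 0 holds [n], from which all addresses
    are computed. *)
Definition searchP (k : nat) : prog :=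
  Seq (setP k r_ans (Const 0))
 (Seq (forP k r_num (Op Add (powE k) (Const 1)) (gridP k))
      (Store (Const 0) (varE k r_ans))).

(** A threshold above [n] is certified at once. The search then has [b <= n], so its numbers are
    bounded in terms of [n] and [k] alone. *)
Definition refuteP (k : nat) : prog :=
  If (Op Sub (Op Add (Cell (Const 0)) (Const 1)) (Cell (Const 1)))
    (searchP k) (Store (Const 0) (Const 1)).

(* The number of squarings performed by the first [t] rounds. *)
Fixpoint squarings (n t : nat) : nat :=
  if t is t'.+1 then squarings n t' + (2 ^ 2 ^ squarings n t' < n + 3) else 0.

Lemma squarings_le n t : squarings n t <= t.
Proof. by elim: t => //= t IH; case: (_ < n + 3); lia. Qed.

Lemma squarings_exp n t : 0 < squarings n t -> 2 ^ 2 ^ (squarings n t).-1 < n + 3.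
Proof.
elim: t => //= t IH; case: (ltnP (2 ^ 2 ^ squarings n t) (n + 3)) => [H|_] /=; first by rewrite addn1.
by rewrite addn0.
Qed.

Lemma squarings_full n : 0 < n -> 0 < squarings n n /\ n + 3 <= 2 ^ 2 ^ squarings n n.
Proof.
have step t : squarings n t = t \/ n + 3 <= 2 ^ 2 ^ squarings n t.
  elim: t => [|t IH] /=; first by left.
  case: (ltnP (2 ^ 2 ^ squarings n t) (n + 3)) => H /=; last by right; rewrite addn0.
  by case: IH => [->|]; [left; rewrite addn1 | lia].
have pos t : 0 < squarings n t.+1.
  elim: t => [|t IH]; first by rewrite /= !addnS.
  by rewrite -[squarings n t.+2]/(squarings n t.+1 + _) addn_gt0 IH.
case: n step pos => // n step pos _; split; first exact: pos.
case: (step n.+1) => [->|//].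
have H m : m < 2 ^ m by apply: ltn_expl.
case: n {step pos} => [//|n].
have h1 := H n.+2; have h2 := ltn_expl (2 ^ n.+2) (ltnSn 1).
apply: leq_trans (_ : 2 ^ (n.+1 + 3) <= _); first by have := H (n.+1 + 3); rewrite addSn; lia.
rewrite leq_exp2l //; have := H n; rewrite !expnS; lia.
Qed.

Lemma squarings_bound n t : 2 ^ squarings n t <= 2 * (n + 3).
Proof.
case: (posnP (squarings n t)) => [->|s0]; first by rewrite expn0; lia.
have H := squarings_exp s0; have := ltn_expl (2 ^ (squarings n t).-1) (ltnSn 1).
have -> : 2 ^ squarings n t = 2 * 2 ^ (squarings n t).-1 by rewrite -expnS prednK.
lia.
Qed.

(** * Size of the numbers in memory *)

Definition unit_bound (n k : nat) : nat := 4 * k`! ^ 2 * (n ^ k + n + 3) ^ 4.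
(** After [j] squarings the numbers are at most [unit_bound ^ (2 ^ j)], and [2 ^ j <= 2 * (n + 3)].
    The bound is exponential in [n], but its binary length, which the cost counts, is polynomial. *)
Definition mem_bound (n k : nat) : nat := unit_bound n k ^ (2 * (n + 3)).

Section Bounds.
Variables n k : nat.
Hypothesis k_ge2 : 1 < k.

Lemma unit_bound_ge m : m <= 4 * (n ^ k + n + 3) ^ 4 -> m <= unit_bound n k.
Proof.
move=> H; apply: leq_trans H _; rewrite /unit_bound leq_mul2r; apply/orP; right.
by rewrite leq_pmulr // expn_gt0 fact_gt0.
Qed.

Lemma unit_bound_gt1 : 1 < unit_bound n k.
Proof. 
apply: unit_bound_ge; have : 0 < (n ^ k + n + 3) ^ 4 by rewrite expn_gt0 addn3.
lia.
Qed.

Lemma mem_bound_exp m t : m <= unit_bound n k -> m ^ (2 ^ squarings n t) <= mem_bound n k.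
Proof.
move=> H; apply: leq_trans (_ : unit_bound n k ^ (2 ^ squarings n t) <= _).
  by rewrite leq_exp2r // expn_gt0.
by rewrite leq_pexp2l ?(ltnW unit_bound_gt1) // squarings_bound.
Qed.

Lemma unit_mem_bound m : m <= unit_bound n k -> m <= mem_bound n k.
Proof. exact: (@mem_bound_exp m 0). Qed.

Lemma mem_bound_gt1 : 1 < mem_bound n k.
Proof. exact: unit_mem_bound unit_bound_gt1. Qed.

Lemma order_le : order n k <= n ^ k.
Proof.
rewrite /order -expnD; case: n => [|n']; last first.
  by rewrite leq_pexp2l // -{3}(split_add k) -addnA leq_addl.
by rewrite exp0n // addn_gt0 half_gt0 k_ge2.
Qed.

Lemma split_pow_le : n ^ split0 k <= n ^ k.
Proof.
have h : 0 < split0 k by rewrite /split0; case: (odd k); rewrite ?half_gt0.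
case: n => [|n']; first by rewrite exp0n.
by rewrite leq_pexp2l // -{2}(split_add k) -addnA leq_addr.
Qed.

Lemma poly_bound (D m : nat) : D = n ^ k ->
  m <= 4 * (D + n + 3) * (D + n + 3) * (D + n + 3) * (D + n + 3) -> m <= unit_bound n k.
Proof.
move=> -> H; apply: unit_bound_ge; apply: leq_trans H _.
by rewrite !expnS expn0 muln1 !mulnA.
Qed.

Lemma bound_num : n ^ k + 1 <= unit_bound n k.
Proof. by apply: (@poly_bound _ _ erefl); move: (n ^ k) => D; nia. Qed.

Lemma bound_n : n <= unit_bound n k.
Proof. by apply: (@poly_bound _ _ erefl); move: (n ^ k) => D; nia. Qed.

Lemma bound_dim2 : (order n k + order n k) * (order n k + order n k) <= unit_bound n k.
Proof. by apply: (@poly_bound _ _ erefl); move: order_le; move: (n ^ k) (order n k) => D N; nia. Qed.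

Lemma bound_dim : order n k + order n k <= unit_bound n k.
Proof. by apply: (@poly_bound _ _ erefl); move: order_le; move: (n ^ k) (order n k) => D N; nia. Qed.

Lemma bound_off j : j <= n ->
  j * ((order n k + order n k) * (order n k + order n k)) <= unit_bound n k.
Proof.
move=> jn; apply: (@poly_bound _ _ erefl); move: order_le; move: (n ^ k) (order n k) => D N ND.
apply: (@leq_trans (n * ((D + D) * (D + D)))).
  by apply: leq_mul => //; apply: leq_mul; apply: leq_add.
have : (n + D + 3) * D <= (D + n + 3) * (D + n + 3) by nia.
nia.
Qed.

Lemma bound_scale : k`! ^ 2 * n ^ k <= unit_bound n k.
Proof.
rewrite /unit_bound [4 * _]mulnC -mulnA leq_mul2l; apply/orP; right.
by move: (n ^ k) => D; rewrite !expnS expn0 muln1; nia.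
Qed.

Lemma ffact_le_exp b m : b ^_ m <= b ^ m.
Proof.
rewrite ffact_prod -[X in _ <= b ^ X]card_ord -prod_nat_const.
by apply: leq_prod => i _; apply: leq_subr.
Qed.

Lemma bound_excess x r b : r <= n ^ k -> b <= n -> excess n k x r b <= unit_bound n k.
Proof.
move=> rD bn; rewrite /excess; apply: leq_trans (leq_subr _ _) _.
have fD : b ^_ k <= n ^ k by apply: leq_trans (ffact_le_exp _ _) _; rewrite leq_exp2r // ltnW.
apply: (@leq_trans ((n ^ k * n ^ k) ^ 2)); first by rewrite leq_exp2r // leq_mul.
apply: unit_bound_ge; apply: leq_trans (_ : _ <= (n ^ k + n + 3) ^ 4) _; last by rewrite leq_pmull.
by rewrite mulnn -expnM leq_exp2r // -addnA leq_addr.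
Qed.

Variables (x : nat -> nat) (r : nat).
Hypothesis x_le1 : forall t, x t <= 1.
Hypothesis r_le : r <= n ^ k.

Lemma pos_part_le t : pos_part n k x t <= n ^ k.
Proof.
rewrite /pos_part; case: (increasing _ _ _); rewrite ?mul0n ?mul1n //.
by rewrite -[X in _ <= X]muln1 leq_mul2l x_le1 orbT.
Qed.

Lemma neg_part_le t : neg_part n k r t <= n ^ k.
Proof. by rewrite /neg_part; case: (increasing _ _ _); rewrite ?mul0n ?mul1n. Qed.

Lemma entry_le u v i : entry n k x r u v i <= 2 * (n ^ k * n ^ k).
Proof.
rewrite /entry /signed_mul; case: (_ != _); rewrite ?mul0n ?mul1n //.
by case: (_ == _); rewrite mul2n -addnn leq_add // leq_mul // ?pos_part_le ?neg_part_le.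
Qed.

(** The dimension on the left makes the estimate reproduce itself: of its two copies in the product
    of two levels, one pays for the sum over the middle index. *)
Lemma level_le j u v : u < order n k + order n k ->
  (order n k + order n k) * level n k x r j u v <= (4 * (n ^ k) ^ 4) ^ (2 ^ j).
Proof.
move=> uM; elim: j u v uM => [|j IH] u v uM.
  have H : level n k x r 0 u v <= n ^ split0 k * (2 * (n ^ k * n ^ k)).
    rewrite /= -[X in _ <= X * _]card_ord -sum_nat_const; apply: leq_sum => i _.
    exact: entry_le.
  move: H order_le split_pow_le; rewrite !expnS !expn0 !muln1.
  move: (level _ _ _ _ _ _ _) (order n k) (n ^ split0 k) (n ^ k) => l N s D Hl HN Hs.
  apply: leq_trans (leq_mul (leq_add HN HN) Hl) _.
  apply: (@leq_trans ((D + D) * (D * (2 * (D * D))))); last by nia.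
  by rewrite leq_mul2l leq_mul2r Hs !orbT.
have M0 : 0 < order n k + order n k by apply: leq_trans uM.
rewrite [level _ _ _ _ _ _ _]/= [2 ^ j.+1]expnSr [_ ^ (2 ^ j * 2)]expnM.
set M := order n k + order n k in IH uM M0 *.
apply: (@leq_trans (\sum_(w < M) level n k x r j u w * level n k x r j w v * M)).
  by rewrite mulnC big_distrl.
set L := (4 * (n ^ k) ^ 4) ^ (2 ^ j).
rewrite -(leq_pmul2l M0) big_distrr /=.
apply: (@leq_trans (\sum_(w < M) L * L)).
  apply: leq_sum => w _; have := leq_mul (IH u w uM) (IH w v (ltn_ord w)).
  by rewrite -/L -!mulnA; move: (level _ _ _ _ _ u w) (level _ _ _ _ _ w v) => l1 l2; lia.
by rewrite sum_nat_const card_ord.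
Qed.

Lemma bound_level t u v : u < order n k + order n k ->
  level n k x r (squarings n t) u v <= mem_bound n k.
Proof.
move=> uM; have M0 : 0 < order n k + order n k by apply: leq_trans uM.
apply: (@leq_trans ((4 * (n ^ k) ^ 4) ^ (2 ^ squarings n t))); last first.
  apply: mem_bound_exp; apply: unit_bound_ge; rewrite leq_mul2l leq_exp2r //.
  by rewrite -addnA leq_addr orbT.
by apply: leq_trans (level_le _ v uM); rewrite leq_pmull.
Qed.

Lemma bound_trace t (f : nat -> nat) : 
  \sum_(z < order n k) level n k x r (squarings n t) z (f z) <= mem_bound n k.
Proof.
apply: (@leq_trans ((4 * (n ^ k) ^ 4) ^ (2 ^ squarings n t))); last first.
  apply: mem_bound_exp; apply: unit_bound_ge; rewrite leq_mul2l leq_exp2r //.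
  by rewrite -addnA leq_addr orbT.
have [N0|N0] := posnP (order n k); first by rewrite N0 big_ord0.
rewrite -(leq_pmul2l N0) big_distrr /= -[X in _ <= X * _]card_ord -sum_nat_const.
apply: leq_sum => z _; apply: leq_trans (level_le _ (f z) _); last first.
  by apply: leq_trans (ltn_ord z) _; rewrite leq_addr.
by rewrite leq_mul2r leq_addr orbT.
Qed.

End Bounds.

(** * Correctness of the program *)

Section Program.
Variables (n k b : nat) (x : nat -> nat) (h : nat).
Hypothesis k_ge2 : 1 < k.
Hypothesis b_le : b <= n.
Hypothesis x_le1 : forall t, x t <= 1.

Let bound := mem_bound n k.
Let D := n ^ k.
Let N := order n k.
Let M := N + N.

Let bound_gt1 : 1 < bound := mem_bound_gt1 n k_ge2.

Notation rep := (rep n k b x bound).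
Notation hoare := (hoare n k b x bound h).

Section Eval.
Variables (s v a : nat -> nat).
Hypothesis r : rep s v a.

Lemma eval_cell0 : eval s (Cell (Const 0)) = n. Proof. exact: eval_n r. Qed.
Lemma eval_cell1 : eval s (Cell (Const 1)) = b. Proof. exact: eval_b r. Qed.

Lemma eval_digit e j : eval s (digitE e j) = digit n (eval s e) j.
Proof. by rewrite /digitE eval_mod eval_cell0 evalE (eval_pow r). Qed.

Lemma eval_increasing e : eval s (increasingE k e) = increasing n k (eval s e).
Proof.
rewrite /increasingE /increasing /digits.
have -> : sorted ltn (mkseq (digit n (eval s e)) k) =
   all (fun j => digit n (eval s e) j < digit n (eval s e) j.+1) (iota 0 k.-1).
  apply/(sortedP 0)/allP => [H j|H j].
    rewrite mem_iota add0n => /andP[_ jk].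
    have jk' : j.+1 < size (mkseq (digit n (eval s e)) k) by rewrite size_mkseq; lia.
    by have := H j jk'; rewrite !nth_mkseq //; lia.
  rewrite size_mkseq => jk; rewrite !nth_mkseq //; last lia.
  by apply: H; rewrite mem_iota; lia.
elim: (iota 0 k.-1) => [|j l IH]; first by [].
rewrite [increasingE_rec _ _]/= evalE eval_lt !eval_digit IH /=.
by case: (_ < _); rewrite ?mul0n ?mul1n.
Qed.

Lemma eval_ffact e m : eval s (ffactE e m) = eval s e ^_ m.
Proof.
elim: m => [|m IH]; first by rewrite ffactn0.
by rewrite ffactnSr -IH.
Qed.

Lemma eval_order : eval s (orderE k) = N.
Proof. by rewrite /orderE evalE !(eval_pow r). Qed.

Lemma eval_dim : eval s (dimE k) = M.
Proof. by rewrite /dimE evalE eval_order. Qed.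

Lemma eval_dim2 : eval s (dim2E k) = M * M.
Proof. by rewrite /dim2E evalE eval_dim. Qed.

Lemma eval_index i c d : eval s (indexE k i c d) = index n k (eval s i) (eval s c) (eval s d).
Proof. by rewrite /indexE !evalE !(eval_pow r). Qed.

Lemma eval_pos e : eval s e < D -> eval s (posE k e) = pos_part n k x (eval s e).
Proof.
by move=> eD; rewrite /posE evalE eval_increasing evalE (eval_pow r) (eval_input r).
Qed.

Lemma eval_neg e : eval s (negE k e) = neg_part n k (v r_num) (eval s e).
Proof. by rewrite /negE evalE eval_increasing (eval_var r). Qed.

Lemma eval_signed same e f (c : bool) : eval s same = c -> eval s e < D -> eval s f < D ->
  eval s (signedE k same e f) = signed_mul n k x (v r_num) c (eval s e) (eval s f).
Proof.
move=> ec eD fD.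
have -> : eval s (signedE k same e f) =
    eval s same * (eval s (posE k e) * eval s (posE k f) + eval s (negE k e) * eval s (negE k f)) +
    eval s (notE same) *
      (eval s (posE k e) * eval s (negE k f) + eval s (negE k e) * eval s (posE k f)) by [].
rewrite (eval_not ec) ec.
rewrite !eval_pos // !eval_neg /signed_mul.
by case: c {ec}; rewrite ?mul0n ?mul1n ?addn0.
Qed.

Lemma eval_entry : v r_pos < M * M -> v r_idx < n ^ split0 k ->
  eval s (entryE k) =
  entry n k x (v r_num) (v r_pos %/ M) (v r_pos %% M) (v r_idx).
Proof.
move=> zM iD; have M0 : 0 < M by case: (M) zM.
have N0 : 0 < N by move: M0; rewrite /M; lia.
have [A0 B0] : 0 < n ^ k./2 /\ 0 < n ^ split2 k.
  by apply/andP; rewrite -muln_gt0.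
have divN u : u %% N %/ n ^ k./2 < n ^ split2 k.
  by rewrite ltn_divLR // mulnC ltn_mod.
have ev u w : eval s (indexE k (varE k r_idx) (modE (modE u (orderE k)) (powE k./2))
     (Op Div (modE w (orderE k)) (powE k./2))) =
   index n k (v r_idx) (eval s u %% N %% n ^ k./2) (eval s w %% N %/ n ^ k./2).
  by rewrite eval_index (eval_var r) // eval_div !eval_mod eval_order !(eval_pow r).
have evlt u w : index n k (v r_idx) (u %% N %% n ^ k./2) (w %% N %/ n ^ k./2) < D.
  by apply: index_ltn => //; rewrite ltn_mod.
pose u := Op Div (varE k r_pos) (dimE k).
pose w := modE (varE k r_pos) (dimE k).
have eu : eval s u = v r_pos %/ M by rewrite /u eval_div eval_dim (eval_var r).
have ew : eval s w = v r_pos %% M by rewrite /w eval_mod eval_dim (eval_var r).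
have -> : eval s (entryE k) = eval s (notE (eqE (modE u (orderE k)) (modE w (orderE k)))) *
    eval s (signedE k (eqE (Op Div u (orderE k)) (Op Div w (orderE k)))
      (indexE k (varE k r_idx) (modE (modE u (orderE k)) (powE k./2))
         (Op Div (modE w (orderE k)) (powE k./2)))
      (indexE k (varE k r_idx) (modE (modE w (orderE k)) (powE k./2))
         (Op Div (modE u (orderE k)) (powE k./2)))) by [].
clearbody u w; rewrite (eval_not (eval_eq _ _ _)) (eval_signed (eval_eq _ _ _)) !ev ?eu ?ew //.
by rewrite !eval_mod !eval_div eval_order eu ew.
Qed.

End Eval.

Lemma eq_off_update l v v' y w : y \in l -> eq_off l v v' -> eq_off l v (update v' y w).
Proof.
move=> yl off z zl; rewrite /update; case: eqP => [zy|_]; last exact: off.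
by rewrite zy yl in zl.
Qed.

Lemma eq_off_sub l l' v v' : {subset l <= l'} -> eq_off l v v' -> eq_off l' v v'.
Proof. by move=> ll off z zl; apply: off; apply: contra zl; apply: ll. Qed.

Lemma eq_off_trans l v v' v'' : eq_off l v v' -> eq_off l v' v'' -> eq_off l v v''.
Proof. by move=> H H' z zl; rewrite H' // H. Qed.

Let ubound m : m <= unit_bound n k -> m <= bound.
Proof. exact: unit_mem_bound. Qed.

Let dim2_le : M * M <= bound.
Proof. exact/ubound/bound_dim2. Qed.

Definition fill_steps : nat := for_steps (M * M) (sum_steps (n ^ split0 k) + 1).

Lemma fill_spec v a : v r_num <= D ->
  hoare v a (fillP k) fill_steps (fun v' a' =>
    eq_off [:: r_pos; r_idx; r_acc] v v' /\
    forall z, z < M * M -> a' z = level n k x (v r_num) 0 (z %/ M) (z %% M)).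
Proof.
move=> rD; set l := [:: r_pos; r_idx; r_acc].
apply: (@hoare_for _ _ _ _ _ _ bound_gt1 _ _ _ _ _ (M * M) _ (fun i v' a' => eq_off l v v' /\
   forall z, z < i -> a' z = level n k x (v r_num) 0 (z %/ M) (z %% M))) => //.
- by move=> s v' a' r; apply: eval_dim2 r.
- by split=> //; apply: eq_off_update.
- move=> z v' a' zM vz [off Ha].
  have M0 : 0 < M by case: (M) zM.
  apply: (hoare_seq bound_gt1).
  have lev_le : level n k x (v r_num) 0 (z %/ M) (z %% M) <= bound.
    by apply: (@bound_level n k k_ge2 x _ x_le1 rD 0); rewrite ltn_divLR.
  apply: (@hoare_sum _ _ _ _ _ _ bound_gt1 _ _ _ _ _ _ (n ^ split0 k)
     (entry n k x (v r_num) (z %/ M) (z %% M))) => //.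
  + by apply: ubound; apply: leq_trans (split_pow_le _ k_ge2) _; apply: leq_trans (bound_num _ k_ge2); rewrite leq_addr.
  + by move=> s v1 a1 r; apply: eval_pow r _.
  + move=> i v1 s iD off1 vi r; rewrite (eval_entry r) ?vi //.
      by rewrite (off1 r_num) // (off r_num) // (off1 r_pos) // vz.
    by rewrite (off1 r_pos) // vz.
  move=> v1 off1 vacc.
  have v1z : v1 r_pos = z by rewrite (off1 r_pos).
  apply: (@hoare_put _ _ _ _ _ _ bound_gt1 _ _ _ _ z (level n k x (v r_num) 0 (z %/ M) (z %% M))) => //.
  + by move=> s r; rewrite (eval_var r).
  + by move=> s r; rewrite (eval_var r) // vacc.
  split=> //; split.
    apply: eq_off_update => //; apply: eq_off_trans off _.
    by apply: eq_off_sub off1 => u; rewrite !inE => /orP[]/eqP ->.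
  move=> u uz; rewrite /update; case: eqP => [->//|/eqP ne].
  by apply: Ha; rewrite ltn_neqAle ne -ltnS.
Qed.

Section Grid.
Variables (r e c ans : nat).
Hypothesis r_le : r <= D.
Hypothesis e_le : e <= unit_bound n k.
Hypothesis c_le : c <= unit_bound n k.

Definition grid_state (j : nat) (v a : nat -> nat) : Prop :=
  [/\ v r_ans = ans /\ v r_num = r, v r_exc = e ^ (2 ^ j) /\ v r_scl = c ^ (2 ^ j),
      v r_cap = 2 ^ (2 ^ j), v r_off = j * (M * M) &
      forall z, z < M * M -> a (j * (M * M) + z) = level n k x r j (z %/ M) (z %% M)].

Definition square_steps : nat :=
  1 + (1 + (1 + (for_steps (M * M) (sum_steps M + 1) + 1))).

Lemma square_spec t v a : squarings n t.+1 = (squarings n t).+1 -> t < n ->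
  grid_state (squarings n t) v a ->
  hoare v a (squareP k) square_steps (fun v' a' =>
    grid_state (squarings n t).+1 v' a' /\ v' r_rnd = v r_rnd).
Proof.
move=> sq tn [[va vn] [ve vc] vg vo Ha].
set j := squarings n t in sq ve vc vg vo Ha *.
have sqr m : m ^ (2 ^ j) * m ^ (2 ^ j) = m ^ (2 ^ j.+1).
  by rewrite -expnD addnn -mul2n -expnS.
have pow_le m : m <= unit_bound n k -> m ^ (2 ^ j.+1) <= bound.
  by rewrite -sq; apply: mem_bound_exp.
apply: (hoare_seq bound_gt1); apply: (@hoare_set _ _ _ _ _ _ bound_gt1 _ _ _ _ (2 ^ (2 ^ j.+1))) => //.
- by move=> s R; rewrite evalE (eval_var R) // vg sqr.
- by apply: pow_le; apply: unit_bound_gt1.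
apply: (hoare_seq bound_gt1); apply: (@hoare_set _ _ _ _ _ _ bound_gt1 _ _ _ _ (e ^ (2 ^ j.+1))) => //.
- by move=> s R; rewrite evalE (eval_var R) // /update /= ve sqr.
- exact: pow_le.
apply: (hoare_seq bound_gt1); apply: (@hoare_set _ _ _ _ _ _ bound_gt1 _ _ _ _ (c ^ (2 ^ j.+1))) => //.
- by move=> s R; rewrite evalE (eval_var R) // /update /= vc sqr.
- exact: pow_le.
set v1 := update _ r_scl _.
have [v1a v1n v1e v1c] : [/\ v1 r_ans = ans, v1 r_num = r, v1 r_exc = e ^ (2 ^ j.+1) &
   v1 r_scl = c ^ (2 ^ j.+1)] by [].
have [v1g v1o v1r] : [/\ v1 r_cap = 2 ^ (2 ^ j.+1), v1 r_off = j * (M * M) & v1 r_rnd = v r_rnd] by [].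
clearbody v1.
apply: (hoare_seq bound_gt1).
set l := [:: r_pos; r_idx; r_acc].
have jn : j.+1 <= n by rewrite -sq; apply: leq_trans (squarings_le _ _) _.
apply: (@hoare_for _ _ _ _ _ _ bound_gt1 _ _ _ _ _ (M * M) _ (fun i v' a' => [/\ eq_off l v1 v',
   forall z, z < M * M -> a' (j * (M * M) + z) = level n k x r j (z %/ M) (z %% M) &
   forall z, z < i -> a' (j * (M * M) + M * M + z) = level n k x r j.+1 (z %/ M) (z %% M)])) => //.
- by move=> s v' a' R; apply: eval_dim2 R.
- by split=> //; apply: eq_off_update.
- move=> z v' a' zM vz [off Ha1 Ha2].
  have M0 : 0 < M by case: (M) zM.
  have uM : z %/ M < M by rewrite ltn_divLR.
  have v'o : v' r_off = j * (M * M) by rewrite (off r_off).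
  apply: (hoare_seq bound_gt1).
  have lev_le : level n k x r j.+1 (z %/ M) (z %% M) <= bound.
    by rewrite -sq; apply: (@bound_level n k k_ge2 x _ x_le1 r_le).
  apply: (@hoare_sum _ _ _ _ _ _ bound_gt1 _ _ _ _ _ _ M
     (fun w => level n k x r j (z %/ M) w * level n k x r j w (z %% M))) => //.
  + exact/ubound/bound_dim.
  + by move=> s v2 a2 R; apply: eval_dim R.
  + move=> w v2 s wM off2 vw R.
    have v2z : v2 r_pos = z by rewrite (off2 r_pos).
    have v2o : v2 r_off = j * (M * M) by rewrite (off2 r_off).
    rewrite /productE eval_mul !(eval_arr R).
    have -> : eval s (Op Add (varE k r_off)
       (Op Add (Op Mul (Op Div (varE k r_pos) (dimE k)) (dimE k)) (varE k r_idx))) =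
       j * (M * M) + (z %/ M * M + w).
      by rewrite !eval_add eval_mul eval_div (eval_dim R) !(eval_var R) // v2z v2o vw.
    have -> : eval s (Op Add (varE k r_off)
       (Op Add (Op Mul (varE k r_idx) (dimE k)) (modE (varE k r_pos) (dimE k)))) =
       j * (M * M) + (w * M + z %% M).
      by rewrite !eval_add eval_mul eval_mod (eval_dim R) !(eval_var R) // v2z v2o vw.
    have lt2 p q : p < M -> q < M -> p * M + q < M * M.
      by move=> pM qM; apply: (@leq_trans (p.+1 * M)); [rewrite mulSn addnC ltn_add2r | rewrite leq_mul2r pM orbT].
    have dm p q : q < M -> (p * M + q) %/ M = p /\ (p * M + q) %% M = q.
      by move=> qM; rewrite divnMDl // divn_small // addn0 modnMDl modn_small.
    have zm : z %% M < M by rewrite ltn_mod.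
    rewrite !Ha1 ?lt2 //; have [-> ->] := dm (z %/ M) w wM.
    by have [-> ->] := dm w (z %% M) zm.
  move=> v2 off2 vacc.
  have v2z : v2 r_pos = z by rewrite (off2 r_pos).
  have v2o : v2 r_off = j * (M * M) by rewrite (off2 r_off).
  apply: (@hoare_put _ _ _ _ _ _ bound_gt1 _ _ _ _ (j * (M * M) + M * M + z)
    (level n k x r j.+1 (z %/ M) (z %% M))) => //.
  + by move=> s R; rewrite !eval_add (eval_dim2 R) !(eval_var R) // v2z v2o.
  + by move=> s R; rewrite (eval_var R) // vacc.
  split=> //; split.
  + apply: eq_off_update => //; apply: eq_off_trans off _.
    by apply: eq_off_sub off2 => u; rewrite !inE => /orP[]/eqP ->.
  (* Writing into block [j.+1] leaves block [j], still being read, untouched. *)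
  + by move=> u uM2; rewrite /update; case: eqP => [E|_]; [lia | exact: Ha1].
  + move=> u uz; rewrite /update; case: eqP => [E|ne]; first by have -> : u = z by lia.
    by apply: Ha2; lia.
- move=> v' a' _ [off Ha1 Ha2].
  apply: (@hoare_set _ _ _ _ _ _ bound_gt1 _ _ _ _ (j.+1 * (M * M))) => //.
  + by move=> s R; rewrite evalE (eval_dim2 R) (eval_var R) // (off r_off) // v1o mulSn addnC.
  + exact/ubound/bound_off.
  split; last by rewrite /update /= (off r_rnd).
  split; rewrite /update //=.
  + by rewrite (off r_ans) // (off r_num).
  + by rewrite (off r_exc) // (off r_scl).
  + by rewrite (off r_cap).
  + by move=> z zM; rewrite mulSn addnC [M * M + _]addnC addnC; apply: Ha2.
Qed.

Definition round_steps : nat := 1 + (square_steps + 1).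

Lemma round_spec t v a : t < n -> grid_state (squarings n t) v a ->
  hoare v a (roundP k) round_steps (fun v' a' =>
    grid_state (squarings n t.+1) v' a' /\ v' r_rnd = v r_rnd).
Proof.
move=> tn St; have [_ _ vg _ _] := St.
apply: (@hoare_if _ _ _ _ _ _ bound_gt1 _ _ _ _ _ _ _ (n + 3 - 2 ^ (2 ^ squarings n t))).
- by move=> s R; rewrite eval_sub eval_add (eval_cell0 R) (eval_var R) // vg.
- rewrite subn_eq0 -ltnNge => g.
  have sq : squarings n t.+1 = (squarings n t).+1 by rewrite /= g addn1.
  by rewrite sq; apply: square_spec.
- move=> /eqP; rewrite subn_eq0 leqNgt => /negPf g.
  have sq : squarings n t.+1 = squarings n t by rewrite /= g addn0.
  by apply: hoare_skip => //; rewrite sq.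
Qed.

End Grid.

Definition grid_steps : nat :=
  sum_steps D + (1 + (1 + (1 + (1 + (fill_steps + (for_steps n round_steps +
  (sum_steps N + (sum_steps N + (1 + (1 + 1)))))))))).

Lemma grid_spec v a : v r_num <= D ->
  hoare v a (gridP k) grid_steps (fun v' a' => v' r_num = v r_num /\
    v' r_ans = if refuted n k x (v r_num) b (squarings n n) then 1 else v r_ans).
Proof.
set r := v r_num; set ans := v r_ans => rD.
have D_le : D <= bound by apply: ubound; apply: leq_trans (bound_num _ k_ge2); rewrite leq_addr.
have cnt_le : edge_count n k x <= D.
  apply: (@leq_trans (\sum_(t < n ^ k) 1)); last by rewrite sum_nat_const card_ord muln1.
  by apply: leq_sum => t _; case: (increasing _ _ _); rewrite ?mul0n ?mul1n.
apply: (hoare_seq bound_gt1).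
apply: (@hoare_sum _ _ _ _ _ _ bound_gt1 _ _ _ _ _ _ D (fun t => increasing n k t * x t)) => //.
- by move=> s v' a' R; apply: eval_pow R _.
- move=> t v' s tD off vt R.
  by rewrite eval_mul (eval_increasing R) (eval_input R) (eval_var R) // vt.
- exact: leq_trans cnt_le D_le.
move=> v1 off1 v1c; apply: (hoare_seq bound_gt1).
have e_le := @bound_excess n k k_ge2 x r b rD b_le.
apply: (@hoare_set _ _ _ _ _ _ bound_gt1 _ _ _ _ (excess n k x r b)) => //.
- move=> s R.
  have -> : eval s (excessE k) =
     eval s (varE k r_num) * eval s (ffactE (Cell (Const 1)) k) *
     (eval s (varE k r_num) * eval s (ffactE (Cell (Const 1)) k)) -
     k`! ^ 2 * eval s (powE (split0 k)) * (eval s (powE k) * eval s (powE k) * eval s (varE k r_cnt) +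
       eval s (varE k r_num) * eval s (varE k r_num) * eval s (powE k)) by [].
  rewrite (eval_ffact s) (eval_cell1 R) !(eval_pow R) !(eval_var R) // (off1 r_num) // v1c.
  by rewrite !mulnn.
- exact: ubound.
apply: (hoare_seq bound_gt1); apply: (@hoare_set _ _ _ _ _ _ bound_gt1 _ _ _ _ (k`! ^ 2 * D)) => //.
- by move=> s R; rewrite eval_mul (eval_pow R).
- exact/ubound/bound_scale.
apply: (hoare_seq bound_gt1); apply: (@hoare_set _ _ _ _ _ _ bound_gt1 _ _ _ _ 2) => //.
apply: (hoare_seq bound_gt1); apply: (@hoare_set _ _ _ _ _ _ bound_gt1 _ _ _ _ 0) => //.
set v2 := update _ r_off _.
have [v2a v2n v2e v2c] : [/\ v2 r_ans = ans, v2 r_num = r, v2 r_exc = excess n k x r b &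
   v2 r_scl = k`! ^ 2 * D].
  by rewrite /v2 /update /=; split=> //; rewrite ?(off1 r_ans) ?(off1 r_num).
have [v2g v2o] : v2 r_cap = 2 /\ v2 r_off = 0 by [].
clearbody v2; apply: (hoare_seq bound_gt1).
refine (hoare_conseq (@fill_spec v2 a _) _); first by rewrite v2n.
rewrite v2n => v3 a3 [off3 Ha3]; apply: (hoare_seq bound_gt1).
pose St t := grid_state r (excess n k x r b) (k`! ^ 2 * D) ans (squarings n t).
apply: (@hoare_for _ _ _ _ _ _ bound_gt1 _ _ _ _ _ n _ St) => //.
- exact/ubound/bound_n.
- by move=> s v' a' R; apply: eval_cell0 R.
- split; rewrite /update /= ?expn1 ?mul0n.
  + by rewrite (off3 r_ans) // (off3 r_num).
  + by rewrite (off3 r_exc) // (off3 r_scl) // v2e v2c.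
  + by rewrite (off3 r_cap).
  + by rewrite (off3 r_off).
  + by [].
- move=> t v' a' tn vt st.
  have rs := @round_spec r _ _ ans rD e_le (bound_scale n k_ge2) t v' a' tn st.
  refine (hoare_conseq rs _) => v4 a4 [st4 v4r]; split; first by rewrite v4r.
  by case: st4 => ? ? ? ? ?; split.
move=> v4 a4 _ [[v4a v4n] [v4e v4c] v4g v4o Ha4].
set J := squarings n n in v4e v4c v4g v4o Ha4 *.
have lt2 p q : p < M -> q < M -> p * M + q < M * M.
  by move=> pM qM; apply: (@leq_trans (p.+1 * M)); [rewrite mulSn addnC ltn_add2r | rewrite leq_mul2r pM orbT].
have dm p q : q < M -> (p * M + q) %/ M = p /\ (p * M + q) %% M = q.
  by move=> qM; have M0 : 0 < M by [case: (M) qM]; rewrite divnMDl // divn_small // addn0 modnMDl modn_small.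
have N_le : N <= bound by apply: leq_trans (ubound (bound_dim n k_ge2)); rewrite leq_addr.
have arr z q : z < N -> q < M -> a4 (J * (M * M) + (z * M + q)) = level n k x r J z q.
  move=> zN qM; have zM : z < M by rewrite /M; lia.
  by rewrite Ha4 ?lt2 //; have [-> ->] := dm z q qM.
apply: (hoare_seq bound_gt1).
apply: (@hoare_sum _ _ _ _ _ _ bound_gt1 _ _ _ _ _ _ N (fun z => level n k x r J z z)) => //.
- by move=> s v' a' R; apply: eval_order R.
- move=> z v' s zN off vz R; rewrite (eval_arr R) !eval_add eval_mul (eval_dim R) !(eval_var R) //.
  by rewrite vz (off r_off) // v4o arr // /M; lia.
- exact: (@bound_trace n k k_ge2 x r x_le1 rD n id).
move=> v5 off5 v5t; apply: (hoare_seq bound_gt1).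
apply: (@hoare_sum _ _ _ _ _ _ bound_gt1 _ _ _ _ _ _ N (fun z => level n k x r J z (N + z))) => //.
- by move=> s v' a' R; apply: eval_order R.
- move=> z v' s zN off vz R; rewrite (eval_arr R) !eval_add eval_mul (eval_dim R) (eval_order R) !(eval_var R) //.
  by rewrite vz (off r_off) // (off5 r_off) // v4o arr // /M; lia.
- exact: (@bound_trace n k k_ge2 x r x_le1 rD n (addn N)).
move=> v6 off6 v6t.
have v6n : v6 r_num = r by rewrite (off6 r_num) // (off5 r_num).
have v6a : v6 r_ans = ans by rewrite (off6 r_ans) // (off5 r_ans).
apply: (@hoare_if _ _ _ _ _ _ bound_gt1 _ _ _ _ _ _ _
  (excess n k x r b ^ (2 ^ J) - (k`! ^ 2 * D) ^ (2 ^ J) * (trace_pos n k x r J - trace_neg n k x r J))).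
- move=> s R; rewrite eval_sub eval_mul eval_sub !(eval_var R) // v6t (off6 r_acc) // v5t.
  by rewrite (off6 r_exc) // (off6 r_scl) // (off5 r_exc) // (off5 r_scl) // v4e v4c.
- rewrite subn_eq0 -ltnNge => ref.
  apply: (@hoare_set _ _ _ _ _ _ bound_gt1 _ _ _ _ 1) => //; first by apply: ltnW.
  by rewrite /update /= v6n /refuted ref.
- move=> /eqP; rewrite subn_eq0 leqNgt => /negPf ref.
  by apply: hoare_skip; rewrite v6n v6a /refuted ref.
Qed.

Definition search_steps : nat := 1 + (for_steps (D + 1) grid_steps + 1).

Lemma search_spec s v a : rep s v a ->
  runs bound h (searchP k) s search_steps (fun s' =>
    (s' 0 != 0) = [exists r : 'I_D.+1, refuted n k x r b (squarings n n)]).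
Proof.
move=> R; pose ref r := refuted n k x r b (squarings n n).
apply: (runs_seq bound_gt1) => hs.
have HS : hoare v a (setP k r_ans (Const 0)) 1 (fun v' a' => v' r_ans = 0).
  by apply: (@hoare_set _ _ _ _ _ _ bound_gt1 _ _ _ _ 0).
have [t [s1 [ex tN [v1 [a1 [R1 v1a]]]]]] := HS s R hs.
exists t, s1; split=> //; apply: (runs_seq bound_gt1) => hs1.
have HF : hoare v1 a1 (forP k r_num (Op Add (powE k) (Const 1)) (gridP k))
    (for_steps (D + 1) grid_steps) (fun v' a' => v' r_ans = has ref (iota 0 (D + 1))).
  apply: (@hoare_for _ _ _ _ _ _ bound_gt1 _ _ _ _ _ (D + 1) _
     (fun i v' a' => v' r_ans = has ref (iota 0 i))) => //.
  - exact/ubound/bound_num.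
  - by move=> s' v' a' R'; rewrite eval_add (eval_pow R').
  - move=> i v' a' iD vi va.
    have iD' : v' r_num <= D by rewrite vi; lia.
    refine (hoare_conseq (@grid_spec v' a' iD') _) => v2 a2 [v2n v2a]; rewrite v2n; split=> //.
    rewrite -addn1 iotaD has_cat /= orbF add0n /update /= v2a va vi -/(ref i).
    by case: (ref i); rewrite ?orbT ?orbF.
have [t2 [s2 [ex2 tN2 [v2 [a2 [R2 v2a]]]]]] := HF s1 R1 hs1.
exists t2, s2; split=> //.
apply: (runs_store bound_gt1); first by case: R2.
rewrite (eval_var R2) // v2a /update /=.
apply/idP/existsP => [|[r ref_r]].
  case hr : (has _ _) => // _; have /hasP[r] := hr.
  rewrite mem_iota add0n addn1 => /andP[_ rD] ref_r; by exists (Ordinal rD).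
suff -> : has ref (iota 0 (D + 1)) by [].
by apply/hasP; exists (val r) => //; rewrite mem_iota add0n addn1 ltn_ord.
Qed.

End Program.

(** * Polynomial running time *)

Section Run.
Variables (n k b : nat) (H : hypergraph n).
Hypothesis k_ge2 : 1 < k.

Let h := prog_size (refuteP k).
Let input := encode k b H.

Lemma initial_incidence t : t < n ^ k -> initial input (t + 2) = incidence k H t.
Proof. by move=> tn; rewrite addn2 /initial /= nth_mkseq. Qed.

Lemma initial_out t : n ^ k <= t -> initial input (t + 2) = 0.
Proof. by move=> tn; rewrite addn2 /initial /= nth_default // size_mkseq. Qed.

Lemma initial_bounded B : n <= B -> b <= B -> 1 <= B -> bounded B (initial input).
Proof.
move=> nB bB B1 [|[|t]] //; rewrite -addn2; have [tn|tn] := ltnP t (n ^ k).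
  by rewrite initial_incidence //; apply: leq_trans (incidence_le1 _ _ _) B1.
by rewrite initial_out.
Qed.

(** One unit cost for each branch of the test [b <= n]: in the other branch the memory contains [b],
    which [n] does not control. *)
Definition run_time : nat :=
  (1 + (search_steps n k + 1)) * (unit_cost (mem_bound n k) h + unit_cost (n + b + 2) h).

Lemma refute_run : exists t s, [/\ exec (refuteP k) (initial input) t s, t <= run_time &
  (s 0 != 0) = (n < b) ||
    [exists r : 'I_(n ^ k).+1, refuted n k (incidence k H) r b (squarings n n)]].
Proof.
have ev : eval (initial input) (Op Sub (Op Add (Cell (Const 0)) (Const 1)) (Cell (Const 1))) = n + 1 - b by [].
have [bn|nb] := leqP b n.
  have B1 := mem_bound_gt1 n k_ge2.
  have nB : n <= mem_bound n k by apply/unit_mem_bound/bound_n.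
  have bs : bounded (mem_bound n k) (initial input).
    by apply: initial_bounded; [|apply: leq_trans nB|apply: ltnW].
  have R : rep n k b (incidence k H) (mem_bound n k) (initial input) (fun=> 0) (fun=> 0).
    split=> //; split=> //; first exact: initial_incidence.
      by move=> y _; rewrite addnAC initial_out // leq_addr.
    move=> t; have -> : n ^ k + 2 + num_vars + t = n ^ k + num_vars + t + 2 by lia.
    by rewrite initial_out // -addnA leq_addr.
  have [||t [s [ex tN sE]]] := @runs_if _ B1 h _ (searchP k) (Store (Const 0) (Const 1)) (initial input)
     (search_steps n k) 1 (fun s => (s 0 != 0) = [exists r : 'I_(n ^ k).+1,
       refuted n k (incidence k H) r b (squarings n n)]) bs _ _ (leqnn _).
  - by move=> _; refine (@search_spec n k b (incidence k H) h k_ge2 bn _ _ _ _ R); apply: incidence_le1.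
  - by rewrite ev; lia.
  exists t, s; split=> //; apply: leq_trans tN _; rewrite leq_mul2l; apply/orP; right.
  exact: leq_addr.
have B1 : 1 < n + b + 2 by lia.
have bs : bounded (n + b + 2) (initial input) by apply: initial_bounded; lia.
have [||t [s [ex tN sE]]] := @runs_if _ B1 h _ (searchP k) (Store (Const 0) (Const 1)) (initial input)
   (search_steps n k) 1 (fun s => s 0 != 0) bs _ _ (leqnn _).
- by rewrite ev; lia.
- by move=> _; apply: (runs_store B1) => //.
exists t, s; split=> //; apply: leq_trans tN _; rewrite leq_mul2l; apply/orP; right.
exact: leq_addl.
Qed.

End Run.

(** Each tensor entry has length at least 1, so time polynomial in [n ^ k] and [bitlen b] is
    polynomial in the input length. *)
Lemma input_length_encode n k b (H : hypergraph n) :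
  [/\ 1 < input_length (encode k b H), n ^ k <= input_length (encode k b H) &
      bitlen b <= input_length (encode k b H)].
Proof.
rewrite /input_length /encode !big_cons; set s := \sum_(a <- mkseq _ _) _.
have : n ^ k <= s.
  rewrite -[X in X <= _](size_mkseq (fun i => nat_of_bool (tuple_support n k i \in H))).
  rewrite -sum1_size; apply: leq_sum => a _; exact: bitlen_gt0.
have := bitlen_gt0 n; have := bitlen_gt0 b.
move: s (bitlen n) (bitlen b) (n ^ k) => s p q D; split; lia.
Qed.

(* Bounds that are polynomial in the length [l] of the encoding of a hypergraph
   on [n] vertices with threshold [b]. *)
Definition poly_bounded (k : nat) (f : nat -> nat -> nat) : Prop :=
  exists c d, forall n b l, 1 < l -> n ^ k <= l -> bitlen b <= l -> f n b <= c * l ^ d.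

Section PolyBounded.
Variable k : nat.
Hypothesis k_ge2 : 1 < k.

Lemma poly_bounded_const m : poly_bounded k (fun _ _ => m).
Proof. by exists m, 0 => n b l _ _ _; rewrite expn0 muln1. Qed.

Lemma poly_bounded_leq f g : (forall n b, f n b <= g n b) ->
  poly_bounded k g -> poly_bounded k f.
Proof.
move=> fg [c [d H]]; exists c, d => n b l l1 nl bl.
by apply: leq_trans (fg n b) _; apply: H.
Qed.

Lemma poly_bounded_mul f g : poly_bounded k f -> poly_bounded k g ->
  poly_bounded k (fun n b => f n b * g n b).
Proof.
move=> [c [d H]] [c' [d' H']]; exists (c * c'), (d + d') => n b l l1 nl bl.
by rewrite expnD mulnACA leq_mul ?H ?H'.
Qed.

Lemma poly_bounded_add f g : poly_bounded k f -> poly_bounded k g ->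
  poly_bounded k (fun n b => f n b + g n b).
Proof.
move=> [c [d H]] [c' [d' H']]; exists (c + c'), (d + d') => n b l l1 nl bl.
have l0 : 0 < l by apply: ltnW.
rewrite mulnDl leq_add //.
  by apply: leq_trans (H n b l l1 nl bl) _; rewrite leq_mul2l leq_pexp2l ?leq_addr ?orbT.
by apply: leq_trans (H' n b l l1 nl bl) _; rewrite leq_mul2l leq_pexp2l ?leq_addl ?orbT.
Qed.

Lemma poly_bounded_size : poly_bounded k (fun n _ => n ^ k).
Proof. by exists 1, 1 => n b l _ nl _; rewrite mul1n expn1. Qed.

Lemma poly_bounded_bitlen : poly_bounded k (fun _ b => bitlen b).
Proof. by exists 1, 1 => n b l _ _ bl; rewrite mul1n expn1. Qed.

Lemma poly_bounded_n : poly_bounded k (fun n _ => n).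
Proof.
apply: poly_bounded_leq poly_bounded_size => n _.
by case: n => // n; rewrite -[X in X <= _]expn1 leq_pexp2l // ltnW.
Qed.

Lemma bitlen_add_le a c : bitlen (a + c) <= bitlen a + bitlen c.
Proof.
apply: bitlen_le_of_ltn; first by rewrite addn_gt0.
rewrite expnD; have := bitlen_ltn a; have := bitlen_ltn c.
have : 1 < 2 ^ bitlen a by rewrite -{1}(expn0 2) ltn_exp2l.
have : 1 < 2 ^ bitlen c by rewrite -{1}(expn0 2) ltn_exp2l.
move: (2 ^ bitlen a) (2 ^ bitlen c) => p q; nia.
Qed.

Lemma bitlen_leq_self a : bitlen a <= a.+1.
Proof. by apply: bitlen_le_of_ltn => //; apply: ltn_trans (ltn_expl _ _). Qed.

Lemma run_time_poly : poly_bounded k (fun n b => run_time n k b).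
Proof.
have pD := poly_bounded_size; have pn := poly_bounded_n; have pc := poly_bounded_const.
have pN : poly_bounded k (fun n _ => order n k).
  by apply: poly_bounded_leq pD => n _; apply: order_le.
have ps : poly_bounded k (fun n _ => n ^ split0 k).
  by apply: poly_bounded_leq pD => n _; apply: split_pow_le.
have pu : poly_bounded k (fun n _ => unit_bound n k).
  rewrite /unit_bound !expnS expn0.
  do ?[exact: pc | exact: pD | exact: pn | exact: pN | exact: ps | apply: poly_bounded_mul | apply: poly_bounded_add].
(* Only the exponent [2 * (n + 3)] must leave the logarithm; the length of [unit_bound] is bounded
   crudely by [unit_bound + 1]. *)
have pb : poly_bounded k (fun n _ => bitlen (mem_bound n k)).
  apply: (@poly_bounded_leq _ (fun n _ => 2 * (n + 3) * (unit_bound n k).+1)).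
    move=> n _; apply: leq_trans (bitlen_exp_le _ _) _; first by rewrite addn3.
    by rewrite leq_mul2l bitlen_leq_self orbT.
  have -> : (fun n _ => 2 * (n + 3) * (unit_bound n k).+1) = (fun n (_ : nat) => 2 * (n + 3) * (unit_bound n k + 1)).
    by apply: boolp.funext => n; rewrite addn1.
  do ?[exact: pc | exact: pD | exact: pn | exact: pN | exact: ps | exact: pu | apply: poly_bounded_mul | apply: poly_bounded_add].
have pl : poly_bounded k (fun n b => bitlen (n + b + 2)).
  apply: (@poly_bounded_leq _ (fun n b => n + 1 + bitlen b + bitlen 2)).
    move=> n b; apply: leq_trans (bitlen_add_le _ _) _; rewrite leq_add2r.
    apply: leq_trans (bitlen_add_le _ _) _; rewrite leq_add2r addn1; exact: bitlen_leq_self.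
  do ?[exact: pc | exact: pD | exact: pn | exact: pN | exact: ps | exact: pu | exact: poly_bounded_bitlen | apply: poly_bounded_mul | apply: poly_bounded_add].
rewrite /run_time /unit_cost /search_steps /grid_steps /for_steps /sum_steps /fill_steps
  /round_steps /square_steps /for_steps /sum_steps /for_steps.
do ?[exact: pc | exact: pD | exact: pn | exact: pN | exact: ps | exact: pu | exact: pb | exact: pl | apply: poly_bounded_mul | apply: poly_bounded_add].
Qed.

Lemma refuteP_poly_time : poly_time_on (encodings k) (refuteP k).
Proof.
have [c [d H]] := run_time_poly; exists c, d => _ [n [b [G [_ ->]]]].
have [t [s [ex tN _]]] := refute_run b G k_ge2.
have [l1 nl bl] := input_length_encode k b G.
exists t, s; split=> //; apply: leq_trans tN _; apply: leq_trans (leq_addr _ _).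
exact: H.
Qed.

(** Execution is deterministic, so the halting run that was constructed is the only one. *)
Lemma refuteP_accepts n b (G : hypergraph n) :
  accepts (refuteP k) (encode k b G) <->
  (n < b) || [exists r : 'I_(n ^ k).+1, refuted n k (incidence k G) r b (squarings n n)].
Proof.
have [t [s [ex _ sE]]] := refute_run b G k_ge2; rewrite -sE; split.
  by move=> [t' [s' [ex' s0]]]; rewrite (exec_det ex ex').
by move=> s0; exists t, s.
Qed.

End PolyBounded.

(** * The theorem *)

Local Open Scope classical_set_scope.
Local Open Scope ring_scope.

Lemma threshold_ge (R : realType) (beta : R) : 0 <= beta -> beta <= (threshold beta)%:R.
Proof.
move=> b0; rewrite /threshold natr_absz ger0_norm ?ceil_ge // ceil_ge0.
exact: lt_le_trans b0.
Qed.

Lemma lt_threshold (R : realType) (beta : R) (a : nat) : 0 <= beta ->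
  (a < threshold beta)%N = (a%:R < beta).
Proof.
move=> b0; have c0 : 0 <= Num.ceil beta by rewrite ceil_ge0; apply: lt_le_trans b0.
by rewrite -[a%:R]/((Posz a)%:~R) -ceil_gt_int /threshold -ltz_nat gez0_abs.
Qed.

Lemma refuted_threshold_ge n k x r b j : refuted n k x r b j -> (k <= b)%N.
Proof.
case: (leqP k b) => // bk; rewrite /refuted /excess ffact_small //.
by rewrite muln0 exp0n // sub0n exp0n ?expn_gt0.
Qed.

Lemma independent_sub n (H : hypergraph n) (S T : {set 'I_n}) :
  T \subset S -> independent H S -> independent H T.
Proof.
move=> TS /forallP iS; apply/forallP => e; apply/implyP => eH.
have /implyP/(_ eH) := iS e; apply: contra => eT.
exact: fintype.subset_trans eT TS.
Qed.

(** The certificate excludes independent sets of exactly [b] vertices; a larger one would contain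
    such a set. *)
Lemma alpha_lt_refuted (R : realType) (n k : nat) (H : hypergraph n) r b j :
  (1 < k)%N -> refuted n k (incidence k H) r b j.+1 -> (alpha H < b)%N.
Proof.
move=> k2 ref; rewrite ltnNge; apply/negP => ba.
(* If the empty set is a hyperedge, no set is independent and [alpha H = 0]; positivity of [b] rules
   this case out. *)
have b0 : (0 < b)%N by apply: leq_trans (refuted_threshold_ge ref); apply: ltnW.
have [S iS Sb] : exists2 S : {set 'I_n}, independent H S & (b <= #|S|)%N.
  have [|S iS aE] := @eq_bigmax_cond _ [pred S : {set 'I_n} | independent H S] (fun S => #|S|).
    rewrite lt0n; apply/eqP => c0; move: (leq_trans b0 ba); rewrite /alpha big_pred0 // => S.
    by apply/negbTE/negP => iS; have := card0_eq c0 S; rewrite inE iS.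
  by exists S => //; rewrite -aE.
have : (0 < #|[set A : {set 'I_n} | A \subset S & #|A| == b]|)%N.
  by rewrite cards_draws bin_gt0.
case/card_gt0P => T; rewrite inE => /andP[TS /eqP Tb].
have := @refuted_sound n k H r R j T (ltnW k2) (independent_sub TS iS).
by rewrite Tb ref.
Qed.

(** * Numerical estimates *)

Lemma bin_le_exp n k : ('C(n, k) <= n ^ k)%N.
Proof.
apply: leq_trans (ffact_le_exp n k); rewrite -bin_ffact.
by rewrite leq_pmulr // fact_gt0.
Qed.

Lemma ln2_ge (R : realType) : 2^-1 <= ln 2 :> R.
Proof.
have h : ln (1 + - 2^-1) <= - 2^-1 :> R by apply: le_ln1Dx; lra.
have E : 1 + - 2^-1 = 2^-1 :> R by lra.
by rewrite E lnV ?posrE // lerN2 in h.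
Qed.

Lemma powR_half (R : realType) (n k : nat) :
  n%:R `^ ((5 * k)%:R / 2) = (n ^ k)%:R ^+ 2 * Num.sqrt (n ^ k)%:R :> R.
Proof.
rewrite -powR12_sqrt // natrX -powR_mulrn ?ler0n // -powR_mulrn ?powR_ge0 // -!powRrM.
have [->|n0] := eqVneq n 0%N.
  have [->|k0] := eqVneq k 0%N; first by rewrite muln0 !mul0r !powRr0 mulr1.
  by rewrite !powR0 ?mulr0 // !mulf_neq0 ?invr_neq0 ?pnatr_eq0 // muln_eq0.
rewrite -powRD; last by rewrite pnatr_eq0 n0 implybT.
by congr (_ `^ _); rewrite natrM; lra.
Qed.

Lemma ln_ge1 (R : realType) (n : nat) : (4 <= n)%N -> 1 <= ln n%:R :> R.
Proof.
move=> n4; have h : ln (2 ^+ 2) <= ln n%:R :> R.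
  by rewrite ler_ln ?posrE ?exprn_gt0 ?ltr0n //; [rewrite -natrX ler_nat | lia].
by have := ln2_ge R; move: h; rewrite lnXn //; lra.
Qed.

(** Before the last squaring [2 ^ 2 ^ j < n + 3 <= n ^ 2]. Taking logarithms, with [1 / 2 <= ln 2],
    gives the constant 8, whose cube is the 512 of the bound on [m ^ 3]. *)
Lemma squarings_ln (R : realType) (n j : nat) : (4 <= n)%N -> squarings n n = j.+1 -> (2 ^ j.+1)%:R <= 8 * ln n%:R :> R.
Proof.
move=> n4 jE; have H := @squarings_exp n n; rewrite jE /= in H; have {}H := H isT.
have h1 : (2 ^ 2 ^ j <= n ^ 2)%N by apply: leq_trans (ltnW H) _; rewrite -mulnn; nia.
have h2 : ln ((2 ^ 2 ^ j)%:R) <= ln ((n ^ 2)%:R) :> R.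
  by rewrite ler_ln ?posrE ?ltr0n ?expn_gt0 ?ler_nat //; lia.
have n0 : 0 < n%:R :> R by rewrite ltr0n; lia.
move: h2; rewrite !natrX !lnXn // -[ln 2 *+ _]mulr_natl -[ln n%:R *+ 2]mulr_natl => h2.
rewrite exprS; have := ln2_ge R; have y0 : 0 <= 2 ^+ j :> R by rewrite exprn_ge0.
move: h2; rewrite natrX; move: (2 ^+ j) y0 (ln 2) (ln n%:R) => y y0 a c h2 a2.
by nra.
Qed.

Section FailBound.
Variables (R : realType) (n k : nat) (p beta : R).
Hypothesis k_ge2 : (2 <= k)%N.
Hypothesis n_ge4 : (4 <= n)%N.
Hypothesis n_ge : ((2 * k) ^ (2 * k) <= n)%N.
Hypothesis p01 : 0 <= p <= 1.
Hypothesis beta_ge : n%:R `^ (3 / 4) * ln n%:R <= beta.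

Let K : R := 4 ^+ k.+1 * k`!%:R ^+ 2 * 2 ^+ (k + 12).
Hypothesis p_ge : K * (n%:R `^ ((5 * k)%:R / 2) * ln n%:R ^+ 3 / beta ^+ (2 * k)) <=
  p * 'C(n, k)%:R.

Lemma fail_prob_le : fail_prob k (refuteP k) n p beta <= (ln n%:R ^+ 3)^-1 + n%:R^-1.
Proof.
have l1 := ln_ge1 R n_ge4; case/andP: (p01) => p0 p1.
have n0 : (0 < n)%N by lia.
have nR : 0 < n%:R :> R by rewrite ltr0n.
have beta0 : 0 < beta.
  apply: lt_le_trans beta_ge; rewrite mulr_gt0 ?powR_gt0 //; lra.
set b := threshold beta; have bb : beta <= b%:R by apply: threshold_ge; apply: ltW.
(* Above [n] the program always accepts, so the failure probability is 0. *)
have [nb|bn] := ltnP n b.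
  rewrite /fail_prob /prob big_pred0; first by rewrite addr_ge0 ?invr_ge0 ?exprn_ge0 ?ler0n //; lra.
  move=> H; apply/negbTE; rewrite negb_and negbK; apply/orP; right.
  by apply/asboolP; apply/(refuteP_accepts k_ge2); rewrite nb.
have [j jE] : exists j, squarings n n = j.+1.
  by have [s0 _] := squarings_full n0; exists (squarings n n).-1; rewrite prednK.
have [_ nm] := squarings_full n0; rewrite jE in nm.
set l := ln n%:R ^+ 3.
have l_ge1 : 1 <= l by rewrite exprn_ege1.
pose D : R := (n ^ k)%:R.
have D1 : 1 <= D by rewrite /D ler1n expn_gt0 n0.
have K1 := const_ge R k.
(* Here [n^(5k/2) = D^2 * sqrt D], and ['C(n, k) <= D] cancels one factor [D]. *)
have pb : K * l * D * Num.sqrt D <= p * b%:R ^+ (2 * k).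
  have be0 : 0 < beta ^+ (2 * k) by rewrite exprn_gt0.
  have h : K * l * D * Num.sqrt D * D <= p * beta ^+ (2 * k) * D.
    have := p_ge; rewrite powR_half -/l -/D 2!mulrA ler_pdivrMr // => h.
    apply: le_trans (_ : p * 'C(n, k)%:R * beta ^+ (2 * k) <= _).
      by apply: le_trans h; rewrite le_eqVlt; apply/orP; left; apply/eqP; ring.
    rewrite [leRHS]mulrAC ler_wpM2r ?(ltW be0) // ler_wpM2l //.
    by rewrite /D ler_nat bin_le_exp.
  have {}h : K * l * D * Num.sqrt D <= p * beta ^+ (2 * k).
    by move: h; rewrite ler_pM2r //; apply: lt_le_trans D1.
  apply: le_trans h _; rewrite ler_wpM2l //.
  by rewrite lerXn2r ?nnegrE ?ler0n ?(ltW beta0).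
(* For [b < 2 * k] the size of [n] gives [p * b^(2k) <= D], whereas the density assumption makes the
   left side at least [16 * D]. *)
have b_ge : (2 * k <= b)%N.
  rewrite leqNgt; apply/negP => b2k.
  have h1 : b%:R ^+ (2 * k) <= D.
    rewrite -natrX /D ler_nat; apply: (@leq_trans ((2 * k) ^ (2 * k))%N).
      by rewrite leq_exp2r ?(ltnW b2k) // muln_gt0 (ltnW k_ge2).
    by apply: leq_trans n_ge _; rewrite -{1}(expn1 n) leq_pexp2l // (ltnW k_ge2).
  have s1 : 1 <= Num.sqrt D by rewrite -[leLHS]sqrtr1 ler_wsqrtr.
  have h2 : p * b%:R ^+ (2 * k) <= D by rewrite -[leRHS]mul1r ler_pM // exprn_ge0.
  have h3 : 16 * D <= K * l * D * Num.sqrt D.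
    have K0 : 0 <= K by apply: le_trans K1.
    have a1 : 16 <= K * l by rewrite -[leLHS]mulr1 ler_pM.
    by rewrite -[leLHS]mulr1 ler_pM ?ler_pM // mulr_ge0 // ltW // (lt_le_trans ltr01).
  by move: (le_trans h3 (le_trans pb h2)); lra.
apply: le_trans (_ : prob k p (fun H : hypergraph n =>
    ~~ [exists i : 'I_(n ^ k).+1, refuted n k (incidence k H) i b j.+1]) <= _); last first.
  apply: (prob_not_refuted k_ge2 n0 p01 l_ge1 _ _ bn b_ge pb).
    by apply: leq_trans nm; rewrite leq_addr.
  have := squarings_ln R n_ge4 jE; set m := (2 ^ j.+1)%:R => mE.
  apply: le_trans (_ : (8 * ln n%:R) ^+ 3 <= _); first by rewrite lerXn2r ?nnegrE // (le_trans _ mE).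
  by rewrite exprMn /l -natrX.
rewrite /fail_prob /prob; under eq_bigl => H.
  have -> : `[< certifies k (refuteP k) beta H >] =
    [exists i : 'I_(n ^ k).+1, refuted n k (incidence k H) i b j.+1].
    apply/asboolP/idP => [/(refuteP_accepts k_ge2)|ref].
      by rewrite ltnNge bn /= jE.
    by apply/(refuteP_accepts k_ge2); rewrite jE ref orbT.
  over.
exact: lexx.
Qed.

End FailBound.

Lemma fail_prob_ge0 (R : realType) k A n (p beta : R) : 0 <= p <= 1 ->
  0 <= fail_prob k A n p beta.
Proof. by move=> p01; apply: sumr_ge0 => H _; apply: hweight_ge0. Qed.

Unset Implicit Arguments.

Theorem theoremC4 (R : realType) (k : nat) (hk : (2 <= k)%N) :
  exists (C : R) (A : prog),
    [/\ 0 < C,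
        poly_time_on (encodings k) A,
        forall (n : nat) (beta : R) (H : hypergraph n),
          0 <= beta -> uniform k H -> certifies k A beta H ->
          (alpha H)%:R < beta
      & forall (p beta : nat -> R),
          (forall n, 0 <= p n <= 1) ->
          (\forall n \near \oo,
             n%:R `^ (3 / 4) * ln n%:R <= beta n) ->
          (\forall n \near \oo,
             C * (n%:R `^ ((5 * k)%:R / 2) * ln n%:R ^+ 3 / beta n ^+ (2 * k)) <=
             p n * 'C(n, k)%:R) ->
          (fun n => fail_prob k A n (p n) (beta n)) @ \oo --> (0 : R)].
Proof.
exists (4 ^+ k.+1 * k`!%:R ^+ 2 * 2 ^+ (k + 12)), (refuteP k); split.
- by rewrite !mulr_gt0 ?exprn_gt0 ?ltr0n ?fact_gt0.
- exact: refuteP_poly_time.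
- move=> n beta H b0 _ /(refuteP_accepts hk); rewrite -lt_threshold //.
  case/orP=> [nb|/existsP[r ref]].
    apply: leq_ltn_trans nb; apply/bigmax_leqP => S _.
    by rewrite -[X in (_ <= X)%N](card_ord n) max_card.
  (* For [n = 0] no squaring takes place and the soundness lemma does not apply, but a refutation
     still forces [0 < k <= b], while [alpha H = 0]. *)
  have [n0|n0] := posnP n.
    have := refuted_threshold_ge ref; have := leq_bigmax_cond; move: ref => _ _ kb.
    apply: leq_ltn_trans (_ : _ <= n)%N _; last by rewrite n0; apply: leq_trans kb; apply: ltnW.
    by apply/bigmax_leqP => S _; rewrite -[X in (_ <= X)%N](card_ord n) max_card.
  have [s0 _] := squarings_full n0; rewrite -(prednK s0) in ref.
  exact: (alpha_lt_refuted R hk ref).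
move=> p beta p01 Hb Hp; apply/cvgr0Pnorm_le => e e0; near=> n.
rewrite ger0_norm ?fail_prob_ge0 //.
have n4 : (4 <= n)%N by near: n; exact: nbhs_infty_ge.
have nk : ((2 * k) ^ (2 * k) <= n)%N by near: n; exact: nbhs_infty_ge.
have bn : n%:R `^ (3 / 4) * ln n%:R <= beta n by near: n.
apply: le_trans (fail_prob_le hk n4 nk (p01 n) bn _) _; first by near: n.
(* The terms [1 / ln^3 n] and [1 / n] of the failure bound get one half of [e] each. *)
have e2 : 0 < e / 2 by lra.
have l1 := ln_ge1 R n4; have nR : 0 < n%:R :> R by rewrite ltr0n; lia.
have -> : e = e / 2 + e / 2 by lra.
apply: lerD.
  have h : (e / 2)^-1 <= ln n%:R.
    rewrite -(expRK (e / 2)^-1) ler_ln ?posrE ?expR_gt0 //.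
    by near: n; exact: nbhs_infty_ger.
  rewrite -[leRHS]invrK lef_pV2 ?posrE ?invr_gt0 ?exprn_gt0 //; last lra.
  by apply: le_trans h _; rewrite -[leLHS]expr1 ler_weXn2l.
rewrite -[leRHS]invrK lef_pV2 ?posrE ?invr_gt0 //.
by near: n; exact: nbhs_infty_ger.
Unshelve. all: by end_near.
Qed.
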